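(* Let $A_k\in\mathcal{M}_\alpha^\beta(\Omega)$ be a sequence $G$-converging in $\Omega$ to $A\in\mathcal{M}_\alpha^\beta(\Omega)$, let $f_k$ be a bounded sequence in $H^{-1}(\Omega)$, and let $g\in H^{-1}(\Omega)$ be the limit right-hand side associated with $(A_k,f_k)$ (as defined in the context). Let $U\subset\Omega$ be open. Then the sequence $F_k(\cdot,U)$ $\Gamma$-converges in the weak topology of $H^1_0(U)$ if and only if $\nu'(U)=\nu''(U)$, and in that case the $\Gamma$-limit is given by $$F(v,U)=F_0(v,U)-\nu'(U)=F_0(v,U)-\nu''(U)\quad\text{for every }v\in H^1_0(U).$$
   Context: $\Omega\subset\mathbb{R}^n$, $n\ge1$, is a fixed bounded open set and $0<\alpha\le\beta<+\infty$ are constants. $\mathcal{M}_\alpha^\beta(\Omega)$ is the set of symmetric matrices $A\in[L^\infty(\Omega)]^{n\times n}$ with $\alpha|\xi|^2\le A(x)\xi\cdot\xi\le\beta|\xi|^2$ for a.e. $x\in\Omega$ and every $\xi\in\mathbb{R}^n$. For $U$ bounded open, $H^1_0(U)$ is normed by $\|u\|_{H^1_0(U)}=(\int_U|\nabla u|^2dx)^{1/2}$, $H^{-1}(U)$ is its dual, and $\langle\cdot,\cdot\rangle$ is the duality pairing. If $U\subset\Omega$ is open, functions in $H^1_0(U)$ are extended by $0$ to elements of $H^1_0(\Omega)$, so $\langle f,v\rangle$ makes sense for $f\in H^{-1}(\Omega)$, $v\in H^1_0(U)$. $G$-convergence: $A_k$ $G$-converges to $A$ in $\Omega$ if for every $f\in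 H^{-1}(\Omega)$ the solutions $u_k\in H^1_0(\Omega)$ of $-\mathrm{div}(A_k\nabla u_k)=f$ in $\Omega$ converge weakly in $H^1_0(\Omega)$ to the solution $u\in H^1_0(\Omega)$ of $-\mathrm{div}(A\nabla u)=f$ in $\Omega$. Limit right-hand side: $g\in H^{-1}(\Omega)$ is the limit right-hand side associated with $(A_k,f_k)$ if for every open $U\subset\Omega$ the solutions $u_k^U\in H^1_0(U)$ of $-\mathrm{div}(A_k\nabla u_k^U)=f_k$ in $U$ converge weakly in $H^1_0(U)$ to the solution $u^U\in H^1_0(U)$ of $-\mathrm{div}(A\nabla u^U)=g$ in $U$. (Such a $g$ is known to exist after passing to a subsequence; the paper assumes this subsequence has been extracted.) For $U\subset\Omega$ open and $v\in H^1_0(U)$ set $$F_k(v,U)=\frac12\int_UA_k\nabla v\cdot\nabla v\,dx-\langle f_k,v\rangle,\qquad F_0(v,U)=\frac12\int_UA\nabla v\cdot\nabla v\,dx-\langle g,v\rangle,$$ $$-\nu'(U)=\inf_{v_k\in H^1_0(U),\,v_k\rightharpoonup0}\ \liminf_{k\to\infty}F_k(v_k,U),\qquad -\nu''(U)=\inf_{v_k\in H^1_0(U),\,v_k\rightharpoonup0}\ \limsup_{k\to\infty}F_k(v_k,U),$$ where the infima are over sequences converging to $0$ weakly in $H^1_0(U)$. $\Gamma$-convergence in the weak topology of $H^1_0(U)$: the $\Gamma$-$\liminf$ and $\Gamma$-$\limsup$ at $v$ are $\sup_N\liminf_k\inf_{w\in N}F_k(w,U)$ and $\sup_N\limsup_k\inf_{w\in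 N}F_k(w,U)$, with $N$ ranging over weak neighbourhoods of $v$; $F_k(\cdot,U)$ $\Gamma$-converges if they coincide for every $v$, their common value being the $\Gamma$-limit $F(\cdot,U)$. Since these functionals are equi-coercive, these quantities are equivalently the infima of $\liminf_kF_k(v_k,U)$ and of $\limsup_kF_k(v_k,U)$ over all sequences $v_k\rightharpoonup v$ weakly in $H^1_0(U)$. *)

(* Defs.v *)
From HB Require Import structures.
From mathcomp Require Import all_boot all_order all_algebra.
From mathcomp Require Import all_classical all_reals all_analysis.

Set Implicit Arguments.
Unset Strict Implicit.
Unset Printing Implicit Defensive.
Import Order.TTheory GRing.Theory Num.Theory.
Import numFieldNormedType.Exports.

Local Open Scope classical_set_scope.
Local Open Scope ring_scope.

Section row_measurable.
Variables (R : realType) (n : nat).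

Let coord (i : 'I_n) (x : 'rV[R]_n) : measurableTypeR R := x ord0 i.

Let rV_set0 : g_sigma_preimage coord set0.
Proof. exact: sigma_algebra0. Qed.

Let rV_setC A : g_sigma_preimage coord A -> g_sigma_preimage coord (~` A).
Proof. exact: sigma_algebraC. Qed.

Let rV_bigcup (F : (set 'rV[R]_n)^nat) :
  (forall i, g_sigma_preimage coord (F i)) ->
  g_sigma_preimage coord (\bigcup_i F i).
Proof. exact: sigma_algebra_bigcup. Qed.

HB.instance Definition _ := @isMeasurable.Build default_measure_display
  'rV[R]_n (g_sigma_preimage coord) rV_set0 rV_setC rV_bigcup.

Lemma measurable_coord (i : 'I_n) :
  measurable_fun [set: 'rV[R]_n] (fun x => x ord0 i).
Proof.
move=> _ Y mY; rewrite setTI; apply: sub_sigma_algebra => /=.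
rewrite -bigcup_seq/=; exists i => /=; first by rewrite mem_index_enum.
by exists Y => //; rewrite setTI.
Qed.

Lemma measurable_fun_coordP d (T : measurableType d) (f : T -> 'rV[R]_n) :
  (forall i, measurable_fun [set: T] (fun t => f t ord0 i)) ->
  measurable_fun [set: T] f.
Proof.
move=> mf _ A /= mA; rewrite setTI.
suff: g_sigma_preimage coord `<=`
    [set B | @measurable _ T (f @^-1` B)] by exact.
apply: smallest_sub; first split => /=.
- by rewrite preimage_set0.
- by move=> B mB; rewrite setTD preimage_setC; exact: measurableC.
- by move=> F mF; rewrite preimage_bigcup; exact: bigcup_measurable.
- rewrite -bigcup_seq/= => B [i _ [Y mY <-]] /=.
  by rewrite setTI; have := mf i measurableT Y mY; rewrite setTI.
Qed.

End row_measurable.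

Section lebesgue_rV.
Variable R : realType.
Local Open Scope ereal_scope.

Definition rV_cons n (p : measurableTypeR R * 'rV[R]_n) : 'rV[R]_n.+1 :=
  row_mx (p.1%:M : 'rV[R]_1) p.2.

Definition rV_uncons n (x : 'rV[R]_n.+1) : measurableTypeR R * 'rV[R]_n :=
  (x ord0 ord0, rsubmx (x : 'rV[R]_(1 + n))).

Lemma rV_cons0 n p : @rV_cons n p ord0 ord0 = p.1.
Proof.
have -> : (ord0 : 'I_n.+1) = lshift n (ord0 : 'I_1) by exact: val_inj.
by rewrite (@row_mxEl R 1 1 n) mxE eqxx mulr1n.
Qed.

Lemma rV_consS n p j : @rV_cons n p ord0 (lift ord0 j) = p.2 ord0 j.
Proof.
have -> : lift ord0 j = rshift 1 j by exact: val_inj.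
by rewrite (@row_mxEr R 1 1 n).
Qed.

Lemma rV_uncons2 n x j : (@rV_uncons n x).2 ord0 j = x ord0 (lift ord0 j).
Proof. by rewrite mxE; congr (x _ _); exact: val_inj. Qed.

Lemma rV_consK n : cancel (@rV_cons n) (@rV_uncons n).
Proof.
move=> [x t]; rewrite [LHS]surjective_pairing; congr pair.
  exact: rV_cons0.
by apply/rowP => j; rewrite rV_uncons2 rV_consS.
Qed.

Lemma rV_unconsK n : cancel (@rV_uncons n) (@rV_cons n).
Proof.
move=> x; apply/rowP => i; case: (unliftP ord0 i) => [j ->|->].
  by rewrite rV_consS rV_uncons2.
by rewrite rV_cons0.
Qed.

Lemma measurable_rV_cons n : measurable_fun [set: _] (@rV_cons n).
Proof.
apply: measurable_fun_coordP => i; case: (unliftP ord0 i) => [j ->|->].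
  under eq_fun do rewrite rV_consS.
  exact: (measurableT_comp (measurable_coord j) measurable_snd).
under eq_fun do rewrite rV_cons0.
exact: measurable_fst.
Qed.

Lemma measurable_rV_uncons n : measurable_fun [set: _] (@rV_uncons n).
Proof.
apply/measurable_fun_pairP; split; first exact: measurable_coord.
apply: measurable_fun_coordP => i.
under eq_fun do rewrite rV_uncons2.
exact: measurable_coord.
Qed.

Section step.
Variables (n : nat) (m : {sigma_finite_measure set 'rV[R]_n -> \bar R}).

Definition lebesgue_rV_step : set 'rV[R]_n.+1 -> \bar R :=
  pushforward ((@lebesgue_measure R) \x m) (@rV_cons n).

Let step_preimage A : measurable A -> measurable (@rV_cons n @^-1` A).
Proof.
by move=> mA; rewrite -[X in measurable X]setTI; exact: measurable_rV_cons.
Qed.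

Let step0 : lebesgue_rV_step set0 = 0.
Proof. by rewrite /lebesgue_rV_step /pushforward preimage_set0 measure0. Qed.

Let step_ge0 A : 0 <= lebesgue_rV_step A.
Proof. by rewrite /lebesgue_rV_step /pushforward measure_ge0. Qed.

Let step_sigma_additive : semi_sigma_additive lebesgue_rV_step.
Proof.
move=> F mF tF mUF; rewrite /lebesgue_rV_step /pushforward preimage_bigcup.
apply: measure_semi_sigma_additive => [k||]; first exact: step_preimage.
- apply/trivIsetP => /= i j _ _ ij; rewrite -preimage_setI.
  by move/trivIsetP : tF => /(_ _ _ _ _ ij) ->//; rewrite preimage_set0.
- by rewrite -preimage_bigcup; exact: step_preimage.
Qed.

HB.instance Definition _ := isMeasure.Build _ _ _ lebesgue_rV_step
  step0 step_ge0 step_sigma_additive.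

Let step_sigma_finite : sigma_finite setT lebesgue_rV_step.
Proof.
have /sigma_finiteP[F [TF ndF Foo]] := sigma_finiteT (@lebesgue_measure R).
have /sigma_finiteP[G [TG ndG Goo]] := sigma_finiteT m.
exists (fun k => @rV_uncons n @^-1` (F k `*` G k)) => [|k].
  rewrite -preimage_bigcup (_ : \bigcup_k _ = setT) ?preimage_setT//.
  rewrite -setXTT TF TG predeqE => -[x y]; split.
    by move=> [k _ []/= ? ?]; split; exists k.
  move=> [/= [k _ Fkx] [l _ Gly]]; exists (maxn k l) => //; split.
  - by move: x Fkx; exact/subsetPset/ndF/leq_maxl.
  - by move: y Gly; exact/subsetPset/ndG/leq_maxr.
have [mF Fk] := Foo k; have [mG Gk] := Goo k; split.
  rewrite -[X in measurable X]setTI; apply: measurable_rV_uncons => //.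
  exact: measurableX.
rewrite /lebesgue_rV_step /pushforward -comp_preimage.
rewrite (_ : _ \o _ = id); last by apply/funext; exact: rV_consK.
by rewrite product_measure1E// lte_mul_pinfty// ge0_fin_numE.
Qed.

HB.instance Definition _ := Measure_isSigmaFinite.Build _ _ _
  lebesgue_rV_step step_sigma_finite.

End step.

(* Lebesgue measure on R^n, as the iterated product of the one-dimensional
   Lebesgue measure; lebesgue_rV_box gives its value on boxes. *)
Fixpoint lebesgue_rV n : {sigma_finite_measure set 'rV[R]_n -> \bar R} :=
  match n with
  | 0 => \d_(0%R : 'rV[R]_0)
  | n'.+1 => lebesgue_rV_step (lebesgue_rV n')
  end.

Lemma lebesgue_rV_box n (a b : 'rV[R]_n) :
  (forall i, a ord0 i <= b ord0 i)%R ->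
  lebesgue_rV n [set x | forall i, (a ord0 i < x ord0 i <= b ord0 i)%R] =
  (\prod_i (b ord0 i - a ord0 i))%:E.
Proof.
elim: n a b => [|n IH] a b ab.
  rewrite big_ord0/= diracE mem_set//= => i; by case: i.
pose a' := (rV_uncons a).2; pose b' := (rV_uncons b).2.
rewrite /= /lebesgue_rV_step /pushforward /=.
have -> : rV_cons (n:=n) @^-1`
    [set x | forall i, (a ord0 i < x ord0 i <= b ord0 i)%R] =
    (`]a ord0 ord0, b ord0 ord0]%classic `*`
    [set x : 'rV[R]_n | forall i, (a' ord0 i < x ord0 i <= b' ord0 i)%R]).
  apply/seteqP; split=> [p /= H|p /= [H1 H2] i].
    split; first by have := H ord0; rewrite rV_cons0 in_itv.
    by move=> i; have := H (lift ord0 i); rewrite rV_consS !rV_uncons2.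
  case: (unliftP ord0 i) => [j ->|->].
    by have := H2 j; rewrite rV_consS !rV_uncons2.
  by move: H1; rewrite rV_cons0 in_itv.
rewrite product_measure1E//; last first.
  rewrite (_ : mkset _ = \bigcap_(i in [set: 'I_n])
      [set x : 'rV[R]_n | x ord0 i \in `]a' ord0 i, b' ord0 i]]); last first.
    by apply/seteqP; split => x /= H i; [move=> _|]; have := H i;
      rewrite /= in_itv/=; [|apply].
  apply: fin_bigcap_measurable => // i _.
  have := @measurable_coord R n i measurableT `]a' ord0 i, b' ord0 i]%classic.
  by rewrite setTI; apply.
rewrite IH; last by move=> i; rewrite !rV_uncons2.
rewrite big_ord_recl EFinM; congr *%E.
  rewrite /= lebesgue_measure_itv/= lte_fin.
  case: (ltgtP (a ord0 ord0)) (ab ord0) => // -> _.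
  by rewrite subrr.
by congr EFin; apply: eq_bigr => i _; rewrite !rV_uncons2.
Qed.

End lebesgue_rV.

Section sobolev.
Variables (R : realType) (n : nat).
Local Notation mu := (lebesgue_rV R n).

Definition dotp (u v : 'rV[R]_n) : R := \sum_i u ord0 i * v ord0 i.

Definition apply_mx (M : 'M[R]_n) (xi : 'rV[R]_n) : 'rV[R]_n :=
  (M *m xi^T)^T.

Definition partial (i : 'I_n) (phi : 'rV[R]_n -> R) : 'rV[R]_n -> R :=
  fun x => 'D_(delta_mx ord0 i) phi x.

Definition gradient (phi : 'rV[R]_n -> R) : 'rV[R]_n -> 'rV[R]_n :=
  fun x => \row_i partial i phi x.

Definition smooth (phi : 'rV[R]_n -> R) :=
  forall s : seq 'I_n, let psi := foldr partial phi s in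
    continuous psi /\ forall i x, derivable psi x (delta_mx ord0 i).

Definition test_function (U : set 'rV[R]_n) (phi : 'rV[R]_n -> R) :=
  [/\ smooth phi, compact (closure [set x | phi x != 0]) &
      closure [set x | phi x != 0] `<=` U].

(* A Sobolev function is represented by a pair (u, Du), where Du is a
   representative of the weak gradient of u; Du is determined by u almost
   everywhere. The vector space operations are those of the product of function
   spaces. *)
Definition sobolev_pair : Type :=
  (('rV[R]_n -> R) * ('rV[R]_n -> 'rV[R]_n))%type.

HB.instance Definition _ := GRing.Lmodule.on sobolev_pair.

Definition weak_gradient (U : set 'rV[R]_n) (u : sobolev_pair) :=
  forall phi, test_function U phi -> forall i,
    \int[mu]_(x in U) (u.1 x * partial i phi x) =
    - \int[mu]_(x in U) (u.2 x ord0 i * phi x).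

(* Functions on U are extended by 0 to the whole space, together with their
   gradient, so that being in L^2(U) is being in L^2 of the whole space. *)
Definition H1 (U : set 'rV[R]_n) : set sobolev_pair :=
  [set u : sobolev_pair |
    [/\ u.1 \in Lfun mu 2%:E,
        forall i, (fun x => u.2 x ord0 i) \in Lfun mu 2%:E,
        forall x, ~ U x -> u.1 x = 0 /\ u.2 x = 0 &
        weak_gradient U u]].

Definition H1_norm (U : set 'rV[R]_n) (u : sobolev_pair) : R :=
  Num.sqrt (\int[mu]_(x in U) (u.1 x ^+ 2)
            + \int[mu]_(x in U) dotp (u.2 x) (u.2 x)).

(* The closure in H^1(U) of the test functions. Thanks to the extension by 0,
   H10 U is contained in H10 V for U contained in V. *)
Definition H10 (U : set 'rV[R]_n) : set sobolev_pair :=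
  [set u | H1 U u /\ exists phi : nat -> 'rV[R]_n -> R,
    (forall k, test_function U (phi k)) /\
    (fun k => H1_norm U (u - (phi k, gradient (phi k)))) @ \oo --> 0].

Definition H10_norm (U : set 'rV[R]_n) (u : sobolev_pair) : R :=
  Num.sqrt (\int[mu]_(x in U) dotp (u.2 x) (u.2 x)).

(* The dual of H10 U: only the values on H10 U matter. Boundedness for the
   H10 norm forces invariance under almost everywhere equality. With this
   encoding, restricting an element of the dual of H10 V to H10 U, for U
   contained in V, does not change the functional. *)
Definition Hm1 (U : set 'rV[R]_n) : set (sobolev_pair -> R) :=
  [set f | (forall (a : R) u v, H10 U u -> H10 U v ->
              f (a *: u + v) = a * f u + f v) /\
           exists C, forall u, H10 U u -> `|f u| <= C * H10_norm U u].

Definition Hm1_norm (U : set 'rV[R]_n) (f : sobolev_pair -> R) : R :=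
  sup [set `|f u| | u in [set u | H10 U u /\ H10_norm U u <= 1]].

Definition weak_cvg (U : set 'rV[R]_n) (u_ : nat -> sobolev_pair)
    (u : sobolev_pair) :=
  forall h, Hm1 U h -> (fun k => h (u_ k)) @ \oo --> h u.

Definition weak_nbhs (U : set 'rV[R]_n) (v : sobolev_pair) :
    set (set sobolev_pair) :=
  [set N | N `<=` H10 U /\
    exists (m : nat) (h : 'I_m -> sobolev_pair -> R) (e : R),
      [/\ forall i, Hm1 U (h i), 0 < e &
          forall w, H10 U w -> (forall i, `|h i w - h i v| < e) -> N w]].

(* The class M_alpha^beta(Om). *)
Definition coefficient_class (Om : set 'rV[R]_n) (alpha beta : R)
    (A : 'rV[R]_n -> 'M[R]_n) :=
  [/\ forall i j, ((fun x => A x i j) \_ Om) \in Lfun mu +oo%E,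
      {ae mu, forall x, Om x -> (A x)^T = A x} &
      {ae mu, forall x, Om x -> forall xi,
        alpha * dotp xi xi <= dotp (apply_mx (A x) xi) xi <=
        beta * dotp xi xi}].

Definition bilin (A : 'rV[R]_n -> 'M[R]_n) (U : set 'rV[R]_n)
    (u v : sobolev_pair) : R :=
  \int[mu]_(x in U) dotp (apply_mx (A x) (u.2 x)) (v.2 x).

(* Weak form of - div (A grad u) = f in U. *)
Definition solution (A : 'rV[R]_n -> 'M[R]_n) (f : sobolev_pair -> R)
    (U : set 'rV[R]_n) (u : sobolev_pair) :=
  H10 U u /\ forall v, H10 U v -> bilin A U u v = f v.

(* Solutions exist and are unique up to almost everywhere equality
   (Lax-Milgram), hence the quantification over all families of solutions. *)
Definition G_cvg (Om : set 'rV[R]_n) (A_ : nat -> 'rV[R]_n -> 'M[R]_n)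
    (A : 'rV[R]_n -> 'M[R]_n) :=
  forall f, Hm1 Om f -> forall u_ u,
    (forall k, solution (A_ k) f Om (u_ k)) -> solution A f Om u ->
    weak_cvg Om u_ u.

Definition limit_rhs (Om : set 'rV[R]_n) (A_ : nat -> 'rV[R]_n -> 'M[R]_n)
    (A : 'rV[R]_n -> 'M[R]_n) (f_ : nat -> sobolev_pair -> R)
    (g : sobolev_pair -> R) :=
  Hm1 Om g /\ forall U, open U -> U `<=` Om -> forall u_ u,
    (forall k, solution (A_ k) (f_ k) U (u_ k)) -> solution A g U u ->
    weak_cvg U u_ u.

Definition energy (A : 'rV[R]_n -> 'M[R]_n) (f : sobolev_pair -> R)
    (U : set 'rV[R]_n) (v : sobolev_pair) : R :=
  2^-1 * bilin A U v v - f v.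

Section functionals.
Variables (U : set 'rV[R]_n) (F_ : nat -> sobolev_pair -> R).
Local Open Scope ereal_scope.

Definition weakly_null : set (nat -> sobolev_pair) :=
  [set v_ | (forall k, H10 U (v_ k)) /\ weak_cvg U v_ 0%R].

Definition nu' : \bar R :=
  - ereal_inf [set limn_einf (fun k => (F_ k (v_ k))%:E) | v_ in weakly_null].

Definition nu'' : \bar R :=
  - ereal_inf [set limn_esup (fun k => (F_ k (v_ k))%:E) | v_ in weakly_null].

Definition Gamma_liminf (v : sobolev_pair) : \bar R :=
  ereal_sup [set limn_einf (fun k => ereal_inf [set (F_ k w)%:E | w in N])
            | N in weak_nbhs U v].

Definition Gamma_limsup (v : sobolev_pair) : \bar R :=
  ereal_sup [set limn_esup (fun k => ereal_inf [set (F_ k w)%:E | w in N])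
            | N in weak_nbhs U v].

Definition Gamma_cvg :=
  forall v, H10 U v -> Gamma_liminf v = Gamma_limsup v.

Definition Gamma_limit (F : sobolev_pair -> \bar R) :=
  forall v, H10 U v -> Gamma_liminf v = F v /\ Gamma_limsup v = F v.

End functionals.

End sobolev.

(* Main.v *)
(* Put a_k(u, v) = int A_k grad u . grad v, and a(u, v) likewise for A. For v in
   H^1_0(U) let z_k in H^1_0(U) solve a_k(z_k, .) = a(v, .) on H^1_0(U). Then
   z_k converges weakly to v, and for every weakly null y_k
     F_k(z_k + y_k, U) - F_k(y_k, U)
       = a(v, z_k) / 2 + a(v, y_k) - a(v, w_k) -> F_0(v, U),
   where w_k is the solution with right-hand side f_k in U, whose weak limit is
   known by the definition of g: indeed f_k(z_k) = a_k(w_k, z_k) = a(v, w_k).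
   Hence translation by z_k turns the sequences converging weakly to 0 into
   those converging weakly to v, and the Gamma-liminf and Gamma-limsup at v are
   F_0(v, U) - nu'(U) and F_0(v, U) - nu''(U).

   The convergence z_k -> v is the locality of G-convergence. If y_k solves the
   same problem in Om then y_k -> v weakly by definition. By Cea's lemma z_k is
   at least as close to y_k, in energy, as the element eta y_k of H^1_0(U), and
   y_k - eta y_k is small by a Caccioppoli identity when v is a test function of
   U and eta is a logarithmic cutoff at the zeros of v.

   Weak neighbourhoods are turned into sequences by equi-coercivity and
   Rellich's theorem, in the form: for every e > 0 the square of the L^2 norm is
   bounded by e times the energy plus finitely many squares of linear forms. *)
Require Import Defs.
From mathcomp Require Import all_boot all_order all_algebra.
From mathcomp Require Import all_classical all_reals all_analysis.
From mathcomp Require Import measurable_realfun ess_sup_inf.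
From mathcomp Require Import ring lra.
Import Order.TTheory GRing.Theory Num.Theory.
Import numFieldNormedType.Exports.
Local Open Scope classical_set_scope.
Local Open Scope ring_scope.
Set Implicit Arguments.
Unset Strict Implicit.
Unset Printing Implicit Defensive.

(** * Positive semidefinite forms and the space L^2 *)

(** Pairs are representatives rather than classes modulo almost everywhere equality, so the energy
    forms are only semidefinite: Cauchy-Schwarz, Riesz and completeness are developed for
    semidefinite forms on a subset X, and limits or solutions are determined up to zero energy.

    The translation is by z_k and not by v because a_k(v, y_k) need not tend to 0 for weakly null
    y_k, whereas a_k(z_k, y_k) = a(v, y_k) does.

    In the locality step, the identity of Caccioppoli rewrites the energy of y_k - eta y_k as a(v,
    (1 - eta)^2 y_k), a fixed continuous functional of y_k, plus a term that contains y_k but not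
    its gradient. The first converges by weak convergence, the second by Rellich. Their common limit
    is the same expression at v, which is made small by choosing eta. The cutoff is a polynomial in
    v^2, hence smooth, with support inside that of v.

    Sequences of bounded energy are shown to be weakly null by showing that they tend to 0 in
    L^2. *)

Section form.
Context (R : realType) (V : lmodType R) (X : set V) (a : V -> V -> R).

(** Bilinearity and symmetry are asked on X only: the forms below are integrals, whose linearity
    holds for square integrable arguments. *)
Definition psd_form :=
  [/\ X 0, forall (c : R) u v, X u -> X v -> X (c *: u + v),
      forall (c : R) u v w, X u -> X v -> X w -> a (c *: u + v) w = c * a u w + a v w,
      forall u v, X u -> X v -> a u v = a v u &
      forall u, X u -> 0 <= a u u].

Hypothesis aP : psd_form.

Let XP : forall (c : R) u v, X u -> X v -> X (c *: u + v).
Proof. by case: aP. Qed.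

Lemma psdX0 : X 0. Proof. by case: aP. Qed.

Lemma psdXZ c u : X u -> X (c *: u).
Proof. by move=> Xu; rewrite -[_ *: _]addr0; apply: XP => //; exact: psdX0. Qed.

Lemma psdXD u v : X u -> X v -> X (u + v).
Proof. by move=> Xu Xv; rewrite -[u]scale1r; exact: XP. Qed.

Lemma psdXB u v : X u -> X v -> X (u - v).
Proof. by move=> Xu Xv; rewrite addrC -scaleN1r; exact: XP. Qed.

Lemma psdC u v : X u -> X v -> a u v = a v u.
Proof. by case: aP => _ _ _ + _; apply. Qed.

Lemma psd_ge0 u : X u -> 0 <= a u u.
Proof. by case: aP => _ _ _ _; apply. Qed.

Lemma psdDl u v w : X u -> X v -> X w -> a (u + v) w = a u w + a v w.
Proof.
case: aP => _ _ + _ _; move=> /(_ 1 u v w) H Xu Xv Xw.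
by move: H; rewrite scale1r mul1r; apply.
Qed.

Lemma psd0l w : X w -> a 0 w = 0.
Proof.
move=> Xw; have := psdDl psdX0 psdX0 Xw; rewrite addr0 => /eqP.
by rewrite -subr_eq0 opprD addrA subrr add0r oppr_eq0 => /eqP.
Qed.

Lemma psdZl c u w : X u -> X w -> a (c *: u) w = c * a u w.
Proof.
case: (aP) => X0 _ + _ _; move=> /(_ c u 0 w) H Xu Xw.
by move: H; rewrite addr0 psd0l// addr0; apply.
Qed.

Lemma psdBl u v w : X u -> X v -> X w -> a (u - v) w = a u w - a v w.
Proof.
move=> Xu Xv Xw; rewrite -scaleN1r psdDl ?psdZl ?mulN1r//; exact: psdXZ.
Qed.

Lemma psdDr u v w : X u -> X v -> X w -> a w (u + v) = a w u + a w v.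
Proof.
by move=> Xu Xv Xw; rewrite psdC ?psdDl ?[a u w]psdC ?[a v w]psdC//; exact: psdXD.
Qed.

Lemma psdZr c u w : X u -> X w -> a w (c *: u) = c * a w u.
Proof. by move=> Xu Xw; rewrite psdC ?psdZl ?[a u w]psdC//; exact: psdXZ. Qed.

Lemma psdBr u v w : X u -> X v -> X w -> a w (u - v) = a w u - a w v.
Proof.
by move=> Xu Xv Xw; rewrite psdC ?psdBl ?[a u w]psdC ?[a v w]psdC//; exact: psdXB.
Qed.

Lemma psd_sqrD u v : X u -> X v ->
  a (u + v) (u + v) = a u u + 2 * a u v + a v v.
Proof.
move=> Xu Xv; rewrite psdDl// ?psdDr// ?[a v u]psdC//; first ring.
exact: psdXD.
Qed.

Lemma psd_sqrB u v : X u -> X v ->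
  a (u - v) (u - v) = a u u - 2 * a u v + a v v.
Proof.
move=> Xu Xv; rewrite psdBl// ?psdBr// ?[a v u]psdC//; first ring.
exact: psdXB.
Qed.

Lemma psd_sqrZ c u : X u -> a (c *: u) (c *: u) = c ^+ 2 * a u u.
Proof.
by move=> Xu; rewrite psdZl ?psdZr ?mulrA//; exact: psdXZ.
Qed.

Lemma psd_sqrD_le u v : X u -> X v ->
  a (u + v) (u + v) <= 2 * a u u + 2 * a v v.
Proof.
move=> Xu Xv; have := psd_ge0 (psdXB Xu Xv).
by rewrite psd_sqrB// psd_sqrD//; lra.
Qed.

Lemma psd_sqrB_le u v : X u -> X v ->
  a (u - v) (u - v) <= 2 * a u u + 2 * a v v.
Proof.
move=> Xu Xv; rewrite -scaleN1r (le_trans (psd_sqrD_le Xu (psdXZ _ Xv)))//.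
by rewrite psd_sqrZ// sqrrN expr1n mul1r.
Qed.

(** A discriminant bound with an error e. Evaluating at - b / (c + 1) instead of - b / c covers c =
    0. *)
Lemma quad_ge_discr (b c e : R) : 0 <= c ->
  (forall t, - e <= 2 * t * b + t ^+ 2 * c) -> b ^+ 2 <= e * (c + 1).
Proof.
move=> c0 /(_ (- b / (c + 1))) H.
have c1 : c + 1 != 0 by lra.
have : - e <= - b ^+ 2 / (c + 1).
  apply: (le_trans H); rewrite -subr_ge0.
  rewrite (_ : _ - _ = (b / (c + 1)) ^+ 2); first exact: sqr_ge0.
  by field.
by rewrite ler_pdivlMr ?mulNr ?lerN2//; lra.
Qed.

Lemma psd_CauchySchwarz u v : X u -> X v -> a u v ^+ 2 <= a u u * a v v.
Proof.
move=> Xu Xv.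
have Q t : 0 <= a u u + 2 * t * a u v + t ^+ 2 * a v v.
  have := psd_ge0 (psdXD Xu (psdXZ t Xv)).
  by rewrite psd_sqrD ?psd_sqrZ ?psdZr//; [lra|exact: psdXZ].
have [av0|avn0] := eqVneq (a v v) 0.
  have := psd_ge0 Xu => au0.
  have [->|h] := eqVneq (a u v) 0; first by rewrite av0 expr0n mulr0.
  (* The quadratic has degenerated to an affine function of t, which takes the value -1 at this
     point. *)
  have := Q (- (a u u + 1) / (2 * a u v)); rewrite av0 mulr0 addr0.
  rewrite (_ : 2 * _ * _ = - (a u u + 1)); last by field.
  by rewrite opprD addrA subrr; lra.
have v0 : 0 < a v v by rewrite lt_neqAle eq_sym avn0 psd_ge0.
have := Q (- a u v / a v v).
rewrite (_ : _ + _ = a u u - a u v ^+ 2 / a v v); last by field.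
by rewrite subr_ge0 ler_pdivrMr.
Qed.

Definition psd_complete := forall u_ : nat -> V, (forall k, X (u_ k)) ->
  (forall e : R, 0 < e -> exists N, forall i j, (N <= i)%N -> (N <= j)%N ->
     a (u_ i - u_ j) (u_ i - u_ j) <= e) ->
  exists2 u, X u & (fun k => a (u_ k - u) (u_ k - u)) @ \oo --> (0 : R).

Lemma cvg_psd_left u_ u v : (forall k, X (u_ k)) -> X u -> X v ->
  (fun k => a (u_ k - u) (u_ k - u)) @ \oo --> (0 : R) ->
  (fun k => a (u_ k) v) @ \oo --> a u v.
Proof.
move=> Xu_ Xu Xv cu.
apply/cvgrPdist_le => e e0.
have e'0 : 0 < e ^+ 2 / (a v v + 1).
  by rewrite divr_gt0 ?exprn_gt0//; have := psd_ge0 Xv; lra.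
have /cvgrPdist_le/(_ _ e'0) := cu.
apply: filterS => k; rewrite sub0r normrN => H.
rewrite distrC -psdBl// -ler_sqr ?nnegrE// ?(ltW e0)// real_normK ?num_real//.
have CS := psd_CauchySchwarz (psdXB (Xu_ k) Xu) Xv.
apply: (le_trans CS).
have v0 := psd_ge0 Xv.
have := le_trans (ler_norm _) H; rewrite ler_pdivlMr; last lra.
have := psd_ge0 (psdXB (Xu_ k) Xu).
by nra.
Qed.

(** The representative minimises J u = a u u - 2 h u. The bound on h ^ 2 makes J bounded below and
    forces h to vanish where a does. *)
Lemma psd_riesz (h : V -> R) (C : R) : psd_complete ->
  (forall (c : R) u v, X u -> X v -> h (c *: u + v) = c * h u + h v) ->
  (forall u, X u -> h u ^+ 2 <= C * a u u) ->
  exists2 u, X u & forall v, X v -> a u v = h v.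
Proof.
move=> cX hP hC.
have hD u v : X u -> X v -> h (u + v) = h u + h v.
  by move=> Xu Xv; rewrite -[u in LHS]scale1r hP ?mul1r.
have h0 : h 0 = 0.
  by have := hD _ _ psdX0 psdX0; rewrite addr0 => /eqP; rewrite -subr_eq0 opprD addrA subrr add0r oppr_eq0 => /eqP.
have hZ c u : X u -> h (c *: u) = c * h u.
  by move=> Xu; rewrite -[c *: u]addr0 hP ?h0 ?addr0//; exact: psdX0.
pose J u := a u u - 2 * h u.
have J_lb u : X u -> - `|C| <= J u.
  move=> Xu; have u0 := psd_ge0 Xu.
  have := hC _ Xu; have := ler_norm C; rewrite /J; set c := `|C| => Cc hCu.
  have c0 : 0 <= c by rewrite normr_ge0.
  have : h u ^+ 2 <= c * a u u by apply: (le_trans hCu); nra.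
  move=> hu.
  (* Because (2 h u)^2 <= 4 c a u u <= (a u u + c)^2. *)
  suff : `|2 * h u| <= a u u + c by move/(le_trans (ler_norm _)); lra.
  rewrite -ler_sqr ?nnegrE ?addr_ge0// real_normK ?num_real//.
  have := sqr_ge0 (a u u - c); nra.
pose S := [set J u | u in X].
have infS : has_inf S.
  split; first by exists (J 0), 0 => //; exact: psdX0.
  by exists (- `|C|) => _ [u Xu <-]; exact: J_lb.
have /choice [u_ u_P] : forall k : nat, exists u, X u /\ J u < inf S + k.+1%:R^-1.
  move=> k; have k0 : 0 < (k.+1%:R^-1 : R) by rewrite invr_gt0.
  have [_ [u Xu <-] H] := inf_adherent k0 infS.
  by exists u.
have Xu_ k : X (u_ k) by case: (u_P k).
have Jinf u : X u -> inf S <= J u.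
  by move=> Xu; apply: ge_inf => //; [case: infS|exists u].
have [u Xu cu] : exists2 u, X u & (fun k => a (u_ k - u) (u_ k - u)) @ \oo --> (0 : R).
  apply: cX => // e e0.
  have e40 : 0 < e / 4 by lra.
  have [N _ HN] := near_infty_natSinv_lt (PosNum e40).
  exists N => i j Ni Nj.
  have := HN i Ni; have := HN j Nj => /= Hj Hi.
  have [_ Ji] := u_P i; have [_ Jj] := u_P j.
  (* Parallelogram identity: the form at u_i - u_j is 2 J(u_i) + 2 J(u_j) - 4 J(midpoint), at most 2
     (e / 4 + e / 4). *)
  have Xm : X (2^-1 *: (u_ i + u_ j)) by apply/psdXZ/psdXD.
  have := Jinf _ Xm.
  rewrite psd_sqrB// /J psd_sqrZ ?hZ ?psd_sqrD ?hD//; try exact: psdXD.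
  rewrite (_ : 2^-1 ^+ 2 = 4^-1 :> R); last by field.
  move: Ji Jj Hi Hj; rewrite /J.
  set x := i.+1%:R^-1; set y := j.+1%:R^-1; set s := inf S.
  move: (a _ _) (a _ _) (a _ _) (h _) (h _) => *; lra.
exists u => // v Xv.
(* Since u_k minimises J up to 1 / (k + 1), the quadratic t |-> J(u_k + t v) - J(u_k) is at least -
   1 / (k + 1), and [quad_ge_discr] bounds its linear coefficient. *)
have H k : (a (u_ k) v - h v) ^+ 2 <= k.+1%:R^-1 * (a v v + 1).
  apply: quad_ge_discr; first exact: psd_ge0.
  move=> t; have [_ Jk] := u_P k.
  have := Jinf _ (psdXD (Xu_ k) (psdXZ t Xv)).
  rewrite /J psd_sqrD ?hD ?hZ ?psd_sqrZ ?psdZr//; try exact: psdXZ.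
  move: Jk; rewrite /J; set x := k.+1%:R^-1; set s := inf S.
  move: (a _ _) (a _ _) (a _ _) (h _) (h _) => *; lra.
have c1 := cvg_psd_left Xu_ Xu Xv cu.
have c2 : (fun k => (a (u_ k) v - h v) ^+ 2) @ \oo --> (a u v - h v) ^+ 2.
  by apply: cvgM; apply: cvgB => //; exact: cvg_cst.
have c3 : (fun k : nat => k.+1%:R^-1 * (a v v + 1)) @ \oo --> 0 * (a v v + 1).
  by apply: cvgM; [exact: cvg_harmonic|exact: cvg_cst].
have : (a u v - h v) ^+ 2 <= 0.
  by rewrite -(mul0r (a v v + 1)); apply: (ler_cvg_to c2 c3); apply: nearW.
by move=> H0; apply/eqP; rewrite -subr_eq0 -sqrf_eq0 eq_le H0 sqr_ge0.
Qed.

End form.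

(** * The space L^2: products and completeness *)

Section L2.
Context d (T : measurableType d) (R : realType).
Variable mu : {measure set T -> \bar R}.
Implicit Types f g : T -> R.

Local Notation L2 := (Lfun mu 2%:E).

Definition ip f g : R := \int[mu]_x (f x * g x).

Lemma L2_measurable f : f \in L2 -> measurable_fun setT f.
Proof. by rewrite inE => /andP[/[!inE]]. Qed.

Lemma L2P f : f \in L2 <->
  measurable_fun setT f /\ (\int[mu]_x (f x ^+ 2)%:E < +oo)%E.
Proof.
split=> [fL2|[mf foo]].
  split; first exact: L2_measurable.
  have /integrableP[_] := Lfun2_integrable_sqr fL2.
  by under eq_integral do rewrite /= ger0_norm ?sqr_ge0//.
rewrite inE/=; apply/andP; split; first by rewrite inE.
rewrite inE/= /finite_norm unlock poweR_lty//.
under eq_integral => x _ do rewrite /= powR_mulrn ?normr_ge0// real_normK ?num_real//.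
by [].
Qed.

Lemma L2_0 : (0 : T -> R) \in L2.
Proof.
apply/L2P; split; first exact: measurable_cst.
by under eq_integral do rewrite expr0n/=; rewrite integral0 ltry.
Qed.

Lemma L2_lin (c : R) f g : f \in L2 -> g \in L2 -> (c *: f + g) \in L2.
Proof.
move=> fL gL; have := @Lfun_submod_closed _ _ _ mu 2%:E (lee1n 2).
by case=> _; apply.
Qed.

Lemma L2_Z (c : R) f : f \in L2 -> (c *: f) \in L2.
Proof. by move=> fL; rewrite -[_ *: _]addr0; apply: L2_lin => //; exact: L2_0. Qed.

Lemma L2_D f g : f \in L2 -> g \in L2 -> (f + g) \in L2.
Proof. by move=> fL gL; rewrite -[f]scale1r; exact: L2_lin. Qed.

Lemma L2_B f g : f \in L2 -> g \in L2 -> (f - g) \in L2.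
Proof. by move=> fL gL; rewrite addrC -scaleN1r; exact: L2_lin. Qed.

Lemma L2_mul_integrable f g : f \in L2 -> g \in L2 ->
  mu.-integrable setT (fun x => (f x * g x)%:E).
Proof. by move=> fL gL; apply/(Lfun1_integrable mu (f \* g))/Lfun2_mul_Lfun1. Qed.

Lemma L2_ae_bounded_mul (M : R) g f : measurable_fun setT g ->
  {ae mu, forall x, `|g x| <= M} -> f \in L2 -> (fun x => g x * f x) \in L2.
Proof.
move=> mg gM /L2P[mf foo]; apply/L2P; split; first exact: measurable_funM.
apply: (@le_lt_trans _ _ (\int[mu]_x ((M ^+ 2)%:E * (f x ^+ 2)%:E))%E).
  apply: ae_ge0_le_integral => //.
  - by move=> x _; rewrite lee_fin sqr_ge0.
  - by apply/measurable_EFinP/measurable_funX/measurable_funM.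
  - by move=> x _; rewrite -EFinM lee_fin mulr_ge0 ?sqr_ge0.
  - by apply: measurable_funeM; apply/measurable_EFinP/measurable_funX.
  - apply: filterS gM => x gM _; rewrite -EFinM lee_fin exprMn ler_wpM2r ?sqr_ge0//.
    by rewrite -(@real_normK _ (g x)) ?num_real// lerXn2r ?nnegrE// (le_trans _ gM).
rewrite ge0_integralZl ?lee_fin ?sqr_ge0//.
- by rewrite lte_mul_pinfty// ?lee_fin ?sqr_ge0.
- exact/measurable_EFinP/measurable_funX.
- by move=> x _; rewrite lee_fin sqr_ge0.
Qed.

Lemma L2_bounded_mul (M : R) g f : measurable_fun setT g ->
  (forall x, `|g x| <= M) -> f \in L2 -> (fun x => g x * f x) \in L2.
Proof. by move=> mg gM; apply: L2_ae_bounded_mul mg _; apply/aeW; exact: gM. Qed.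

Lemma L2_Loo_mul g f : g \in Lfun mu +oo%E -> f \in L2 ->
  (fun x => g x * f x) \in L2.
Proof.
move=> /[dup] /[!inE]/andP[/[!inE]/= mg _] /andP[_]; rewrite inE/= /finite_norm unlock.
case: ifPn => [_ goo|mu0 _] fL.
  have [M gM] : exists M : R, {ae mu, forall x, `|g x| <= M}.
    exact: (@ess_supr_bounded _ _ _ mu (Num.Def.normr \o g)).
  exact: L2_ae_bounded_mul mg gM fL.
(* Here the whole space is null, so every bound holds almost everywhere. *)
apply: (@L2_ae_bounded_mul 0) => //.
have muT0 : mu setT = 0%E by apply/eqP; rewrite eq_le measure_ge0 leNgt mu0.
by exists setT; split.
Qed.

Lemma L2_indic D f : measurable D -> f \in L2 -> (f \_ D) \in L2.
Proof.
move=> mD fL.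
have -> : f \_ D = (fun x => \1_D x * f x).
  by apply/funext => x; rewrite patchE indicE; case: (x \in D); rewrite ?mul1r ?mul0r.
apply: (@L2_bounded_mul 1 (\1_D)) => //.
by move=> x; rewrite indicE; case: (x \in D); rewrite ?normr1 ?normr0.
Qed.

Lemma ip_form : psd_form [set f | f \in L2] ip.
Proof.
split.
- exact: L2_0.
- exact: L2_lin.
- move=> c u v w uL vL wL; rewrite /ip.
  under eq_Rintegral => x _ do rewrite fctE mulrDl -mulrA.
  rewrite RintegralD//; last exact: L2_mul_integrable.
    by rewrite RintegralZl//; exact: L2_mul_integrable.
  by apply: (@integrableZl _ _ _ _ setT _ c (fun x => (u x * w x)%:E)) => //; exact: L2_mul_integrable.
- by move=> u v _ _; apply: eq_Rintegral => x _; rewrite mulrC.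
- by move=> u _; apply: Rintegral_ge0 => x _; rewrite -expr2 sqr_ge0.
Qed.

Lemma ip_ge0 f : 0 <= ip f f.
Proof. by apply: Rintegral_ge0 => x _; rewrite -expr2 sqr_ge0. Qed.

Lemma ip_EFin f : f \in L2 -> (\int[mu]_x (f x ^+ 2)%:E)%E = (ip f f)%:E.
Proof.
move=> fL; rewrite fineK; last first.
  by apply: integrable_fin_num => //; exact: L2_mul_integrable.
by apply: eq_integral => x _; rewrite expr2.
Qed.

End L2.

Section L2_complete.
Context d (T : measurableType d) (R : realType).
Variable mu : {measure set T -> \bar R}.
Local Notation L2 := (Lfun mu 2%:E).

Lemma limn_einf_le_near (u : (\bar R)^nat) (e : \bar R) K :
  (forall k, (K <= k)%N -> (u k <= e)%E) -> (limn_einf u <= e)%E.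
Proof.
move=> ue; rewrite limn_einf_lim; apply: lime_le; first exact: is_cvg_einfs.
apply: nearW => n; apply: (@le_trans _ _ (u (maxn n K))).
  by apply: ereal_inf_lbound; exists (maxn n K) => //=; exact: leq_maxl.
by apply: ue; exact: leq_maxr.
Qed.

Lemma sum_geometric_half m : \sum_(0 <= i < m) (2^-1 : R) ^+ i <= 2.
Proof.
suff -> : \sum_(0 <= i < m) (2^-1 : R) ^+ i = 2 - 2 * 2^-1 ^+ m.
  by rewrite gerBl mulr_ge0// exprn_ge0.
elim: m => [|m IH]; first by rewrite big_geq// expr0 mulr1 subrr.
by rewrite big_nat_recr//= IH exprS mulrA mulfV// mul1r; ring.
Qed.

(* Along a subsequence with ||u_(n_k+1) - u_(n_k)||^2 <= 8^-k, the weighted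
   series sum 4^k |u_(n_k+1) - u_(n_k)|^2 is integrable, so that the increments
   are almost everywhere dominated by a geometric sequence. *)
Lemma L2_complete : psd_complete [set f | f \in L2] (ip mu).
Proof.
move=> u_ L2u cauchy_u.
have /choice[N_ N_P] : forall k : nat, exists N, forall i j, (N <= i)%N -> (N <= j)%N ->
    ip mu (u_ i - u_ j) (u_ i - u_ j) <= 8^-1 ^+ k.
  by move=> k; apply: cauchy_u; rewrite exprn_gt0.
(* Partial sums dominate every [N_ j] with j <= k, so one subsequence serves all the thresholds. *)
pose n_ k := (\sum_(j < k.+1) N_ j)%N.
have N_n k : (N_ k <= n_ k)%N by rewrite /n_ big_ord_recr leq_addl.
have N_nS k : (N_ k <= n_ k.+1)%N.
  by rewrite /n_ big_ord_recr/= (leq_trans (N_n k))// leq_addr.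
have n_ge k l : (k <= l)%N -> (N_ k <= n_ l)%N.
  rewrite /n_ => kl; rewrite (bigD1 (Ordinal (kl : (k < l.+1)%N)))//=.
  exact: leq_addr.
pose v k := u_ (n_ k); pose dv k := v k.+1 - v k.
have L2dv k : dv k \in L2 by apply: L2_B; exact: L2u.
have ip_dv k : ip mu (dv k) (dv k) <= 8^-1 ^+ k by exact: N_P.
have mv k : measurable_fun setT (v k) by apply: L2_measurable; exact: L2u.
have mdv k : measurable_fun setT (dv k) by apply: L2_measurable; exact: L2dv.
pose t k x : \bar R := (4 ^+ k * (dv k x) ^+ 2)%:E.
have t0 k x : (0 <= t k x)%E by rewrite /t lee_fin mulr_ge0 ?sqr_ge0 ?exprn_ge0.
have mt k : measurable_fun setT (t k).
  by apply/measurable_EFinP/measurable_funM => //; exact: measurable_funX.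
pose S x := (\sum_(0 <= k <oo) t k x)%E.
have S0 x : (0 <= S x)%E by apply: nneseries_ge0 => k _ _; exact: t0.
have mS : measurable_fun setT S.
  exact: (@ge0_emeasurable_sum _ _ _ _ t xpredT).
have intS : (\int[mu]_x S x < +oo)%E.
  rewrite integral_nneseries//.
  apply: (@le_lt_trans _ _ 2%:E); last exact: ltry.
  apply: lime_le; first by apply: is_cvg_nneseries => k _ _; exact: integral_ge0.
  apply: nearW => m.
  apply: (@le_trans _ _ (\sum_(0 <= k < m) (2^-1 ^+ k)%:E)%E); last first.
    by rewrite sumEFin lee_fin sum_geometric_half.
  apply: lee_sum => k _; rewrite /t.
  under eq_integral do rewrite EFinM.
  rewrite ge0_integralZl//; last 2 first.
  - exact/measurable_EFinP/measurable_funX.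
  - by move=> x _; rewrite lee_fin sqr_ge0.
  rewrite ip_EFin// -EFinM lee_fin.
  apply: (@le_trans _ _ (4 ^+ k * 8^-1 ^+ k)).
    by rewrite ler_wpM2l ?exprn_ge0.
  by rewrite -exprMn lerXn2r ?nnegrE//; lra.
pose G := [set x | S x < +oo]%E.
have mG : measurable G.
  have := emeasurable_fun_infty_o measurableT mS +oo%E.
  by rewrite setTI.
have aeG : {ae mu, forall x, G x}.
  have Sint : mu.-integrable setT S.
    apply/integrableP; split => //.
    by under eq_integral do rewrite gee0_abs//.
  have := integrable_ae measurableT Sint.
  apply: filterS => x /(_ I) Sfin; rewrite /G/=.
  by rewrite ltey; move: Sfin; apply: contraTN => /eqP ->.
have cvg_G x : G x -> cvgn (fun k => v k x).
  rewrite /G/= => Sx.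
  have Sfin : S x \is a fin_num by rewrite ge0_fin_numE.
  pose s := fine (S x).
  have s0 : 0 <= s by exact: fine_ge0.
  have dvs k : `|dv k x| <= Num.sqrt s * 2^-1 ^+ k.
    have : (t k x <= S x)%E.
      apply: le_trans (nneseries_lim_ge k.+1 _) => //.
      rewrite big_nat_recr//= leeDr//.
      exact: sume_ge0.
    rewrite -[in X in _ -> X]ler_sqr ?nnegrE ?mulr_ge0 ?exprn_ge0 ?sqrtr_ge0//.
    rewrite -(fineK Sfin) lee_fin -/s => H.
    rewrite real_normK ?num_real// exprMn sqr_sqrtr// -exprM mulnC exprM.
    rewrite -ler_pdivrMr ?exprn_gt0// -exprVn mulrC (le_trans _ H)//.
    by rewrite ler_wpM2r ?sqr_ge0// lerXn2r ?nnegrE//; rewrite ?invr_ge0 ?sqr_ge0//; lra.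
  have : cvgn (series (telescope (fun k => v k x))).
    apply: normed_cvg.
    apply: (@series_le_cvg _ _ (geometric (Num.sqrt s) 2^-1)).
    - by move=> k; exact: normr_ge0.
    - by move=> k; rewrite /geometric/= mulr_ge0 ?sqrtr_ge0 ?exprn_ge0.
    - by move=> k; exact: dvs.
    - by apply: is_cvg_geometric_series; rewrite ger0_norm//; lra.
  rewrite telescopeK => H.
  rewrite (_ : (fun k => v k x) = (fun k => (v k x - v 0%N x) + v 0%N x)).
    by apply: is_cvgD => //; exact: is_cvg_cst.
  by apply/funext => k; rewrite subrK.
(* Set to 0 off G, so that f is everywhere the limit of measurable functions. *)
pose f := (fun x => limn (fun k => v k x)) \_ G.
have v_f x : G x -> (fun k => v k x) @ \oo --> f x.
  by move=> Gx; rewrite /f patchE mem_set//; exact: cvg_G.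
have mf : measurable_fun setT f.
  apply: (measurable_fun_cvg (h := fun k => v k \_ G)).
    by move=> k; apply: (measurable_restrictT _ mG).1; exact: measurable_funTS.
  move=> x _; have [Gx|nGx] := pselect (G x).
    rewrite (_ : (fun k => (v k \_ G) x) = (fun k => v k x)); first exact: v_f.
    by apply/funext => k; rewrite patchE mem_set.
  rewrite (_ : (fun k => (v k \_ G) x) = cst 0).
    by rewrite /f patchE memNset//; exact: cvg_cst.
  by apply/funext => k; rewrite patchE memNset.
(* Fatou along the subsequence: f inherits the Cauchy bound with respect to every [u_ i] beyond the
   threshold, which gives the convergence of the whole sequence. *)
have key i k : (N_ k <= i)%N -> (\int[mu]_x ((u_ i x - f x) ^+ 2)%:E <= (8^-1 ^+ k)%:E)%E.
  move=> Ni.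
  have mui : measurable_fun setT (u_ i) by apply: L2_measurable; exact: L2u.
  have := @fatou _ _ _ mu _ measurableT (fun l x => ((u_ i x - v l x) ^+ 2)%:E).
  move=> /(_ _ _)/le_trans => F; apply: le_trans; last apply: F.
  - apply: ae_ge0_le_integral => //.
    + by move=> x _; rewrite lee_fin sqr_ge0.
    + by apply/measurable_EFinP/measurable_funX/measurable_funB.
    + move=> x _; rewrite limn_einf_lim; apply: lime_ge; first exact: is_cvg_einfs.
      by apply: nearW => l; apply: le_ereal_inf_tmp => _ [m _ <-]; rewrite lee_fin sqr_ge0.
    + rewrite /limn_einf; apply: measurableT_comp => //.
      apply: measurable_fun_limn_esup => l; apply: measurableT_comp => //.
      by apply/measurable_EFinP/measurable_funX/measurable_funB.
    + apply: filterS aeG => x Gx _.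
      suff H : (fun l => ((u_ i x - v l x) ^+ 2)%:E) @ \oo --> ((u_ i x - f x) ^+ 2)%:E.
        by rewrite (cvg_limn_einf_sup H).1.
      apply: cvg_EFin; first exact: nearW.
      by apply: cvgM; apply: cvgB; (exact: cvg_cst || exact: v_f).
  - by move=> l; apply/measurable_EFinP/measurable_funX/measurable_funB.
  - by move=> l x _; rewrite lee_fin sqr_ge0.
  - apply: (@limn_einf_le_near _ _ k) => l kl.
    have := ip_EFin (L2_B (L2u i) (L2u (n_ l))).
    rewrite /= => ->; rewrite lee_fin; apply: N_P => //.
    exact: n_ge.
have L2uf i : (N_ 0%N <= i)%N -> (u_ i - f) \in L2.
  move=> Ni; apply/L2P; split.
    by apply: measurable_funB => //; apply: L2_measurable; exact: L2u.
  exact: (le_lt_trans (key _ _ Ni) (ltry _)).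
have L2f : f \in L2.
  rewrite (_ : f = u_ (N_ 0%N) - (u_ (N_ 0%N) - f)); last by rewrite subKr.
  by apply: L2_B; [exact: L2u|exact: L2uf].
exists f => //.
apply/cvgrPdist_le => e e0.
have [k ke] : exists k, 8^-1 ^+ k <= e.
  have : (fun k => (8^-1 : R) ^+ k) @ \oo --> (0 : R).
    by apply: cvg_expr; rewrite ger0_norm//; lra.
  move=> /cvgrPdist_le/(_ _ e0)[k _ /(_ k (leqnn k))]/=.
  by rewrite sub0r normrN ger0_norm ?exprn_ge0//; exists k.
exists (N_ k) => // i /= Ni.
rewrite sub0r normrN ger0_norm ?ip_ge0//.
rewrite (le_trans _ ke)// -lee_fin -ip_EFin; last by apply: L2_B => //; exact: L2u.
exact: key.
Qed.

End L2_complete.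

(** * Poincare inequalities on cubes *)

Section Rn_measure.
Context (R : realType).

(** Half-open, so that a cube is exactly tiled by smaller ones. *)
Definition cube n (a : 'rV[R]_n) (h : R) : set 'rV[R]_n :=
  [set x | forall i, a ord0 i < x ord0 i <= a ord0 i + h].

Lemma measurable_box n (P : 'I_n -> set R) : (forall i, measurable (P i)) ->
  measurable [set x : 'rV[R]_n | forall i, P i (x ord0 i)].
Proof.
move=> mP; rewrite (_ : mkset _ =
    \bigcap_(i in [set: 'I_n]) [set x : 'rV[R]_n | P i (x ord0 i)]).
  apply: fin_bigcap_measurable => // i _.
  have := @measurable_coord R n i measurableT (P i) (mP i).
  by rewrite setTI.
by apply/seteqP; split => x /= H i; [move=> _|]; apply: H.
Qed.

Lemma cubeE n (a : 'rV[R]_n) (h : R) : cube a h =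
  [set x | forall i, `]a ord0 i, a ord0 i + h]%classic (x ord0 i)].
Proof. by apply/seteqP; split=> x /= H i; have := H i; rewrite /= in_itv. Qed.

Lemma measurable_cube n (a : 'rV[R]_n) (h : R) : measurable (cube a h).
Proof. by rewrite cubeE; apply: (@measurable_box n (fun i => `]a ord0 i, a ord0 i + h]%classic)). Qed.

Lemma cube_volume n (a : 'rV[R]_n) (h : R) : 0 <= h ->
  lebesgue_rV R n (cube a h) = (h ^+ n)%:E.
Proof.
move=> h0.
have -> : cube a h = [set x : 'rV[R]_n | forall i,
    a ord0 i < x ord0 i <= (\row_i (a ord0 i + h) : 'rV[R]_n) ord0 i].
  by apply/seteqP; split=> x /= H i; have := H i; rewrite mxE.
rewrite lebesgue_rV_box; last by move=> i; rewrite mxE lerDl.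
rewrite (eq_bigr (fun=> h)) ?prodr_const ?card_ord//.
by move=> i _; rewrite mxE addrC addKr.
Qed.

(** The sigma-algebra is generated by the coordinates, so U is written as a countable union of boxes
    with rational centres and half-sides 1 / (k + 1); [F p] is empty when the box p does not fit in
    U. *)
Lemma open_measurable_rV n (U : set 'rV[R]_n) : open U -> measurable U.
Proof.
move=> oU.
pose B (p : 'rV[rat]_n * nat) : set 'rV[R]_n :=
  [set x | forall i, `]ratr (p.1 ord0 i) - p.2.+1%:R^-1,
                      ratr (p.1 ord0 i) + p.2.+1%:R^-1[%classic (x ord0 i)].
pose F p := if `[< B p `<=` U >] then B p else set0.
have -> : U = \bigcup_p F p.
  apply/seteqP; split=> [x Ux|x [p _]]; last first.
    by rewrite /F; case: asboolP => [BU /BU|_ []].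
  have := open_nbhs_nbhs (conj oU Ux); rewrite -nbhs_ballE => -[e /= e0 xeU].
  have e20 : 0 < e / 2 by rewrite divr_gt0.
  have [k _ /(_ _ (leqnn k))/= ke] := near_infty_natSinv_lt (PosNum e20).
  have k0 : 0 < k.+1%:R^-1 :> R by rewrite invr_gt0.
  have /choice[q qP] : forall i : 'I_n, exists q : rat,
      `|x ord0 i - ratr q| < k.+1%:R^-1.
    move=> i; have [|q] := @rat_in_itvoo R (x ord0 i - k.+1%:R^-1) (x ord0 i + k.+1%:R^-1).
      by rewrite ltrBlDr -addrA ltrDl addr_gt0.
    by rewrite in_itv/= -ltr_distl distrC; exists q.
  exists (\row_i q i, k) => //; rewrite /F; case: asboolP => [_ /= i|].
    by rewrite /= in_itv/= mxE -ltr_distl.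
  move=> nBU; exfalso; apply: nBU => y /= By; apply: xeU; split => // i j.
  rewrite (ord1 i) /ball/=.
  have := By j; rewrite /= in_itv/= mxE -ltr_distl distrC => yq.
  rewrite (le_lt_trans (ler_distD (ratr (q j)) _ _))//.
  by rewrite (splitr e) (lt_trans (ltrD (qP j) yq))// ltrD.
apply: countable_bigcupT_measurable; first exact: countableP.
move=> p; rewrite /F; case: ifP => // _.
exact: (@measurable_box n (fun i => `]ratr (p.1 ord0 i) - p.2.+1%:R^-1,
  ratr (p.1 ord0 i) + p.2.+1%:R^-1[%classic)).
Qed.

Lemma continuous_measurable_rV n (f : 'rV[R]_n -> R) :
  continuous f -> measurable_fun setT f.
Proof.
move=> cf; apply: (measurability (@RGenOpens.G R)).
  exact: RGenOpens.measurableE.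
move=> _ [_ [a [b ->] <-]]; rewrite setTI; apply: open_measurable_rV.
by apply: open_comp => // x _; exact: cf.
Qed.

Lemma integral_cons n (F : 'rV[R]_n.+1 -> \bar R) : measurable_fun setT F ->
  (forall x, 0 <= F x)%E ->
  (\int[lebesgue_rV R n.+1]_x F x =
   \int[@lebesgue_measure R]_t \int[lebesgue_rV R n]_y F (rV_cons (t, y)))%E.
Proof.
move=> mF F0.
transitivity (\int[(@lebesgue_measure R \x lebesgue_rV R n)%E]_p F (rV_cons p))%E.
  by rewrite /= (ge0_integral_pushforward (@measurable_rV_cons R n)).
rewrite (fubini_tonelli1 (fun p => F (rV_cons p)))//.
by apply: measurableT_comp => //; exact: measurable_rV_cons.
Qed.

End Rn_measure.

Section continuous_fun.
Context (R : realType) (T : topologicalType).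
Implicit Types f g : T -> R.

Lemma continuous_funD f g : continuous f -> continuous g ->
  continuous (fun x => f x + g x).
Proof. by move=> cf cg x; apply: cvgD; [exact: cf|exact: cg]. Qed.

Lemma continuous_funB f g : continuous f -> continuous g ->
  continuous (fun x => f x - g x).
Proof. by move=> cf cg x; apply: cvgB; [exact: cf|exact: cg]. Qed.

Lemma continuous_funM f g : continuous f -> continuous g ->
  continuous (fun x => f x * g x).
Proof. by move=> cf cg x; apply: cvgM; [exact: cf|exact: cg]. Qed.

End continuous_fun.

(** * Functions of class C^1 and their slices *)

Section C1.
Context (R : realType).

(** Stable under fixing the first coordinate, hence suited to the inductions on the dimension. *)
Definition C1 n (phi : 'rV[R]_n -> R) := continuous phi /\
  forall i, continuous (partial i phi) /\
    forall x, derivable phi x (delta_mx ord0 i).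

Lemma rV_cons_continuous_snd n (t : R) :
  continuous (fun y : 'rV[R]_n => rV_cons (t, y)).
Proof.
move=> y A [P Py sPA]; exists (fun i j => P i (lift ord0 j)).
  by move=> i j; have := Py i (lift ord0 j); rewrite (ord1 i) rV_consS.
move=> z /= Pz; apply: sPA => i j; rewrite (ord1 i).
case: (unliftP ord0 j) => [k ->|->]; first by rewrite rV_consS; exact: Pz.
by rewrite rV_cons0; have /nbhs_singleton := Py ord0 ord0; rewrite rV_cons0.
Qed.

Lemma rV_cons_continuous_fst n (y : 'rV[R]_n) :
  continuous (fun t : R => rV_cons (t, y)).
Proof.
move=> t A [P Py sPA]; rewrite nbhs_simpl/=.
have := Py ord0 ord0; rewrite rV_cons0; apply: filterS => s /= Ps.
apply: sPA => i j; rewrite (ord1 i).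
case: (unliftP ord0 j) => [k ->|->]; last by rewrite rV_cons0.
by rewrite rV_consS; have /nbhs_singleton := Py ord0 (lift ord0 k); rewrite rV_consS.
Qed.

Lemma rV_cons_shift_lift n (t h : R) (y : 'rV[R]_n) i :
  rV_cons (t, h *: delta_mx ord0 i + y) =
  h *: delta_mx ord0 (lift ord0 i) + rV_cons (t, y).
Proof.
apply/rowP => j; rewrite [RHS]mxE; case: (unliftP ord0 j) => [k ->|->].
  rewrite !rV_consS [LHS]mxE; congr (_ + _).
  by rewrite !mxE !eqxx/= (inj_eq lift_inj).
by rewrite !rV_cons0 !mxE eqxx/= mulr0 add0r.
Qed.

Lemma rV_cons_shift0 n (t h : R) (y : 'rV[R]_n) :
  rV_cons (h + t, y) = h *: delta_mx ord0 ord0 + rV_cons (t, y).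
Proof.
apply/rowP => j; rewrite [RHS]mxE; case: (unliftP ord0 j) => [k ->|->].
  by rewrite !rV_consS !mxE eqxx/= mulr0 add0r.
by rewrite !rV_cons0 !mxE !eqxx mulr1.
Qed.

Variables (n : nat) (phi : 'rV[R]_n.+1 -> R).
Hypothesis C1phi : C1 phi.

Let slice_quotient t y i :
  (fun h => h^-1 *: (((fun z => phi (rV_cons (t, z))) \o shift y) (h *: delta_mx ord0 i)
     - phi (rV_cons (t, y)))) =
  (fun h => h^-1 *: ((phi \o shift (rV_cons (t, y))) (h *: delta_mx ord0 (lift ord0 i))
     - phi (rV_cons (t, y)))).
Proof. by apply/funext => h /=; rewrite rV_cons_shift_lift. Qed.

Lemma partial_slice t i : partial i (fun y => phi (rV_cons (t, y))) =
  fun y => partial (lift ord0 i) phi (rV_cons (t, y)).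
Proof. by apply/funext => y; rewrite /partial /derive slice_quotient. Qed.

Lemma C1_slice t : C1 (fun y => phi (rV_cons (t, y))).
Proof.
case: C1phi => cphi dphi; split.
  move=> y; apply: continuous_comp; first exact: rV_cons_continuous_snd.
  exact: cphi.
move=> i; split.
  rewrite partial_slice => y.
  apply: continuous_comp; first exact: rV_cons_continuous_snd.
  exact: (dphi _).1.
move=> y; rewrite /derivable slice_quotient; exact: (dphi _).2.
Qed.

Let line_quotient t y :
  (fun h => h^-1 *: (((fun s : R => phi (rV_cons (s, y))) \o shift t) (h *: 1)
     - phi (rV_cons (t, y)))) =
  (fun h => h^-1 *: ((phi \o shift (rV_cons (t, y))) (h *: delta_mx ord0 ord0)
     - phi (rV_cons (t, y)))).
Proof.
by apply/funext => h /=; rewrite -rV_cons_shift0 [h *: 1]mulr1.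
Qed.

Lemma derive_line y (t : R) :
  'D_1 (fun s : R => phi (rV_cons (s, y))) t = partial ord0 phi (rV_cons (t, y)).
Proof. by rewrite /partial /derive line_quotient. Qed.

Lemma derivable_line y (t : R) : derivable (fun s : R => phi (rV_cons (s, y))) t 1.
Proof. by rewrite /derivable line_quotient; exact: (C1phi.2 _).2. Qed.

Lemma continuous_line y : continuous (fun s : R => partial ord0 phi (rV_cons (s, y))).
Proof.
move=> t; apply: continuous_comp; first exact: rV_cons_continuous_fst.
exact: (C1phi.2 _).1.
Qed.

End C1.

(** * Oscillation of a function of one variable *)

Section FTC.
Context (R : realType).
Local Notation mu := (@lebesgue_measure R).
Variables psi g : R -> R.
Hypothesis dpsi : forall t, derivable psi t 1.
Hypothesis psi_g : forall t, 'D_1 psi t = g t.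
Hypothesis cg : continuous g.

Lemma FTC_continuous (s t : R) : s < t ->
  mu.-integrable `[s, t] (EFin \o g) /\ \int[mu]_(x in `[s, t]) g x = psi t - psi s.
Proof.
move=> st.
have cpsi : continuous psi.
  by move=> x; apply/differentiable_continuous/derivable1_diffP; exact: dpsi.
split.
  apply: continuous_compact_integrable; first exact: segment_compact.
  exact: continuous_subspaceT.
rewrite /Rintegral (continuous_FTC2 st (F := psi))//.
- exact: continuous_subspaceT.
- split; first by move=> x _; exact: dpsi.
    by apply: cvg_at_right_filter; exact: cpsi.
  by apply: cvg_at_left_filter; exact: cpsi.
- by move=> x _; rewrite derive1E psi_g.
Qed.

Lemma osc_segment (s t : R) : s < t ->
  (((psi t - psi s) ^+ 2)%:E <=
   (t - s)%:E * \int[mu]_(x in `[s, t]) (g x ^+ 2)%:E)%E.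
Proof.
move=> st; have [ig intg] := FTC_continuous st.
have ig2 : mu.-integrable `[s, t] (EFin \o (fun x => g x ^+ 2)).
  apply: continuous_compact_integrable; first exact: segment_compact.
  by apply: continuous_subspaceT => x; apply: cvgM; exact: cg.
have -> : (\int[mu]_(x in `[s, t]) (g x ^+ 2)%:E)%E =
    (\int[mu]_(x in `[s, t]) (g x ^+ 2))%:E.
  by rewrite fineK//; exact: integrable_fin_num.
rewrite -EFinM lee_fin.
(* The mean slope: integrating (g - c)^2 >= 0 yields the Cauchy-Schwarz inequality for g. *)
pose c := (psi t - psi s) / (t - s).
have ts0 : t - s != 0 by rewrite subr_eq0 gt_eqF.
have ic : mu.-integrable `[s, t] (EFin \o (fun x => c ^+ 2)).
  apply: continuous_compact_integrable; first exact: segment_compact.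
  by apply: continuous_subspaceT => x; exact: cvg_cst.
have icg : mu.-integrable `[s, t] (EFin \o (fun x => 2 * c * g x)).
  apply: continuous_compact_integrable; first exact: segment_compact.
  by apply: continuous_subspaceT => x; apply: cvgM; [exact: cvg_cst|exact: cg].
have : 0 <= \int[mu]_(x in `[s, t]) (g x ^+ 2 - (2 * c * g x - c ^+ 2)).
  apply: Rintegral_ge0 => x _.
  by rewrite (_ : _ - _ = (g x - c) ^+ 2) ?sqr_ge0//; ring.
have icc : mu.-integrable `[s, t] (EFin \o (fun x => 2 * c * g x - c ^+ 2)).
  apply: continuous_compact_integrable; first exact: segment_compact.
  apply: continuous_subspaceT => x; apply: cvgB; last exact: cvg_cst.
  by apply: cvgM; [exact: cvg_cst|exact: cg].
rewrite RintegralB// RintegralB// RintegralZl// Rintegral_cst//= intg.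
rewrite lebesgue_measure_itv/= lte_fin st/= => H.
have t0 : 0 <= t - s by rewrite subr_ge0 ltW.
have := mulr_ge0 t0 H; rewrite mulrBr subr_ge0 => {}H.
apply: le_trans H.
rewrite (_ : _ * (_ - _) = (psi t - psi s) ^+ 2)//.
by rewrite /c; field.
Qed.

Lemma osc_itv (a h s t : R) : a < s <= a + h -> a < t <= a + h ->
  (((psi t - psi s) ^+ 2)%:E <=
   h%:E * \int[mu]_(x in `]a, (a + h)%R]) (g x ^+ 2)%:E)%E.
Proof.
wlog st : s t / s < t.
  move=> H hs ht; have [st|ts|->] := ltgtP s t; first exact: H.
    by rewrite -sqrrN opprB; exact: H.
  rewrite subrr expr0n/= mule_ge0 ?integral_ge0//; last first.
    by move=> x _; rewrite lee_fin sqr_ge0.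
  by rewrite lee_fin; lra.
move=> /andP[as_ sh] /andP[at_ th]; apply: (le_trans (osc_segment st)).
have mg2 D : measurable_fun D (fun x => (g x ^+ 2)%:E).
  apply/measurable_EFinP/measurable_funX; apply: measurable_funTS.
  exact: continuous_measurable_fun.
apply: lee_pmul.
- by rewrite lee_fin; lra.
- by apply: integral_ge0 => x _; rewrite lee_fin sqr_ge0.
- by rewrite lee_fin; lra.
- apply: ge0_subset_integral => //; first exact: mg2.
  + by move=> x _; rewrite lee_fin sqr_ge0.
  + by move=> x /=; rewrite !in_itv/= => /andP[? ?]; apply/andP; split; lra.
Qed.

End FTC.

(** * Tonelli on rectangles *)

Section tonelli.
Local Open Scope ereal_scope.
Context d1 d2 (T1 : measurableType d1) (T2 : measurableType d2) (R : realType).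
Variables (m1 : {sigma_finite_measure set T1 -> \bar R})
  (m2 : {sigma_finite_measure set T2 -> \bar R}).
Variable f : T1 * T2 -> \bar R.
Hypothesis mf : measurable_fun setT f.
Hypothesis f0 : forall p, 0 <= f p.
Variables (A : set T1) (B : set T2).
Hypothesis mA : measurable A.
Hypothesis mB : measurable B.

Lemma measurable_integral_snd :
  measurable_fun setT (fun x => \int[m2]_(y in B) f (x, y)).
Proof.
have -> : (fun x => \int[m2]_(y in B) f (x, y)) =
    fun x => \int[m2]_y (f \_ (setT `*` B)) (x, y).
  apply/funext => x; rewrite integral_mkcond; apply: eq_integral => y _.
  rewrite !patchE; congr (if _ then _ else _).
  by apply/idP/idP; rewrite !inE/= => // -[].
have g0 p : 0 <= (f \_ (setT `*` B)) p by rewrite patchE; case: ifP.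
apply: (measurable_fun_fubini_tonelli_F (f \_ (setT `*` B))) => //.
apply: (measurable_restrictT _ _).1; first exact: measurableX.
exact: measurable_funTS.
Qed.

Lemma integral_swap : \int[m1]_(x in A) \int[m2]_(y in B) f (x, y) =
  \int[m2]_(y in B) \int[m1]_(x in A) f (x, y).
Proof.
pose F := f \_ (A `*` B).
have F0 p : 0 <= F p by rewrite /F patchE; case: ifP.
have mF : measurable_fun setT F.
  apply: (measurable_restrictT _ _).1; first exact: measurableX.
  exact: measurable_funTS.
transitivity (\int[m1]_x \int[m2]_y F (x, y)).
  rewrite [LHS]integral_mkcond; apply: eq_integral => x _. rewrite patchE.
  case: ifPn => xA.
    rewrite [LHS]integral_mkcond; apply: eq_integral => y _.
    rewrite /F !patchE; congr (if _ then _ else _).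
    by apply/idP/idP; rewrite !inE/=; [move=> ?; split => //; exact: set_mem xA|case].
  rewrite integral0_eq// => y _; rewrite /F patchE ifN//.
  by apply: contra xA; rewrite !inE => -[].
rewrite (fubini_tonelli F)//.
rewrite [RHS]integral_mkcond; apply: eq_integral => y _; rewrite patchE.
case: ifPn => yB.
  rewrite [RHS]integral_mkcond; apply: eq_integral => x _.
  rewrite /F !patchE; congr (if _ then _ else _).
  by apply/idP/idP; rewrite !inE/=; [case|move=> ?; split => //; exact: set_mem yB].
rewrite integral0_eq// => x _; rewrite /F patchE ifN//.
by apply: contra yB; rewrite !inE => -[].
Qed.

End tonelli.

(** * Oscillation on cubes, by induction on the dimension *)

Section cube_osc.
Local Open Scope ereal_scope.
Context (R : realType).
Local Notation leb := (@lebesgue_measure R).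

Lemma integral_cube_cons n (a : 'rV[R]_n.+1) (h : R) (F : 'rV[R]_n.+1 -> \bar R) :
  measurable_fun setT F -> (forall x, 0 <= F x) ->
  \int[lebesgue_rV R n.+1]_(x in cube a h) F x =
  \int[leb]_(t in `]a ord0 ord0, (a ord0 ord0 + h)%R])
    \int[lebesgue_rV R n]_(y in cube (rV_uncons a).2 h) F (rV_cons (t, y)).
Proof.
move=> mF F0; rewrite integral_mkcond integral_cons; last 2 first.
- apply: (measurable_restrictT _ (measurable_cube _ _)).1.
  exact: measurable_funTS.
- by move=> x; rewrite patchE; case: ifP.
rewrite [RHS]integral_mkcond; apply: eq_integral => t _; rewrite patchE.
case: ifPn => tI.
  rewrite [RHS]integral_mkcond; apply: eq_integral => y _.
  rewrite !patchE; congr (if _ then _ else _).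
  move: tI; rewrite inE /= in_itv/= => tI.
  apply/idP/idP; rewrite !inE/= => H i.
    by have := H (lift ord0 i); rewrite rV_consS rV_uncons2.
  case: (unliftP ord0 i) => [j ->|->]; last by rewrite rV_cons0.
  by have := H j; rewrite rV_consS rV_uncons2.
rewrite integral0_eq// => y _; rewrite patchE ifN//.
apply: contra tI; rewrite !inE/= in_itv/= => /(_ ord0).
by rewrite rV_cons0.
Qed.

Lemma measurable_sqr_diff n (phi : 'rV[R]_n -> R) : continuous phi ->
  measurable_fun setT (fun p : 'rV[R]_n * 'rV[R]_n => ((phi p.1 - phi p.2) ^+ 2)%:E).
Proof.
move=> cphi; have mphi := continuous_measurable_rV cphi.
apply/measurable_EFinP/measurable_funX/measurable_funB.
  exact: measurableT_comp mphi measurable_fst.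
exact: measurableT_comp mphi measurable_snd.
Qed.

Lemma measurable_sqr n (phi : 'rV[R]_n -> R) D : continuous phi ->
  measurable_fun D (fun x : 'rV[R]_n => (phi x ^+ 2)%:E).
Proof.
move=> cphi; apply: measurable_funTS.
by apply/measurable_EFinP/measurable_funX; exact: continuous_measurable_rV.
Qed.

Lemma sqr_EFin_ge0 (x : R) : 0 <= (x ^+ 2)%:E.
Proof. by rewrite lee_fin sqr_ge0. Qed.

(* Going from (t, x) to (s, y) through (t, y): the first step is handled by the
   induction hypothesis, the second one by the one-dimensional bound. *)
Lemma cube_osc n : exists2 K : R, (0 <= K)%R &
  forall (a : 'rV[R]_n) (h : R) (phi : 'rV[R]_n -> R), (0 < h)%R -> C1 phi ->
  \int[lebesgue_rV R n]_(x in cube a h) \int[lebesgue_rV R n]_(y in cube a h)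
     ((phi x - phi y) ^+ 2)%:E <=
  (K * h ^+ n.+2)%:E *
    \sum_(i < n) \int[lebesgue_rV R n]_(x in cube a h) (partial i phi x ^+ 2)%:E.
Proof.
elim: n => [|n [K K0 IH]].
  exists 0%R => // a h phi h0 C1phi; rewrite big_ord0 mule0.
  rewrite integral0_eq// => x _; rewrite integral0_eq// => y _.
  by rewrite (_ : y = x) ?subrr ?expr0n//; apply/rowP => -[].
(* From (p - q)^2 <= 2 (p - r)^2 + 2 (r - q)^2, the first derivative gets the constant 2 and the
   other derivatives the constant 2 K, both with the factor h ^ (n + 3). *)
exists (2 * K + 2)%R; first by rewrite addr_ge0// mulr_ge0.
move=> a h phi h0 C1phi.
have [cphi dphi] := C1phi.
set I := `]a ord0 ord0, (a ord0 ord0 + h)%R]%classic.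
set Q := cube (rV_uncons a).2 h.
have mQ : measurable Q by exact: measurable_cube.
have mI : measurable I by exact: measurable_itv.
have lI : leb I = h%:E.
  rewrite /I lebesgue_measure_itv/= lte_fin ltrDl h0.
  by rewrite -EFinB addrC addKr.
have lQ : lebesgue_rV R n Q = (h ^+ n)%:E by apply: cube_volume; exact: ltW.
have mphi := continuous_measurable_rV cphi.
pose G y := \int[leb]_(r in I) (partial ord0 phi (rV_cons (r, y)) ^+ 2)%:E.
have G0 y : 0 <= G y by apply: integral_ge0 => r _; exact: sqr_EFin_ge0.
have mcons_sw : measurable_fun setT (fun p : 'rV[R]_n * measurableTypeR R => rV_cons (p.2, p.1)).
  apply: (@measurableT_comp _ _ _ _ _ _ (@rV_cons R n)); first exact: measurable_rV_cons.
  by apply/measurable_fun_pairP; split; [exact: measurable_snd|exact: measurable_fst].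
have mG : measurable_fun setT G.
  apply: (@measurable_integral_snd _ _ _ _ _ leb
    (fun p : 'rV[R]_n * measurableTypeR R => (partial ord0 phi (rV_cons (p.2, p.1)) ^+ 2)%:E)) => //.
  - apply: (measurableT_comp (measurable_sqr (dphi ord0).1)) => //.
  - by move=> p; exact: sqr_EFin_ge0.
pose J := \int[lebesgue_rV R n]_(y in Q) G y.
have J0 : 0 <= J by exact: integral_ge0.
have JE : J = \int[lebesgue_rV R n.+1]_(x in cube a h) (partial ord0 phi x ^+ 2)%:E.
  rewrite integral_cube_cons//; last 2 first.
  - exact: measurable_sqr (dphi ord0).1.
  - by move=> x; exact: sqr_EFin_ge0.
  rewrite /J /G (@integral_swap _ _ _ _ _ (lebesgue_rV R n) leb
    (fun p => (partial ord0 phi (rV_cons (p.2, p.1)) ^+ 2)%:E))//.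
  - exact: (measurableT_comp (measurable_sqr (dphi ord0).1)).
  - by move=> p; exact: sqr_EFin_ge0.
pose slice (t : R) (y : 'rV[R]_n) := phi (rV_cons (t, y)).
have C1s t : C1 (slice t) by exact: C1_slice.
have cs t : continuous (slice t) := (C1s t).1.
pose H t x := \int[lebesgue_rV R n]_(y in Q) ((slice t x - slice t y) ^+ 2)%:E.
have H0 t x : 0 <= H t x by apply: integral_ge0 => y _; exact: sqr_EFin_ge0.
have step1 t x : I t -> Q x ->
  \int[lebesgue_rV R n.+1]_(z in cube a h) ((phi (rV_cons (t, x)) - phi z) ^+ 2)%:E
  <= (2 * h)%:E * H t x + (2 * h ^+ 2)%:E * J.
  move=> It Qx; have h2 : (0 <= 2 * h)%R by lra.
  have mdiff : measurable_fun setT (fun z => ((phi (rV_cons (t, x)) - phi z) ^+ 2)%:E).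
    by apply/measurable_EFinP/measurable_funX/measurable_funB.
  rewrite integral_cube_cons//; last by move=> z; exact: sqr_EFin_ge0.
  have csd : continuous (fun y : 'rV[R]_n => slice t x - slice t y)%R.
    by apply: continuous_funB => //; exact: cst_continuous.
  have csd2 s : continuous (fun y : 'rV[R]_n => phi (rV_cons (t, x)) - phi (rV_cons (s, y)))%R.
    by apply: continuous_funB; [exact: cst_continuous|exact: cs].
  have inner s : I s -> \int[lebesgue_rV R n]_(y in Q)
      ((phi (rV_cons (t, x)) - phi (rV_cons (s, y))) ^+ 2)%:E <=
      2%:E * H t x + (2 * h)%:E * J.
    move=> Is.
    rewrite /H /J -ge0_integralZl//; last 2 first.
    - exact: measurable_sqr csd.
    - by move=> y _; exact: sqr_EFin_ge0.
    rewrite -ge0_integralZl//; last exact: measurable_funTS.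
    rewrite -ge0_integralD//; last 4 first.
    - by move=> y _; rewrite mule_ge0// sqr_EFin_ge0.
    - by apply: measurable_funeM; exact: measurable_sqr csd.
    - by move=> y _; rewrite mule_ge0.
    - by apply: measurable_funeM; exact: measurable_funTS.
    apply: ge0_le_integral => //.
    - by move=> y _; exact: sqr_EFin_ge0.
    - exact: measurable_sqr (csd2 s).
    - apply: emeasurable_funD; apply: measurable_funeM; last exact: measurable_funTS.
      exact: measurable_sqr csd.
    - move=> y Qy.
      have := @osc_itv R (fun r => phi (rV_cons (r, y)))
        (fun r => partial ord0 phi (rV_cons (r, y)))
        (@derivable_line R n phi C1phi y) (@derive_line R n phi y) (@continuous_line R n phi C1phi y)
        (a ord0 ord0) h s t.
      move: Is It; rewrite /I /= !in_itv/= => Is It /(_ Is It) osc.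
      rewrite [(2 * h)%:E]EFinM -muleA.
      apply: (@le_trans _ _ (2%:E * ((slice t x - slice t y) ^+ 2)%:E +
         2%:E * ((phi (rV_cons (t, y)) - phi (rV_cons (s, y))) ^+ 2)%:E)).
        rewrite -!EFinM -EFinD lee_fin /slice.
        set p := phi _; set q := phi _; set r := phi _.
        by rewrite -subr_ge0 (_ : _ - _ = (p - 2 * r + q) ^+ 2)%R ?sqr_ge0//; ring.
      by rewrite leeD2l// lee_wpmul2l.
  apply: (@le_trans _ _ (\int[leb]_(s in I) cst (2%:E * H t x + (2 * h)%:E * J) s)).
    apply: ge0_le_integral => //.
    - by move=> s _; apply: integral_ge0 => y _; exact: sqr_EFin_ge0.
    - apply: measurable_funTS.
      apply: (@measurable_integral_snd _ _ _ _ _ (lebesgue_rV R n)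
        (fun p => ((phi (rV_cons (t, x)) - phi (rV_cons p)) ^+ 2)%:E)) => //.
      + by apply: (measurableT_comp mdiff); exact: measurable_rV_cons.
      + by move=> p; exact: sqr_EFin_ge0.
  rewrite integral_cst// [X in _ * X <= _]lI muleDl//; last first.
    by apply: ge0_adde_def; rewrite inE mule_ge0.
  by rewrite !(muleAC _ _ h%:E) -!EFinM -mulrA -expr2.
rewrite integral_cube_cons; last 2 first.
- apply: (@measurable_integral_snd _ _ _ _ _ (lebesgue_rV R n.+1)
    (fun p => ((phi p.1 - phi p.2) ^+ 2)%:E)).
  + exact: measurable_sqr_diff.
  + by move=> p; exact: sqr_EFin_ge0.
  + exact: measurable_cube.
- by move=> x; apply: integral_ge0 => y _; exact: sqr_EFin_ge0.
pose S i t := \int[lebesgue_rV R n]_(x in Q) (partial (lift ord0 i) phi (rV_cons (t, x)) ^+ 2)%:E.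
have S0 i t : 0 <= S i t by apply: integral_ge0 => x _; exact: sqr_EFin_ge0.
have mS i : measurable_fun setT (S i).
  apply: (@measurable_integral_snd _ _ _ _ _ (lebesgue_rV R n)
     (fun p => (partial (lift ord0 i) phi (rV_cons p) ^+ 2)%:E)) => //.
  - apply: (measurableT_comp (measurable_sqr (dphi (lift ord0 i)).1)).
    exact: measurable_rV_cons.
  - by move=> p; exact: sqr_EFin_ge0.
have mHt t : measurable_fun setT (H t).
  apply: (@measurable_integral_snd _ _ _ _ _ (lebesgue_rV R n)
    (fun q : 'rV[R]_n * 'rV[R]_n => ((slice t q.1 - slice t q.2) ^+ 2)%:E)) => //.
  - exact: measurable_sqr_diff.
  - by move=> p; exact: sqr_EFin_ge0.
have K2 : (0 <= 2 * h * (K * h ^+ n.+2))%R.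
  have h_ge0 := ltW h0; apply: mulr_ge0; apply: mulr_ge0 => //.
  exact: exprn_ge0.
have bound t : I t -> \int[lebesgue_rV R n]_(x in Q)
     \int[lebesgue_rV R n.+1]_(z in cube a h) ((phi (rV_cons (t, x)) - phi z) ^+ 2)%:E <=
  (2 * h * (K * h ^+ n.+2))%:E * (\sum_(i < n) S i t) + (2 * h ^+ 2)%:E * J * (h ^+ n)%:E.
  move=> It.
  apply: (@le_trans _ _ (\int[lebesgue_rV R n]_(x in Q)
     ((2 * h)%:E * H t x + cst ((2 * h ^+ 2)%:E * J) x))).
    apply: ge0_le_integral => //.
    - by move=> x _; apply: integral_ge0 => y _; exact: sqr_EFin_ge0.
    - apply: measurable_funTS.
      apply: (@measurable_integral_snd _ _ _ _ _ (lebesgue_rV R n.+1)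
        (fun p : 'rV[R]_n * 'rV[R]_n.+1 =>
          ((phi (rV_cons (t, p.1)) - phi p.2) ^+ 2)%:E)) => //.
      + apply/measurable_EFinP/measurable_funX/measurable_funB.
          apply: (measurableT_comp (continuous_measurable_rV (cs t))).
          exact: measurable_fst.
        exact: (measurableT_comp mphi measurable_snd).
      + by move=> p; exact: sqr_EFin_ge0.
      + exact: measurable_cube.
    - apply: emeasurable_funD => //; apply: measurable_funeM.
      exact: measurable_funTS.
    - by move=> x Qx; exact: step1.
  have h20 : (0 <= 2 * h)%R by lra.
  have hh0 : (0 <= 2 * h ^+ 2)%R by rewrite mulr_ge0 ?sqr_ge0.
  rewrite ge0_integralD//; last 3 first.
  - by move=> x _; rewrite mule_ge0.
  - by apply: measurable_funeM; exact: measurable_funTS.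
  - by move=> x _; rewrite mule_ge0.
  rewrite integral_cst// [X in _ + _ * X <= _]lQ leeD2r// ge0_integralZl//; last exact: measurable_funTS.
  rewrite [X in _ <= X * _]EFinM -muleA lee_wpmul2l//.
  apply: (le_trans (IH (rV_uncons a).2 h (slice t) h0 (C1s t))).
  apply: lee_wpmul2l; first by rewrite lee_fin mulr_ge0 ?exprn_ge0// ltW.
  apply: lee_sum => i _; rewrite /S -/Q.
  by under eq_integral do rewrite /slice partial_slice.
apply: (@le_trans _ _ (\int[leb]_(t in I)
   ((2 * h * (K * h ^+ n.+2))%:E * (\sum_(i < n) S i t) +
    cst ((2 * h ^+ 2)%:E * J * (h ^+ n)%:E) t))).
  apply: ge0_le_integral => //.
  - move=> t _; apply: integral_ge0 => x _; apply: integral_ge0 => y _; exact: sqr_EFin_ge0.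
  - apply: measurable_funTS.
    apply: (@measurable_integral_snd _ _ _ _ _ (lebesgue_rV R n)
      (fun p => \int[lebesgue_rV R n.+1]_(z in cube a h) ((phi (rV_cons p) - phi z) ^+ 2)%:E)) => //.
    + apply: (@measurable_integral_snd _ _ _ _ _ (lebesgue_rV R n.+1)
        (fun q => ((phi (rV_cons q.1) - phi q.2) ^+ 2)%:E)) => //.
      * apply/measurable_EFinP/measurable_funX/measurable_funB.
          apply: (measurableT_comp mphi).
          apply: (measurableT_comp (@measurable_rV_cons R n)).
          exact: measurable_fst.
        exact: (measurableT_comp mphi measurable_snd).
      * by move=> p; exact: sqr_EFin_ge0.
      * exact: measurable_cube.
    + by move=> p; apply: integral_ge0 => y _; exact: sqr_EFin_ge0.
  - apply: emeasurable_funD => //; apply: measurable_funeM.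
    apply: measurable_funTS; exact: emeasurable_sum.
have hh0 : (0 <= 2 * h ^+ 2)%R by rewrite mulr_ge0 ?sqr_ge0.
have hn0 : (0 <= h ^+ n)%R by rewrite exprn_ge0 ?ltW.
rewrite ge0_integralD//; last 3 first.
- by move=> t _; rewrite mule_ge0// sume_ge0.
- apply: measurable_funeM; apply: measurable_funTS; exact: emeasurable_sum.
- by move=> t _; rewrite /cst !mule_ge0.
rewrite integral_cst// [X in _ + _ * X <= _]lI ge0_integralZl//; last 2 first.
- by apply: measurable_funTS; exact: emeasurable_sum.
- by move=> t _; rewrite sume_ge0.
rewrite ge0_integral_sum//; last first.
  by move=> i; exact: measurable_funTS.
rewrite big_ord_recl -JE.
have SE i : \int[leb]_(t in I) S i t =
    \int[lebesgue_rV R n.+1]_(x in cube a h) (partial (lift ord0 i) phi x ^+ 2)%:E.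
  rewrite integral_cube_cons//.
  - exact: measurable_sqr (dphi _).1.
  - by move=> x; exact: sqr_EFin_ge0.
under eq_bigr do rewrite SE.
set Sum := \sum_(i < n) _.
have Sum0 : 0 <= Sum by apply: sume_ge0 => i _; apply: integral_ge0 => x _; exact: sqr_EFin_ge0.
have h3 : (0 <= h ^+ n.+3)%R by rewrite exprn_ge0 ?ltW.
rewrite [leRHS]ge0_muleDr// [leLHS]addeC; apply: leeD.
  rewrite (muleAC _ J) -EFinM (muleAC _ J) -EFinM lee_wpmul2r// lee_fin.
  rewrite (_ : _ * h = 2 * h ^+ n.+3)%R; last by rewrite !exprS; ring.
  by rewrite ler_wpM2r//; lra.
rewrite lee_wpmul2r// lee_fin.
rewrite (_ : 2 * h * _ = (2 * K) * h ^+ n.+3)%R; last by rewrite !exprS; ring.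
by rewrite ler_wpM2r//; lra.
Qed.

End cube_osc.

Lemma L2_indicator d (T : measurableType d) (R : realType)
    (mu : {measure set T -> \bar R}) (A : set T) : measurable A ->
  (mu A < +oo)%E -> (\1_A : T -> R) \in Lfun mu 2%:E.
Proof.
move=> mA muA; apply/L2P; split; first exact: measurable_indic.
rewrite (eq_integral (fun x => (\1_A x)%:E)); last first.
  by move=> x _; rewrite indicE; case: (x \in A); rewrite ?expr1n ?expr0n.
by rewrite integral_indic// setIT.
Qed.

(** * Test functions and integration by parts *)

Section bounded_support.
Context (R : realType).

Definition supp_in n (M : R) (f : 'rV[R]_n -> R) :=
  forall x, f x != 0 -> forall i, `|x ord0 i| <= M.

(** The region |x_j| > M is open, so f vanishes near each of its points, and so does its derivative
    there. *)
Lemma supp_in_partial n M (f : 'rV[R]_n -> R) i :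
  supp_in M f -> supp_in M (partial i f).
Proof.
move=> fM x px j; rewrite leNgt; apply: contraNN px => xj.
rewrite /partial (_ : 'D_ _ f x = 'D_(delta_mx ord0 i) (cst 0) x).
  by rewrite derive_cst.
apply: near_eq_derive.
have : nbhs x [set y : 'rV[R]_n | M < `|y ord0 j|].
  apply: open_nbhs_nbhs; split => //.
  apply: (@open_comp _ _ (fun y : 'rV[R]_n => `|y ord0 j|) [set r | M < r]); last exact: open_gt.
  move=> y _; apply: continuous_comp; first exact: coord_continuous.
  exact: norm_continuous.
apply: filterS => y /= yj; apply/eqP; apply: contraTT yj => fy.
by rewrite -leNgt; exact: fM.
Qed.

Lemma supp_in_bounded n M (f : 'rV[R]_n -> R) : continuous f -> supp_in M f ->
  exists2 C, 0 <= C & forall x, `|f x| <= C.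
Proof.
move=> cf fM.
have cK : compact [set v : 'rV[R]_n | forall i, v ord0 i \in `[- M, M]].
  by apply: (@rV_compact _ _ (fun=> `[- M, M]%classic)) => i; exact: segment_compact.
have : bounded_set (f @` [set v : 'rV[R]_n | forall i, v ord0 i \in `[- M, M]]).
  by apply/compact_bounded/continuous_compact => //; exact: continuous_subspaceT.
move=> [C [_ /(_ (`|C| + 1))]] H; exists (`|C| + 1); first by rewrite addr_ge0.
move=> x; have [->|fx] := eqVneq (f x) 0; first by rewrite normr0 addr_ge0.
apply: H; first by rewrite ltr_pwDr// ler_norm.
by exists x => // i; rewrite in_itv/= -ler_norml; exact: fM.
Qed.

(** The absolute value allows a negative M, and the margin 1 keeps the support away from the left
    faces, which a half-open cube lacks. *)
Definition big_cube n (M : R) : set 'rV[R]_n :=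
  cube (const_mx (- (`|M| + 1))) (2 * (`|M| + 1)).

Lemma supp_in_big_cube n M (f : 'rV[R]_n -> R) : supp_in M f ->
  forall x, ~ @big_cube n M x -> f x = 0.
Proof.
move=> fM x nx; apply/eqP; apply: contra_notT nx => fx i; rewrite mxE.
have := fM _ fx i; rewrite ler_norml => /andP[? ?]; have := ler_norm M.
by move=> ?; apply/andP; split; lra.
Qed.

Lemma big_cube_volume n (M : R) :
  lebesgue_rV R n (@big_cube n M) = ((2 * (`|M| + 1)) ^+ n)%:E.
Proof. by apply: cube_volume; rewrite mulr_ge0// addr_ge0. Qed.

Lemma supp_in_L2 n M (f : 'rV[R]_n -> R) : continuous f -> supp_in M f ->
  f \in Lfun (lebesgue_rV R n) 2%:E.
Proof.
move=> cf fM; have [C C0 fC] := supp_in_bounded cf fM.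
have mf := continuous_measurable_rV cf.
apply/L2P; split => //.
apply: (@le_lt_trans _ _ (\int[lebesgue_rV R n]_(x in @big_cube n M) cst (C ^+ 2)%:E x)%E).
  rewrite [leRHS]integral_mkcond; apply: ge0_le_integral => //.
  - by move=> x _; rewrite lee_fin sqr_ge0.
  - by apply/measurable_EFinP/measurable_funX.
  - by apply: (measurable_restrictT _ (measurable_cube _ _)).1; exact: measurable_cst.
  - move=> x _; rewrite patchE; case: ifPn => [_|].
      by rewrite lee_fin -(@real_normK _ (f x)) ?num_real// lerXn2r ?nnegrE.
    by rewrite notin_setE => /(supp_in_big_cube fM) ->; rewrite expr0n.
rewrite integral_cst; last exact: measurable_cube.
by rewrite [X in (_ * X)%E]big_cube_volume -EFinM ltry.
Qed.

Lemma supp_in_integrable n M (f : 'rV[R]_n -> R) : continuous f -> supp_in M f ->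
  (lebesgue_rV R n).-integrable setT (EFin \o f).
Proof.
move=> cf fM; have fL := supp_in_L2 cf fM.
have mc : measurable (@big_cube n M) by exact: measurable_cube.
have iL : (\1_(@big_cube n M) : 'rV[R]_n -> R) \in Lfun (lebesgue_rV R n) 2%:E.
  by apply: L2_indicator => //; rewrite [X in (X < _)%E]big_cube_volume ltry.
have := L2_mul_integrable fL iL; apply: eq_integrable => // x _ /=.
rewrite indicE; case: (boolP (x \in _)) => [_|]; first by rewrite mulr1.
by rewrite notin_setE => /(supp_in_big_cube fM) ->; rewrite mul0r.
Qed.

End bounded_support.

(** * Integrals of partial derivatives *)

Section divergence.
Context (R : realType).
Local Notation leb := (@lebesgue_measure R).

Lemma integrable_cons n (F : 'rV[R]_n.+1 -> \bar R) :
  (lebesgue_rV R n.+1).-integrable setT F ->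
  (leb \x lebesgue_rV R n)%E.-integrable setT (fun p => F (rV_cons p)).
Proof.
move=> iF; have mF := measurable_int _ iF.
have mFc : measurable_fun setT (fun p => F (@rV_cons R n p)).
  by apply: measurableT_comp => //; exact: measurable_rV_cons.
apply/integrable12ltyP => //.
rewrite -(@integral_cons _ _ (fun x => `|F x|)%E)//; last exact: measurableT_comp.
by case/integrableP : iF.
Qed.

Lemma integral_cons_integrable n (F : 'rV[R]_n.+1 -> \bar R) :
  (lebesgue_rV R n.+1).-integrable setT F ->
  (\int[lebesgue_rV R n.+1]_x F x =
   \int[(leb \x lebesgue_rV R n)%E]_p F (rV_cons p))%E.
Proof.
move=> iF; have mF := measurable_int _ iF.
rewrite /= (integral_pushforward (@measurable_rV_cons R n))//.
by rewrite preimage_setT; exact: integrable_cons.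
Qed.

Lemma integral_line0 (psi g : R -> R) (M : R) : (forall t, derivable psi t 1) ->
  (forall t, 'D_1 psi t = g t) -> continuous g ->
  (forall t, psi t != 0 -> `|t| <= M) -> (forall t, g t != 0 -> `|t| <= M) ->
  (\int[leb]_t (g t)%:E = 0)%E.
Proof.
move=> dpsi psig cg psiM gM.
pose L := `|M| + 1; have LM : M < L by rewrite /L ltr_pwDr// ler_norm.
have L0 : 0 < L by rewrite /L ltr_pwDr.
have zero (f : R -> R) t : (forall t, f t != 0 -> `|t| <= M) -> L <= `|t| -> f t = 0.
  move=> fM Lt; apply/eqP; apply: contraTT (lt_le_trans LM Lt) => /fM.
  by rewrite -leNgt.
have LL : - L < L by rewrite gtrN.
have [ig intg] := @FTC_continuous R psi g dpsi psig cg _ _ LL.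
have -> : (\int[leb]_t (g t)%:E = \int[leb]_(t in `[(- L)%R, L]) (g t)%:E)%E.
  rewrite [RHS]integral_mkcond; apply: eq_integral => t _; rewrite patchE.
  case: ifPn => //; rewrite notin_setE/= in_itv/= -ler_norml => /negP.
  by rewrite -ltNge => /ltW Lt; rewrite (_ : g t = 0)//; exact: zero gM Lt.
rewrite -[LHS]fineK; last exact: integrable_fin_num.
rewrite [X in X%:E](_ : _ = psi L - psi (- L))//.
by rewrite !(zero psi)// ?subrr// ?normrN ger0_norm// ltW.
Qed.

(** Fubini in the order suited to the direction: for the first coordinate the inner integral runs
    over a line and vanishes by the fundamental theorem of calculus; for another one it runs over a
    slice and vanishes by induction. *)
Lemma integral_partial0 n (phi : 'rV[R]_n -> R) M i : C1 phi -> supp_in M phi ->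
  (\int[lebesgue_rV R n]_x (partial i phi x)%:E = 0)%E.
Proof.
elim: n phi i => [phi []//|n IH phi i C1phi phiM].
have iF : (lebesgue_rV R n.+1).-integrable setT (EFin \o partial i phi).
  by apply: supp_in_integrable; [exact: (C1phi.2 i).1|exact: supp_in_partial phiM].
rewrite integral_cons_integrable//.
case: (unliftP ord0 i) iF => [j ->|->] iF.
  rewrite -(integral12_prod_meas1 (integrable_cons iF)).
  apply: integral0_eq => t _; rewrite /fubini_F.
  have := IH (fun y => phi (rV_cons (t, y))) j (@C1_slice _ _ _ C1phi t).
  rewrite partial_slice; apply => y /= py k.
  by have := phiM _ py (lift ord0 k); rewrite rV_consS.
rewrite -(integral21_prod_meas1 (integrable_cons iF)).
apply: integral0_eq => y _; rewrite /fubini_G.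
apply: (@integral_line0 (fun t => phi (rV_cons (t, y))) _ M) => [t|t||t|t].
- exact: derivable_line.
- exact: derive_line.
- exact: continuous_line.
- by move/phiM => /(_ ord0); rewrite rV_cons0.
- by move/(supp_in_partial phiM) => /(_ ord0); rewrite rV_cons0.
Qed.

End divergence.

(** * Smooth functions and test functions *)

Section smooth.
Context (R : realType) (n : nat).
Implicit Types f g phi : 'rV[R]_n -> R.

Lemma smooth_continuous phi : smooth phi -> continuous phi.
Proof. by move=> /(_ [::])[]. Qed.

Lemma smooth_derivable phi : smooth phi ->
  forall i x, derivable phi x (delta_mx ord0 i).
Proof. by move=> /(_ [::])[]. Qed.

Lemma smooth_partial phi i : smooth phi -> smooth (partial i phi).
Proof. by move=> sphi s; have := sphi (rcons s i); rewrite foldr_rcons. Qed.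

Lemma smooth_C1 phi : smooth phi -> C1 phi.
Proof.
move=> sphi; split; first exact: smooth_continuous.
move=> i; split; first exact/smooth_continuous/smooth_partial.
exact: smooth_derivable.
Qed.

(** Coinduction: a class of continuous functions with partial derivatives in the class contains all
    iterated partial derivatives of its members. It spares an explicit formula for the iterated
    derivatives of sums and products. *)
Lemma smooth_coind (S : set ('rV[R]_n -> R)) :
  (forall f, S f -> continuous f /\ forall i,
     (forall x, derivable f x (delta_mx ord0 i)) /\ S (partial i f)) ->
  forall f, S f -> smooth f.
Proof.
move=> HS f Sf s /=.
have /HS[cs ds] : S (foldr (@partial R n) f s).
  elim: s => //= i s IH; exact: ((HS _ IH).2 i).2.
by split => // i; exact: (ds i).1.
Qed.

Lemma partial_cst (c : R) i : partial i (cst c : 'rV[R]_n -> R) = cst 0.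
Proof. by apply/funext => x; rewrite /partial derive_cst. Qed.

Lemma partialD f g i : (forall x, derivable f x (delta_mx ord0 i)) ->
  (forall x, derivable g x (delta_mx ord0 i)) ->
  partial i (f + g) = partial i f + partial i g.
Proof. by move=> df dg; apply/funext => x; rewrite /partial deriveD. Qed.

Lemma partialM f g i : (forall x, derivable f x (delta_mx ord0 i)) ->
  (forall x, derivable g x (delta_mx ord0 i)) ->
  partial i (f * g) = f * partial i g + g * partial i f.
Proof. by move=> df dg; apply/funext => x; rewrite /partial deriveM. Qed.

Lemma smooth_cst (c : R) : smooth (cst c : 'rV[R]_n -> R).
Proof.
apply: (@smooth_coind [set f | exists c : R, f = cst c]); last by exists c.
move=> _ [{}c ->]; split; first exact: cst_continuous.
by move=> i; split; [move=> x; exact: derivable_cst|exists 0; rewrite partial_cst].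
Qed.

Lemma smoothD f g : smooth f -> smooth g -> smooth (f + g).
Proof.
move=> sf sg.
apply: (@smooth_coind [set h | exists f g, [/\ smooth f, smooth g & h = f + g]]).
  move=> _ [{sf}f [{sg}g [sf sg ->]]]; split.
    by apply: continuous_funD; exact: smooth_continuous.
  move=> i; split; first by move=> x; apply: derivableD; exact: smooth_derivable.
  exists (partial i f), (partial i g); split; [exact: smooth_partial..|].
  by rewrite partialD//; exact: smooth_derivable.
by exists f, g.
Qed.

(** The Leibniz rule leads out of the class of products; this is the class closed under it, to which
    [smooth_coind] applies. *)
Inductive sum_of_products : ('rV[R]_n -> R) -> Prop :=
| sum_of_products_mul f g : smooth f -> smooth g -> sum_of_products (f * g)
| sum_of_products_add f g : sum_of_products f -> sum_of_products g ->
    sum_of_products (f + g).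

Lemma smoothM f g : smooth f -> smooth g -> smooth (f * g).
Proof.
move=> sf sg; apply: (@smooth_coind sum_of_products); last first.
  exact: sum_of_products_mul.
move=> h; elim=> {f g sf sg h} [f g sf sg|f g _ [cf df] _ [cg dg]].
  have df := smooth_derivable sf; have dg := smooth_derivable sg.
  split; first by apply: continuous_funM; exact: smooth_continuous.
  move=> i; split; first by move=> x; apply: derivableM.
  rewrite partialM//; apply: sum_of_products_add; apply: sum_of_products_mul => //;
    exact: smooth_partial.
split; first exact: continuous_funD.
move=> i; split.
  by move=> x; apply: derivableD; [exact: (df i).1|exact: (dg i).1].
rewrite partialD; [|exact: (df i).1|exact: (dg i).1].
by apply: sum_of_products_add; [exact: (df i).2|exact: (dg i).2].
Qed.

Lemma smoothZ (c : R) f : smooth f -> smooth (c *: f).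
Proof. by move=> sf; apply: (smoothM (smooth_cst c) sf). Qed.

Lemma partialZ (c : R) f i : (forall x, derivable f x (delta_mx ord0 i)) ->
  partial i (c *: f) = c *: partial i f.
Proof.
move=> df; apply/funext => x; rewrite /partial.
by rewrite [LHS](@deriveZ _ _ _ f c x (delta_mx ord0 i) (df x)).
Qed.

Lemma test_smooth U phi : test_function U phi -> smooth phi.
Proof. by case. Qed.

Lemma test_C1 U phi : test_function U phi -> C1 phi.
Proof. by move=> /test_smooth/smooth_C1. Qed.

Lemma test_supp_in U phi : test_function U phi -> exists M, supp_in M phi.
Proof.
move=> [_ /compact_bounded[M [_ HM]] _].
have H : closure [set x | phi x != 0] `<=` [set x | `|x| <= M + 1].
  by apply: HM; rewrite ltrDl.
exists (M + 1) => x px i.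
have /H : closure [set x | phi x != 0] x by exact: subset_closure.
apply: le_trans; rewrite [leRHS](mx_normrE x).
exact: (le_bigmax _ (fun p => `|x p.1 p.2|) (ord0, i)).
Qed.

Lemma test_zero U phi : test_function U phi -> forall x, ~ U x -> phi x = 0.
Proof.
move=> [_ _ sU] x nUx; apply/eqP; apply: contra_notT nUx => px.
by apply: sU; exact: subset_closure.
Qed.

Lemma test_supp_sub U phi psi : test_function U phi -> smooth psi ->
  [set x | psi x != 0] `<=` closure [set x | phi x != 0] -> test_function U psi.
Proof.
move=> [_ cphi phiU] spsi sub.
have csub : closure [set x | psi x != 0] `<=` closure [set x | phi x != 0].
  rewrite [X in _ `<=` X](closure_id _).1; last exact: closed_closure.
  exact: closure_subset.
split => //; last exact: subset_trans phiU.
by apply: (subclosed_compact _ cphi csub); exact: closed_closure.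
Qed.

Lemma test_partial U phi i : test_function U phi -> test_function U (partial i phi).
Proof.
move=> tphi; apply: (test_supp_sub tphi).
  exact/smooth_partial/(test_smooth tphi).
move=> x /= px; apply: contrapT => nx; move/eqP: px; apply.
rewrite /partial (_ : 'D_ _ phi x = 'D_(delta_mx ord0 i) (cst 0) x).
  by rewrite derive_cst.
apply: near_eq_derive.
have : nbhs x (~` closure [set x | phi x != 0]).
  by apply: open_nbhs_nbhs; split => //; rewrite openC; exact: closed_closure.
apply: filterS => y ny; apply/eqP; apply: contra_notT ny => py; apply: subset_closure; exact: py.
Qed.

Lemma test_mul U phi eta : smooth eta -> test_function U phi ->
  test_function U (eta * phi).
Proof.
move=> seta tphi; apply: (test_supp_sub tphi).
  by apply: smoothM => //; exact: test_smooth tphi.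
move=> x /= H; apply: subset_closure => /=; apply: contraNN H => /eqP H.
by rewrite fctE H mulr0.
Qed.

Lemma test_lin U (c : R) phi psi : test_function U phi -> test_function U psi ->
  test_function U (c *: phi + psi).
Proof.
move=> tphi tpsi; have [sphi cphi phiU] := tphi; have [spsi cpsi psiU] := tpsi.
have sub : closure [set x | (c *: phi + psi) x != 0] `<=`
    closure [set x | phi x != 0] `|` closure [set x | psi x != 0].
  rewrite -closureU; apply: closure_subset => x /= H.
  have [p0|] := eqVneq (phi x) 0; last by left.
  by right; apply: contraNneq H => q0; rewrite !fctE p0 q0 scaler0 addr0.
split.
- by apply: smoothD => //; exact: smoothZ.
- apply: (subclosed_compact _ _ sub); first exact: closed_closure.
  exact: compactU.
- by apply: (subset_trans sub) => x [/phiU|/psiU].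
Qed.

Lemma test_subset U V phi : U `<=` V -> test_function U phi -> test_function V phi.
Proof. by move=> UV [? ? ?]; split => //; exact: subset_trans UV. Qed.

Lemma test_0 U : test_function U (0 : 'rV[R]_n -> R).
Proof.
have E : [set x : 'rV[R]_n | (0 : 'rV[R]_n -> R) x != 0] = set0.
  by apply/seteqP; split => // x /=; rewrite eqxx.
split; first exact: smooth_cst.
  by rewrite E closure0; exact: compact0.
by rewrite E closure0.
Qed.

Lemma test_L2 U phi : test_function U phi -> phi \in Lfun (lebesgue_rV R n) 2%:E.
Proof.
move=> tphi; have [M phiM] := test_supp_in tphi.
by apply: supp_in_L2 phiM; exact/smooth_continuous/(test_smooth tphi).
Qed.

(** The product phi psi has compact support although phi may not, so the integral of its partial
    derivative is 0. *)
Lemma test_by_parts U phi psi i : smooth phi -> test_function U psi ->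
  \int[lebesgue_rV R n]_x (phi x * partial i psi x) =
  - \int[lebesgue_rV R n]_x (partial i phi x * psi x).
Proof.
move=> sphi tpsi; have tphipsi := test_mul sphi tpsi.
have [M HM] := test_supp_in tphipsi.
have := @integral_partial0 _ _ _ _ i (test_C1 tphipsi) HM.
rewrite partialM; [|exact: smooth_derivable|exact/smooth_derivable/(test_smooth tpsi)].
have t1 := test_mul sphi (test_partial i tpsi).
have t2 := test_mul (smooth_partial i sphi) tpsi.
have int U' f : test_function U' f -> (lebesgue_rV R n).-integrable setT (EFin \o f).
  move=> tf; have [M' HM'] := test_supp_in tf.
  by apply: supp_in_integrable HM'; exact/smooth_continuous/(test_smooth tf).
move=> /(congr1 fine)/=.
rewrite -[LHS]/(\int[lebesgue_rV R n]_x ((phi * partial i psi) x + (psi * partial i phi) x)).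
rewrite RintegralD//; last 2 first.
- exact: int t1.
- by rewrite mulrC; exact: int t2.
move/eqP; rewrite addr_eq0 => /eqP ->; congr (- _).
by apply: eq_Rintegral => x _; rewrite !fctE mulrC.
Qed.

End smooth.

(** * The space H^1_0 *)

Section sobolev_forms.
Context (R : realType) (n : nat).
Local Notation mu := (lebesgue_rV R n).
Local Notation L2 := (Lfun mu 2%:E).
Local Notation pair := (sobolev_pair R n).
Implicit Types (u v w : pair) (U : set 'rV[R]_n) (phi : 'rV[R]_n -> R).

Definition gcomp u (i : 'I_n) : 'rV[R]_n -> R := fun x => u.2 x ord0 i.

(** The two components are unrelated: the forms are also applied to fields that are not gradients,
    such as [gradmul eta u]. *)
Definition L2pair : set pair := [set u | u.1 \in L2 /\ forall i, gcomp u i \in L2].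

(** The inner product whose square norm is that of [H10_norm]; [sform] is the one of [H1_norm]. *)
Definition gform u v : R := \sum_i ip mu (gcomp u i) (gcomp v i).

Definition sform u v : R := ip mu u.1 v.1 + gform u v.

Definition tp phi : pair := (phi, gradient phi).

Definition zero_off U u := forall x, ~ U x -> u.1 x = 0 /\ u.2 x = 0.

Lemma gcomp_lin (c : R) u v i : gcomp (c *: u + v) i = c *: gcomp u i + gcomp v i.
Proof. by apply/funext => x; rewrite /gcomp !mxE. Qed.

Lemma gcompB u v i : gcomp (u - v) i = gcomp u i - gcomp v i.
Proof. by apply/funext => x; rewrite /gcomp !mxE. Qed.

Lemma gcomp_tp phi i : gcomp (tp phi) i = partial i phi.
Proof. by apply/funext => x; rewrite /gcomp mxE. Qed.

Lemma L2pair0 : L2pair 0.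
Proof.
split; first exact: L2_0.
by move=> i; rewrite (_ : gcomp 0 i = 0) ?L2_0//; apply/funext => x; rewrite /gcomp mxE.
Qed.

Lemma L2pair_lin (c : R) u v : L2pair u -> L2pair v -> L2pair (c *: u + v).
Proof.
move=> [u1 u2] [v1 v2]; split; first exact: L2_lin.
by move=> i; rewrite gcomp_lin; exact: L2_lin.
Qed.

Lemma gform_psd : psd_form L2pair gform.
Proof.
have ipP := ip_form mu; split.
- exact: L2pair0.
- exact: L2pair_lin.
- move=> c u v w [_ u2] [_ v2] [_ w2]; rewrite /gform mulr_sumr -big_split/=.
  apply: eq_bigr => i _; rewrite gcomp_lin.
  by rewrite (psdDl ipP) ?(psdZl ipP)//; [exact: u2|exact: w2|exact: L2_Z|exact: v2|exact: w2].
- by move=> u v [_ u2] [_ v2]; apply: eq_bigr => i _; rewrite (psdC ipP)//; [exact: u2|exact: v2].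
- by move=> u _; apply: sumr_ge0 => i _; exact: ip_ge0.
Qed.

Lemma sform_psd : psd_form L2pair sform.
Proof.
have ipP := ip_form mu; have gP := gform_psd; split.
- exact: L2pair0.
- exact: L2pair_lin.
- move=> c u v w Lu Lv Lw; rewrite /sform.
  have [[u1 _] [v1 _] [w1 _]] := And3 Lu Lv Lw.
  rewrite (psdDl gP)// ?(psdZl gP)//; last by rewrite -[_ *: _]addr0; apply: L2pair_lin => //; exact: L2pair0.
  rewrite (psdDl ipP) ?(psdZl ipP)//; first ring.
  exact: L2_Z.
- by move=> u v Lu Lv; rewrite /sform (psdC gP)// (psdC ipP)//; [exact: Lu.1|exact: Lv.1].
- by move=> u Lu; rewrite addr_ge0 ?ip_ge0// (psd_ge0 gP).
Qed.

Lemma ip_le_sform u : L2pair u -> ip mu u.1 u.1 <= sform u u.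
Proof. by move=> Lu; rewrite lerDl (psd_ge0 gform_psd). Qed.

Lemma ip_comp_le_gform u i : L2pair u -> ip mu (gcomp u i) (gcomp u i) <= gform u u.
Proof.
move=> Lu; rewrite /gform (bigD1 i)//= lerDl sumr_ge0// => j _; exact: ip_ge0.
Qed.

Lemma gform_le_sform u : L2pair u -> gform u u <= sform u u.
Proof. by move=> Lu; rewrite lerDr ip_ge0. Qed.

Lemma L2pair_tp U phi : test_function U phi -> L2pair (tp phi).
Proof.
move=> tphi; split; first exact: test_L2 tphi.
by move=> i; rewrite gcomp_tp; apply: test_L2; exact: test_partial tphi.
Qed.

Lemma zero_off_tp U phi : test_function U phi -> zero_off U (tp phi).
Proof.
move=> tphi x nUx; split; first exact: test_zero tphi _ nUx.
by apply/rowP => i; rewrite !mxE; exact: test_zero (test_partial i tphi) _ nUx.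
Qed.

Lemma zero_off_lin U (c : R) u v : zero_off U u -> zero_off U v ->
  zero_off U (c *: u + v).
Proof.
move=> zu zv x nUx; have [u1 u2] := zu x nUx; have [v1 v2] := zv x nUx; split.
  by rewrite [LHS](_ : _ = c * u.1 x + v.1 x)// u1 v1 mulr0 addr0.
by rewrite [LHS](_ : _ = c *: u.2 x + v.2 x)// u2 v2 scaler0 addr0.
Qed.

Lemma tp_lin (c : R) U phi psi : test_function U phi -> test_function U psi ->
  tp (c *: phi + psi) = c *: tp phi + tp psi.
Proof.
move=> tphi tpsi.
suff E : gradient (c *: phi + psi) = c *: gradient phi + gradient psi by rewrite /tp E.
apply/funext => x; apply/rowP => i; rewrite !mxE.
have dphi := smooth_derivable (test_smooth tphi).
have dpsi := smooth_derivable (test_smooth tpsi).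
rewrite partialD//; first by rewrite partialZ//.
exact: (smooth_derivable (smoothZ c (test_smooth tphi))).
Qed.

Lemma Rintegral_zero_off U (f : 'rV[R]_n -> R) : (forall x, ~ U x -> f x = 0) ->
  \int[mu]_(x in U) f x = \int[mu]_x f x.
Proof.
move=> f0; rewrite Rintegral_mkcond; apply: eq_Rintegral => x _.
by rewrite patchE; case: ifPn => //; rewrite notin_setE => /f0.
Qed.

Lemma integrable_sumr (I : Type) (s : seq I) (F : I -> 'rV[R]_n -> R) :
  (forall i, mu.-integrable setT (EFin \o F i)) ->
  mu.-integrable setT (EFin \o (fun x => \sum_(i <- s) F i x)).
Proof.
move=> iF; have := @integrable_sum _ _ _ mu setT measurableT _ s xpredT (fun i => EFin \o F i).
move=> /(_ (fun i _ => iF i)); apply: eq_integrable => // x _ /=.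
by rewrite sumEFin.
Qed.

Lemma Rintegral_sum (I : Type) (s : seq I) (F : I -> 'rV[R]_n -> R) :
  (forall i, mu.-integrable setT (EFin \o F i)) ->
  \int[mu]_x (\sum_(i <- s) F i x) = \sum_(i <- s) \int[mu]_x F i x.
Proof.
move=> iF; elim: s => [|i s IH].
  rewrite big_nil; under eq_Rintegral do rewrite big_nil.
  by rewrite Rintegral_cst// mul0r.
rewrite big_cons -IH -RintegralD//; last exact: integrable_sumr.
by apply: eq_Rintegral => x _; rewrite big_cons.
Qed.

Lemma Rintegral_dotp u v : L2pair u -> L2pair v ->
  \int[mu]_x dotp (u.2 x) (v.2 x) = gform u v.
Proof.
move=> Lu Lv; rewrite /dotp Rintegral_sum// => i.
by apply: L2_mul_integrable; [exact: Lu.2|exact: Lv.2].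
Qed.

Lemma H10_normE U u : L2pair u -> zero_off U u ->
  H10_norm U u = Num.sqrt (gform u u).
Proof.
move=> Lu zu; rewrite /H10_norm Rintegral_zero_off ?Rintegral_dotp//.
by move=> x /zu[_ ->]; rewrite /dotp big1// => i _; rewrite mxE mul0r.
Qed.

Lemma H1_normE U u : L2pair u -> zero_off U u ->
  H1_norm U u = Num.sqrt (sform u u).
Proof.
move=> Lu zu.
rewrite /H1_norm 2?(@Rintegral_zero_off U) ?Rintegral_dotp//.
- by move=> x /zu[_ ->]; rewrite /dotp big1// => i _; rewrite mxE mul0r.
- by move=> x /zu[-> _]; rewrite expr0n.
Qed.

Lemma H1_L2pair U u : H1 U u -> L2pair u.
Proof. by case. Qed.

Lemma H1_zero_off U u : H1 U u -> zero_off U u.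
Proof. by case. Qed.

Lemma sqrt_cvg0 (s : nat -> R) : (forall k, 0 <= s k) ->
  (fun k => Num.sqrt (s k)) @ \oo --> (0 : R) <-> s @ \oo --> (0 : R).
Proof.
move=> s0; split => [H|H].
  rewrite (_ : s = fun k => Num.sqrt (s k) * Num.sqrt (s k)).
    by rewrite -[X in _ --> X](mul0r (0 : R)); exact: cvgM.
  by apply/funext => k; rewrite -expr2 sqr_sqrtr.
rewrite -sqrtr0; apply: continuous_cvg => //; exact: sqrt_continuous.
Qed.

(** Also used with e = 0 and a zero second sequence, to scale a single sequence; hence the terms
    [0 * 0] further on. *)
Lemma cvg0_comb (c e : R) (s t : nat -> R) : s @ \oo --> (0 : R) ->
  t @ \oo --> (0 : R) -> (fun k => c * s k + e * t k) @ \oo --> (0 : R).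
Proof.
move=> s0 t0; rewrite -[X in _ --> X](_ : c * 0 + e * 0 = 0); last first.
  by rewrite !mulr0 addr0.
apply: cvgD.
  exact: (@cvgM _ _ \oo _ (cst c) s c 0 (cvg_cst c) s0).
exact: (@cvgM _ _ \oo _ (cst e) t e 0 (cvg_cst e) t0).
Qed.

Lemma L2pairB u v : L2pair u -> L2pair v -> L2pair (u - v).
Proof. by move=> Lu Lv; rewrite addrC -scaleN1r; exact: L2pair_lin. Qed.

Lemma zero_offB U u v : zero_off U u -> zero_off U v -> zero_off U (u - v).
Proof. by move=> Lu Lv; rewrite addrC -scaleN1r; exact: zero_off_lin. Qed.

(** The weak gradient identity of [H1] is recovered from the approximation: it is integration by
    parts for the test functions phi_k, and both of its sides are continuous for the L^2 norm. *)
Lemma H10P U u : H10 U u <-> [/\ L2pair u, zero_off U u &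
  exists phi : nat -> 'rV[R]_n -> R, (forall k, test_function U (phi k)) /\
    (fun k => sform (u - tp (phi k)) (u - tp (phi k))) @ \oo --> (0 : R)].
Proof.
split=> [[H1u [phi [tphi cphi]]]|[Lu zu [phi [tphi cphi]]]].
  have Lu := H1_L2pair H1u; have zu := H1_zero_off H1u; split => //.
  exists phi; split => //; apply/sqrt_cvg0.
    by move=> k; apply: (psd_ge0 sform_psd); apply: L2pairB => //; exact: L2pair_tp (tphi k).
  apply: cvg_trans cphi; apply: near_eq_cvg; apply: nearW => k.
  rewrite -(@H1_normE U)//; first by apply: L2pairB => //; exact: L2pair_tp (tphi k).
  by apply: zero_offB => //; exact: zero_off_tp.
have Ltp k : L2pair (tp (phi k)) := L2pair_tp (tphi k).
have LB k : L2pair (u - tp (phi k)) by exact: L2pairB.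
split; last first.
  exists phi; split => //.
  have s0 k : 0 <= sform (u - tp (phi k)) (u - tp (phi k)) by exact: (psd_ge0 sform_psd).
  move/(sqrt_cvg0 s0) : cphi; apply: cvg_trans; apply: near_eq_cvg; apply: nearW => k.
  by rewrite -(@H1_normE U)//; apply: zero_offB => //; exact: zero_off_tp.
have ipP := ip_form mu.
split; [exact: Lu.1|exact: Lu.2|exact: zu|].
move=> psi tpsi i.
have tdpsi := test_partial i tpsi.
rewrite 2?(@Rintegral_zero_off U); last 2 first.
- by move=> x nUx; rewrite (test_zero tpsi nUx) mulr0.
- by move=> x nUx; rewrite (test_zero tdpsi nUx) mulr0.
have sub (f_ : nat -> 'rV[R]_n -> R) f g : (forall k, f_ k \in L2) -> f \in L2 ->
    g \in L2 -> (forall k, ip mu (f_ k - f) (f_ k - f) <=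
      sform (u - tp (phi k)) (u - tp (phi k))) ->
    (fun k => ip mu (f_ k) g) @ \oo --> ip mu f g.
  move=> f_L fL gL H; apply: (cvg_psd_left ipP) => //.
  apply: (squeeze_cvgr _ (cvg_cst 0) cphi); apply: nearW => k.
  by rewrite ip_ge0 H.
have c1 : (fun k => ip mu (phi k) (partial i psi)) @ \oo --> ip mu u.1 (partial i psi).
  apply: sub => [k||| k]; [exact: test_L2 (tphi k)|exact: Lu.1|exact: test_L2 tdpsi|].
  apply: le_trans (ip_le_sform (LB k)).
  rewrite (_ : phi k - u.1 = - (u - tp (phi k)).1); last by rewrite opprB.
  by rewrite le_eqVlt; apply/orP; left; apply/eqP/eq_Rintegral => x _; rewrite fctE mulrNN.
have c2 : (fun k => ip mu (partial i (phi k)) psi) @ \oo --> ip mu (gcomp u i) psi.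
  apply: sub => [k||| k]; [exact: test_L2 (test_partial i (tphi k))|exact: Lu.2|exact: test_L2 tpsi|].
  apply: le_trans (gform_le_sform (LB k)).
  apply: le_trans (ip_comp_le_gform i (LB k)).
  rewrite gcompB gcomp_tp.
  rewrite (_ : partial i (phi k) - gcomp u i = - (gcomp u i - partial i (phi k))); last by rewrite opprB.
  by rewrite le_eqVlt; apply/orP; left; apply/eqP/eq_Rintegral => x _; rewrite fctE mulrNN.
have c3 : (fun k => ip mu (phi k) (partial i psi)) @ \oo --> - ip mu (gcomp u i) psi.
  rewrite (_ : (fun k => _) = (fun k => - ip mu (partial i (phi k)) psi)); first exact: cvgN.
  by apply/funext => k; rewrite /ip (test_by_parts i (test_smooth (tphi k)) tpsi).
exact: (cvg_unique _ c1 c3).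
Qed.

Lemma H10_L2pair U u : H10 U u -> L2pair u.
Proof. by case/H10P. Qed.

Lemma H10_zero_off U u : H10 U u -> zero_off U u.
Proof. by case/H10P. Qed.

Lemma H10_tp U phi : test_function U phi -> H10 U (tp phi).
Proof.
move=> tphi; apply/H10P; split; [exact: L2pair_tp tphi|exact: zero_off_tp|].
exists (fun=> phi); split => //; rewrite subrr.
by rewrite (psd0l sform_psd); [exact: cvg_cst|exact: L2pair0].
Qed.

Lemma sformN u : L2pair u -> sform (- u) (- u) = sform u u.
Proof.
by move=> Lu; rewrite -scaleN1r (psd_sqrZ sform_psd)// sqrrN expr1n mul1r.
Qed.

Lemma H10_lin U (c : R) u v : H10 U u -> H10 U v -> H10 U (c *: u + v).
Proof.
move=> /H10P[Lu zu [phi [tphi cphi]]] /H10P[Lv zv [psi [tpsi cpsi]]].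
apply/H10P; split; [exact: L2pair_lin|exact: zero_off_lin|].
exists (fun k => c *: phi k + psi k); split; first by move=> k; exact: test_lin.
have P := sform_psd.
have LB k : L2pair (u - tp (phi k)) by apply: L2pairB => //; exact: L2pair_tp (tphi k).
have LB' k : L2pair (v - tp (psi k)) by apply: L2pairB => //; exact: L2pair_tp (tpsi k).
pose s k := (2 * c ^+ 2) * sform (u - tp (phi k)) (u - tp (phi k))
  + 2 * sform (v - tp (psi k)) (v - tp (psi k)).
have cs : s @ \oo --> (0 : R).
  exact: cvg0_comb.
apply: (squeeze_cvgr _ (cvg_cst 0) cs); apply: nearW => k.
rewrite (tp_lin c (tphi k) (tpsi k)).
rewrite (_ : _ - _ = c *: (u - tp (phi k)) + (v - tp (psi k))); last first.
  by rewrite scalerBr addrACA -opprD.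
have LZ : L2pair (c *: (u - tp (phi k))) by exact: (psdXZ P).
rewrite (psd_ge0 P)/=; last exact: (psdXD P).
by apply: (le_trans (psd_sqrD_le P LZ (LB' k))); rewrite (psd_sqrZ P)// mulrA.
Qed.

Lemma H10_0 U : H10 U 0.
Proof.
have := H10_tp (@test_0 R n U) => H.
by have := H10_lin (-1) H H; rewrite scaleN1r addNr.
Qed.

Lemma H10_psd U a : psd_form L2pair a -> psd_form (H10 U) a.
Proof.
move=> aP; split.
- exact: H10_0.
- by move=> *; exact: H10_lin.
- move=> c u v w /H10_L2pair Lu /H10_L2pair Lv /H10_L2pair Lw.
  rewrite (psdDl aP)// ?(psdZl aP)//; exact: (psdXZ aP).
- by move=> u v /H10_L2pair Lu /H10_L2pair Lv; exact: (psdC aP).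
- by move=> u /H10_L2pair Lu; exact: (psd_ge0 aP).
Qed.

(** Each u_k is replaced by a test function at squared distance at most 1 / (k + 1). *)
Lemma H10_closed U u (u_ : nat -> pair) : L2pair u -> zero_off U u -> (forall k, H10 U (u_ k)) ->
  (fun k => sform (u_ k - u) (u_ k - u)) @ \oo --> (0 : R) -> H10 U u.
Proof.
move=> Lu zu Hu_ cu_; apply/H10P; split => //.
have P := sform_psd.
have /choice[phi phiP] : forall k, exists phi, test_function U phi /\
    sform (u_ k - tp phi) (u_ k - tp phi) <= k.+1%:R^-1.
  move=> k; have /H10P[Lk zk [phi [tphi /cvgrPdist_le cphi]]] := Hu_ k.
  have k0 : 0 < k.+1%:R^-1 :> R by rewrite invr_gt0.
  have [N _ /(_ N (leqnn N))/=] := cphi _ k0.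
  by rewrite sub0r normrN => /(le_trans (ler_norm _)) H; exists (phi N).
exists phi; split; first by move=> k; exact: (phiP k).1.
have Lk k := H10_L2pair (Hu_ k).
have Lphi k := L2pair_tp (phiP k).1.
pose s k := 2 * sform (u_ k - u) (u_ k - u) + 2 * k.+1%:R^-1.
have cs : s @ \oo --> (0 : R).
  by apply: cvg0_comb => //; exact: cvg_harmonic.
apply: (squeeze_cvgr _ (cvg_cst 0) cs); apply: nearW => k.
rewrite (_ : u - _ = - (u_ k - u) + (u_ k - tp (phi k))); last first.
  by rewrite opprB addrA subrK.
have L1 : L2pair (u_ k - u) by exact: L2pairB.
have L1' : L2pair (- (u_ k - u)) by rewrite -scaleN1r; exact: (psdXZ P).
have L2 : L2pair (u_ k - tp (phi k)) by exact: L2pairB.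
rewrite (psd_ge0 P)/=; last exact: (psdXD P).
apply: (le_trans (psd_sqrD_le P L1' L2)); rewrite sformN// lerD2l ler_wpM2l//.
exact: (phiP k).2.
Qed.

Lemma H10_subset U V u : U `<=` V -> H10 U u -> H10 V u.
Proof.
move=> UV /H10P[Lu zu [phi [tphi cphi]]]; apply/H10P; split => //.
  by move=> x nVx; apply: zu => Ux; apply/nVx/UV.
by exists phi; split => // k; exact: test_subset UV (tphi k).
Qed.

End sobolev_forms.

(** * From oscillation to Poincare inequalities *)

Section cube_poincare.
Context (R : realType) (n : nat).
Local Notation mu := (lebesgue_rV R n).
Local Notation L2 := (Lfun mu 2%:E).

Lemma patch_indic (D : set 'rV[R]_n) (f : 'rV[R]_n -> R) :
  f \_ D = fun x => f x * \1_D x.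
Proof.
by apply/funext => x; rewrite patchE indicE; case: ifP; rewrite ?mulr1 ?mulr0.
Qed.

Lemma ip_patch (D : set 'rV[R]_n) (f g : 'rV[R]_n -> R) :
  ip mu (f \_ D) (g \_ D) = \int[mu]_(x in D) (f x * g x).
Proof.
rewrite Rintegral_mkcond; apply: eq_Rintegral => x _.
by rewrite !patchE; case: ifP; rewrite ?mulr0.
Qed.

Lemma ip_indic (D : set 'rV[R]_n) (f : 'rV[R]_n -> R) :
  ip mu f \1_D = \int[mu]_(x in D) f x.
Proof. by rewrite Rintegral_mkcond patch_indic. Qed.

Section finite_domain.
Variables (D : set 'rV[R]_n) (m : R) (f : 'rV[R]_n -> R).
Hypotheses (mD : measurable D) (muD : mu D = m%:E) (fL : f \in L2).

Let iD : (\1_D : 'rV[R]_n -> R) \in L2.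
Proof. by apply: L2_indicator => //; rewrite [X in (X < _)%E]muD ltry. Qed.

Let intf : mu.-integrable D (EFin \o f).
Proof.
apply/integrable_mkcond => //; rewrite restrict_EFin patch_indic.
exact: L2_mul_integrable.
Qed.

Let intf2 : mu.-integrable D (EFin \o (fun x => f x ^+ 2)).
Proof. by apply: (@integrableS _ _ _ mu setT) => //; exact: Lfun2_integrable_sqr. Qed.

Let intc (c : R) : mu.-integrable D (EFin \o cst c).
Proof.
apply/integrable_mkcond => //; rewrite restrict_EFin patch_indic.
have := L2_mul_integrable (L2_Z c iD) iD; apply: eq_integrable => // x _.
change ((c * \1_D x * \1_D x)%:E = (c * \1_D x)%:E).
by rewrite indicE; case: (x \in D); rewrite ?mulr1// ?mulr0.
Qed.

Lemma integral_quadratic (c b e : R) :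
  (\int[mu]_(x in D) (c * f x ^+ 2 + b * f x + e)%:E =
  (c * ip mu (f \_ D) (f \_ D) + b * ip mu f \1_D + e * m)%:E)%E.
Proof.
have i1 : mu.-integrable D (EFin \o (fun x => c * f x ^+ 2)).
  exact: (integrableZl mD c intf2).
have i2 : mu.-integrable D (EFin \o (fun x => b * f x)).
  exact: (integrableZl mD b intf).
have i12 : mu.-integrable D (EFin \o (fun x => c * f x ^+ 2 + b * f x)).
  exact: (integrableD mD i1 i2).
have i123 : mu.-integrable D (EFin \o (fun x => c * f x ^+ 2 + b * f x + e)).
  exact: (integrableD mD i12 (intc e)).
rewrite -[LHS]fineK; last exact: integrable_fin_num.
rewrite -[X in X%:E]/(\int[mu]_(x in D) (c * f x ^+ 2 + b * f x + e)).
rewrite RintegralD//; last exact: intc.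
rewrite RintegralD// !RintegralZl// Rintegral_cst// [fine _](congr1 fine muD)/=.
by rewrite ip_patch ip_indic.
Qed.

Lemma double_integral_sqr_diff :
  (\int[mu]_(x in D) \int[mu]_(y in D) ((f x - f y) ^+ 2)%:E =
  (2 * (m * ip mu (f \_ D) (f \_ D)) - 2 * ip mu f \1_D ^+ 2)%:E)%E.
Proof.
set S := ip mu (f \_ D) (f \_ D); set I := ip mu f \1_D.
transitivity (\int[mu]_(x in D) (m * f x ^+ 2 + (- (2 * I)) * f x + S)%:E)%E.
  apply: eq_integral => x _.
  rewrite (eq_integral (fun y => (1 * f y ^+ 2 + (- (2 * f x)) * f y + f x ^+ 2)%:E)).
    by rewrite integral_quadratic -/S -/I; congr EFin; ring.
  by move=> y _; congr EFin; ring.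
by rewrite integral_quadratic -/S -/I; congr EFin; ring.
Qed.

End finite_domain.

(** Expanding the square, the double integral of [cube_osc] is 2 h^n int phi^2 - 2 (int phi)^2. The
    average is left on the right-hand side, to be absorbed in the Poincare inequality and kept as a
    linear form in the inequality of Rellich. *)
Lemma cube_poincare : exists2 K : R, 0 <= K &
  forall (a : 'rV[R]_n) (h : R) U (phi : 'rV[R]_n -> R), 0 < h -> test_function U phi ->
  ip mu (phi \_ (cube a h)) (phi \_ (cube a h)) <=
  (h ^+ n)^-1 * ip mu phi \1_(cube a h) ^+ 2 +
  K * h ^+ 2 * \sum_i ip mu (partial i phi \_ (cube a h)) (partial i phi \_ (cube a h)).
Proof.
have [K K0 HK] := @cube_osc R n; exists K => // a h U phi h0 tphi.
have := HK a h phi h0 (test_C1 tphi).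
have mQ : measurable (cube a h) by exact: measurable_cube.
have muQ : mu (cube a h) = (h ^+ n)%:E by apply: cube_volume; exact: ltW.
rewrite (double_integral_sqr_diff mQ muQ (test_L2 tphi)).
rewrite (eq_bigr (fun i => (ip mu (partial i phi \_ (cube a h)) (partial i phi \_ (cube a h)))%:E)); last first.
  move=> i _; rewrite -ip_EFin; last first.
    by apply: L2_indic => //; apply: test_L2; exact: test_partial tphi.
  rewrite [LHS]integral_mkcond; apply: eq_integral => x _.
  by rewrite !patchE; case: ifP; rewrite ?expr0n.
rewrite sumEFin -EFinM lee_fin.
set S := ip _ (phi \_ _) _; set I := ip _ _ _; set G := \sum_i _ => H.
have hn0 : 0 < h ^+ n by rewrite exprn_gt0.
have hn : h ^+ n != 0 by rewrite gt_eqF.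
have G0 : 0 <= G by apply: sumr_ge0 => i _; exact: ip_ge0.
rewrite -(@ler_pM2l _ (h ^+ n))// mulrDr mulrA mulfV// mul1r.
have -> : h ^+ n * (K * h ^+ 2 * G) = K * h ^+ n.+2 * G by rewrite (exprS _ n.+1) (exprS _ n); ring.
have : 0 <= K * h ^+ n.+2 * G.
  by apply: mulr_ge0 => //; apply: mulr_ge0 => //; exact: exprn_ge0 (ltW h0).
by move: H; move: (K * _ * G) (h ^+ n * S) (I ^+ 2) => X Y Z; lra.
Qed.

End cube_poincare.

Lemma cvg_psd_sqr (R : realType) (V : lmodType R) (X : set V) (a : V -> V -> R)
    (u_ : nat -> V) u : psd_form X a -> (forall k, X (u_ k)) -> X u ->
  (fun k => a (u_ k - u) (u_ k - u)) @ \oo --> (0 : R) ->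
  (fun k => a (u_ k) (u_ k)) @ \oo --> a u u.
Proof.
move=> aP Xu_ Xu cu.
have c1 := cvg_psd_left aP Xu_ Xu Xu cu.
have -> : (fun k => a (u_ k) (u_ k)) =
    (fun k => a (u_ k - u) (u_ k - u) + (a (u_ k) u + a (u_ k) u - a u u)).
  by apply/funext => k; rewrite (psd_sqrB aP)//; ring.
rewrite -[X in _ --> X](_ : 0 + (a u u + a u u - a u u) = a u u); last ring.
by apply: cvgD => //; apply: cvgB; [exact: cvgD|exact: cvg_cst].
Qed.

Section bounded_domain.
Context (R : realType) (n : nat).
Local Notation mu := (lebesgue_rV R n).
Local Notation L2 := (Lfun mu 2%:E).
Local Notation pair := (sobolev_pair R n).

Definition coord_bound (Om : set 'rV[R]_n) (M : R) :=
  forall x, Om x -> forall i, `|x ord0 i| <= M.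

Lemma bounded_coord_bound (Om : set 'rV[R]_n) : bounded_set Om ->
  exists M, coord_bound Om M.
Proof.
move=> [M [_ HM]]; exists (M + 1) => x Omx i.
have : `|x| <= M + 1 by apply: HM => //; rewrite ltrDl.
apply: le_trans; rewrite [leRHS](mx_normrE x).
exact: (le_bigmax _ (fun p => `|x p.1 p.2|) (ord0, i)).
Qed.

Lemma test_coord_bound Om M phi : coord_bound Om M -> test_function Om phi ->
  supp_in M phi.
Proof.
move=> OmM tphi x px; apply: OmM; apply: contrapT => nx.
by move: px; rewrite (test_zero tphi nx) eqxx.
Qed.

Lemma H10_approx Om (u : pair) : H10 Om u -> exists phi : nat -> 'rV[R]_n -> R,
  [/\ forall k, test_function Om (phi k),
   (fun k => sform (tp (phi k) - u) (tp (phi k) - u)) @ \oo --> (0 : R),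
   (fun k => ip mu (phi k) (phi k)) @ \oo --> ip mu u.1 u.1,
   (fun k => gform (tp (phi k)) (tp (phi k))) @ \oo --> gform u u &
   forall w, w \in L2 -> (fun k => ip mu (phi k) w) @ \oo --> ip mu u.1 w].
Proof.
move=> /H10P[Lu zu [phi [tphi cphi]]].
have Lphi k := L2pair_tp (tphi k).
have LB k : L2pair (tp (phi k) - u) by exact: L2pairB.
have E : (fun k => sform (tp (phi k) - u) (tp (phi k) - u)) @ \oo --> (0 : R).
  apply: cvg_trans cphi; apply: near_eq_cvg; apply: nearW => k.
  by rewrite -opprB sformN//; exact: L2pairB.
have ipE : (fun k => ip mu (phi k - u.1) (phi k - u.1)) @ \oo --> (0 : R).
  apply: (squeeze_cvgr _ (cvg_cst 0) E); apply: nearW => k.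
  by rewrite ip_ge0; exact: (ip_le_sform (LB k)).
have gE : (fun k => gform (tp (phi k) - u) (tp (phi k) - u)) @ \oo --> (0 : R).
  apply: (squeeze_cvgr _ (cvg_cst 0) E); apply: nearW => k.
  by rewrite (psd_ge0 (@gform_psd R n))//; exact: (gform_le_sform (LB k)).
exists phi; split => //.
- apply: (cvg_psd_sqr (ip_form mu)) => //; last exact: Lu.1.
  by move=> k; exact: (Lphi k).1.
- exact: (cvg_psd_sqr (@gform_psd R n)).
- move=> w wL; apply: (cvg_psd_left (ip_form mu)) => //; last exact: Lu.1.
  by move=> k; exact: (Lphi k).1.
Qed.

Lemma patch_supp M a h (f : 'rV[R]_n -> R) : supp_in M f ->
  big_cube M `<=` cube a h -> f \_ (cube a h) = f.
Proof.
move=> fM sub; apply/funext => x; rewrite patchE; case: ifPn => //.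
by rewrite notin_setE => nx; rewrite (supp_in_big_cube fM)// => /sub.
Qed.

(** On a cube with twice the side of a cube containing Om, Cauchy-Schwarz on the smaller cube bounds
    the average term by 2^-n times the squared L^2 norm. As n > 0, this is at most half of the
    left-hand side and is absorbed there, whence the factor 2 in the constant. *)
Lemma poincare_inequality Om : (0 < n)%N -> bounded_set Om ->
  exists2 P : R, 0 <= P & forall u : pair, H10 Om u -> ip mu u.1 u.1 <= P * gform u u.
Proof.
move=> n0 /bounded_coord_bound[M OmM].
have [K K0 HK] := cube_poincare R n.
pose L := `|M| + 1; have L0 : 0 < L by rewrite /L ltr_pwDr.
pose a : 'rV[R]_n := const_mx (- L); pose h := 4 * L.
have h0 : 0 < h by rewrite mulr_gt0.
have sub : big_cube M `<=` cube a h.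
  move=> x /= H i; have /andP[H1 H2] := H i; rewrite H1/=.
  apply: (le_trans H2); rewrite !mxE -/L /h; lra.
exists (2 * (K * h ^+ 2)); first by apply: mulr_ge0 => //; apply: mulr_ge0 => //; exact: sqr_ge0.
have Ptest phi : test_function Om phi ->
    ip mu phi phi <= 2 * (K * h ^+ 2) * gform (tp phi) (tp phi).
  move=> tphi; have phiM := test_coord_bound OmM tphi.
  have := HK a h _ _ h0 tphi.
  rewrite (patch_supp phiM sub) (eq_bigr (fun i => ip mu (gcomp (tp phi) i) (gcomp (tp phi) i))); last first.
    by move=> i _; rewrite gcomp_tp (patch_supp (@supp_in_partial _ _ _ _ i phiM) sub).
  rewrite -/(gform (tp phi) (tp phi)).
  have mS : measurable (@big_cube R n M) by exact: measurable_cube.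
  have SL : (\1_(@big_cube R n M) : 'rV[R]_n -> R) \in L2.
    by apply: L2_indicator => //; rewrite [X in (X < _)%E]big_cube_volume ltry.
  have -> : ip mu phi \1_(cube a h) = ip mu phi \1_(@big_cube R n M).
    apply: eq_Rintegral => x _; rewrite !indicE.
    case: (boolP (x \in big_cube M)) => xS.
      by rewrite mem_set//; apply: sub; exact: set_mem xS.
    move: xS; rewrite notin_setE => /(supp_in_big_cube phiM) ->.
    by rewrite !mul0r.
  have : ip mu phi \1_(@big_cube R n M) ^+ 2 <= ip mu phi phi * (2 * L) ^+ n.
    apply: (le_trans (psd_CauchySchwarz (ip_form mu) (test_L2 tphi) SL)).
    rewrite ler_wpM2l ?ip_ge0// -lee_fin -ip_EFin//.
    rewrite (eq_integral (fun x => (\1_(@big_cube R n M) x)%:E)); last first.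
      by move=> x _; rewrite indicE; case: (x \in _); rewrite ?expr1n ?expr0n.
    by rewrite integral_indic// setIT [X in (X <= _)%E]big_cube_volume.
  have -> : h ^+ n = 2 ^+ n * (2 * L) ^+ n by rewrite -exprMn; congr (_ ^+ _); rewrite /h; ring.
  have t0 : 0 < (2 * L) ^+ n by rewrite exprn_gt0// mulr_gt0.
  have q2 : 2 <= 2 ^+ n :> R.
    by rewrite -[leLHS]expr1 ler_eXn2l// ltr1n.
  set T := (2 * L) ^+ n in t0 *; set q := 2 ^+ n in q2 *.
  set I := ip mu phi _ ^+ 2; set S := ip mu phi phi; set G := gform _ _.
  move=> IS H.
  have S0 : 0 <= S by exact: ip_ge0.
  have : (q * T)^-1 * I <= 2^-1 * S.
    rewrite invfM -mulrA; apply: (@le_trans _ _ (q^-1 * S)).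
      rewrite ler_wpM2l ?invr_ge0//; first lra.
      by rewrite mulrC ler_pdivrMr.
    by rewrite ler_wpM2r// lef_pV2 ?posrE//; lra.
  rewrite -mulrA; move: H; set X := (q * T)^-1 * I; set Y := K * h ^+ 2 * G.
  by move=> *; lra.
move=> u /H10_approx[phi [tphi _ c1 c2 _]].
apply: (ler_cvg_to c1); last first.
  by apply: nearW => k; exact: Ptest (tphi k).
by apply: cvgM => //; exact: cvg_cst.
Qed.

End bounded_domain.

(** * Grids of cubes and the inequality of Rellich *)

Section rellich.
Context (R : realType) (n : nat).
Local Notation mu := (lebesgue_rV R n).
Local Notation L2 := (Lfun mu 2%:E).
Local Notation pair := (sobolev_pair R n).

Lemma sum_itv_natr (a h t : R) N : 0 <= h ->
  \sum_(j < N) ((a + j%:R * h < t <= a + j%:R * h + h)%R%:R : R) =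
  (a < t <= a + N%:R * h)%R%:R.
Proof.
move=> h0; elim: N => [|N IH].
  rewrite big_ord0 mul0r addr0; case: (boolP (a < t <= a)) => // /andP[a_t].
  by rewrite leNgt a_t.
rewrite big_ord_recr/= IH.
have e : a + N.+1%:R * h = a + N%:R * h + h by rewrite -natr1; ring.
rewrite e; set b := a + N%:R * h.
have ab : a <= b by rewrite lerDl mulr_ge0.
have [tb|bt] := leP t b.
  by rewrite andbT/= addr0 (le_trans tb)// ?lerDl// andbT.
by rewrite andbF add0r/= (le_lt_trans ab bt).
Qed.

Lemma indic_cubeE (a : 'rV[R]_n) (h : R) x :
  \1_(cube a h) x = \prod_i ((a ord0 i < x ord0 i <= a ord0 i + h)%R%:R : R).
Proof.
rewrite indicE; case: (boolP (x \in _)) => [/set_mem xQ|].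
  by rewrite big1// => i _; rewrite (xQ i).
rewrite notin_setE => nQ.
have [i ni] : exists i, ~~ (a ord0 i < x ord0 i <= a ord0 i + h).
  by apply/existsP; rewrite -negb_forall; apply/negP => /forallP.
by rewrite (bigD1 i)//= (negbTE ni) mul0r.
Qed.

Definition grid_point (a : 'rV[R]_n) (h : R) N (c : {ffun 'I_n -> 'I_N}) : 'rV[R]_n :=
  \row_i (a ord0 i + (c i)%:R * h).

(** Distributivity: the product over the coordinates of one-dimensional sums is the sum over the
    choices of one interval in each coordinate, that is, over the cells. *)
Lemma sum_indic_grid (a : 'rV[R]_n) (h : R) N x : 0 <= h ->
  \sum_(c : {ffun 'I_n -> 'I_N}) \1_(cube (grid_point a h c) h) x =
  \1_(cube a (N%:R * h)) x :> R.
Proof.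
move=> h0; rewrite indic_cubeE.
under [RHS]eq_bigr do rewrite -sum_itv_natr//.
rewrite bigA_distr_bigA/=; apply: eq_bigr => c _; rewrite indic_cubeE.
by apply: eq_bigr => i _; rewrite mxE.
Qed.

Lemma sum_ip_grid (M h : R) N (f : 'rV[R]_n -> R) : f \in L2 -> supp_in M f ->
  0 <= h -> N%:R * h = 2 * (`|M| + 1) ->
  \sum_(c : {ffun 'I_n -> 'I_N})
    ip mu (f \_ (cube (grid_point (const_mx (- (`|M| + 1))) h c) h))
          (f \_ (cube (grid_point (const_mx (- (`|M| + 1))) h c) h)) = ip mu f f.
Proof.
move=> fL fM h0 Nh.
set Q := fun c : {ffun 'I_n -> 'I_N} => cube (grid_point (const_mx (- (`|M| + 1))) h c) h.
have QL c : f \_ (Q c) \in L2 by apply: L2_indic => //; exact: measurable_cube.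
rewrite /ip -Rintegral_sum; last first.
  by move=> c; exact: (L2_mul_integrable (QL c) (QL c)).
apply: eq_Rintegral => x _.
rewrite (eq_bigr (fun c => f x * f x * \1_(Q c) x)); last first.
  move=> c _; rewrite patchE indicE; case: ifP; by rewrite ?mulr1 ?mulr0.
rewrite -mulr_sumr sum_indic_grid// Nh -/(@big_cube R n M).
rewrite indicE; case: (boolP (x \in _)); first by rewrite mulr1.
by rewrite notin_setE => /(supp_in_big_cube fM) ->; rewrite !mul0r.
Qed.

(* Cutting a cube containing Om into small cubes and summing the Poincare
   inequalities: up to a small multiple of the energy, the L^2 norm is
   controlled by the finitely many averages over the small cubes. *)
Lemma rellich_inequality Om (e : R) : bounded_set Om -> 0 < e ->
  exists (s : seq ('rV[R]_n -> R)) (C : R), [/\ 0 <= C,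
    forall w, w \in s -> w \in L2 &
    forall u : pair, H10 Om u ->
      ip mu u.1 u.1 <= C * (\sum_(w <- s) ip mu u.1 w ^+ 2) + e * gform u u].
Proof.
move=> /bounded_coord_bound[M OmM] e0.
have [K K0 HK] := cube_poincare R n.
pose L := 2 * (`|M| + 1); have L0 : 0 < L by rewrite /L mulr_gt0// ltr_pwDr.
have [N Ne] : exists N : nat, K * (L / N.+1%:R) ^+ 2 <= e.
  have c : (fun N : nat => (K * L ^+ 2) * (N.+1%:R^-1 * N.+1%:R^-1) + 0 * 0 : R) @ \oo --> (0 : R).
    apply: (@cvg0_comb _ _ _ (fun N => N.+1%:R^-1 * N.+1%:R^-1) (cst 0)); last exact: cvg_cst.
    by rewrite -[X in _ --> X](mulr0 (0 : R)); apply: cvgM; exact: cvg_harmonic.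
  move/cvgrPdist_le : c => /(_ _ e0)[N _ /(_ N (leqnn N))/=].
  rewrite sub0r normrN => /(le_trans (ler_norm _)) H; exists N.
  apply: le_trans H; set y := N.+1%:R^-1.
  by rewrite le_eqVlt; apply/orP; left; apply/eqP; ring.
pose h := L / N.+1%:R.
have h0 : 0 < h by rewrite divr_gt0.
have Nh : N.+1%:R * h = L by rewrite /h mulrCA mulfV ?mulr1.
pose Q c := cube (@grid_point (const_mx (- (`|M| + 1))) h N.+1 c) h.
pose s := [seq (\1_(Q c) : 'rV[R]_n -> R) | c <- enum {ffun 'I_n -> 'I_N.+1}].
have mQ c : measurable (Q c) by exact: measurable_cube.
have muQ c : (mu (Q c) < +oo)%E by rewrite [X in (X < _)%E]cube_volume ?ltry// ltW.
exists s, (h ^+ n)^-1; split.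
- by rewrite invr_ge0 exprn_ge0// ltW.
- by move=> _ /mapP[c _ ->]; exact: (L2_indicator (mQ c) (muQ c)).
have sE (u : pair) : \sum_(w <- s) ip mu u.1 w ^+ 2 = \sum_c ip mu u.1 \1_(Q c) ^+ 2.
  by rewrite big_map big_enum.
have Rtest phi : test_function Om phi -> ip mu phi phi <=
    (h ^+ n)^-1 * (\sum_(w <- s) ip mu phi w ^+ 2) + e * gform (tp phi) (tp phi).
  move=> tphi; have phiM := test_coord_bound OmM tphi.
  rewrite (sE (tp phi)) -(sum_ip_grid (test_L2 tphi) phiM (ltW h0) Nh).
  apply: (@le_trans _ _ (\sum_c ((h ^+ n)^-1 * ip mu phi \1_(Q c) ^+ 2 +
      K * h ^+ 2 * \sum_i ip mu (partial i phi \_ (Q c)) (partial i phi \_ (Q c))))).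
    by apply: ler_sum => c _; exact: HK tphi.
  rewrite big_split/= -!mulr_sumr lerD2l exchange_big/=.
  rewrite (eq_bigr (fun i => ip mu (gcomp (tp phi) i) (gcomp (tp phi) i))); last first.
    move=> i _; rewrite gcomp_tp sum_ip_grid ?(ltW h0)//.
      by apply: test_L2; exact: test_partial tphi.
    exact: supp_in_partial phiM.
  by rewrite ler_wpM2r// sumr_ge0// => i _; exact: ip_ge0.
move=> u /H10_approx[phi [tphi _ c1 c2 c3]].
apply: (ler_cvg_to c1); last first.
  by apply: nearW => k; exact: Rtest (tphi k).
apply: cvgD; last by apply: cvgM => //; exact: cvg_cst.
apply: cvgM; first exact: cvg_cst.
rewrite (sE u) (_ : (fun k => _) = (fun k => \sum_c ip mu (phi k) \1_(Q c) ^+ 2)); last first.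
  by apply/funext => k; rewrite (sE (tp (phi k))).
apply: cvg_big => //; first exact: add_continuous.
move=> c _; apply: cvgM; apply: c3; exact: (L2_indicator (mQ c) (muQ c)).
Qed.

End rellich.

(** * Completeness of H^1_0 *)

Section H10_complete.
Context (R : realType) (n : nat).
Local Notation mu := (lebesgue_rV R n).
Local Notation L2 := (Lfun mu 2%:E).
Local Notation pair := (sobolev_pair R n).

Lemma ip_patch_le (D : set 'rV[R]_n) f : measurable D -> f \in L2 ->
  ip mu (f \_ D) (f \_ D) <= ip mu f f.
Proof.
move=> mD fL; have fDL := L2_indic mD fL.
apply: le_Rintegral => // [| |x _]; [exact: L2_mul_integrable|exact: L2_mul_integrable|].
by rewrite patchE; case: ifP => // _; rewrite mulr0 -expr2 sqr_ge0.
Qed.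

(** By the Poincare inequality a Cauchy sequence for the energy is Cauchy in L^2, as are the
    components of its gradients; the L^2 limits form a pair to which [H10_closed] applies. *)
Lemma H10_complete (U : set 'rV[R]_n) (P : R) : measurable U ->
  (forall u : pair, H10 U u -> ip mu u.1 u.1 <= P * gform u u) ->
  psd_complete (H10 U) (@gform R n).
Proof.
move=> mU HP u_ Hu_ cauchy.
have Lu_ k := H10_L2pair (Hu_ k).
have zu_ k := H10_zero_off (Hu_ k).
have HB i j : H10 U (u_ i - u_ j) by apply: (psdXB (H10_psd U (@gform_psd R n))).
have [f fL cf] : exists2 f, f \in L2 &
    (fun k => ip mu ((u_ k).1 - f) ((u_ k).1 - f)) @ \oo --> (0 : R).
  apply: (@L2_complete _ _ _ mu (fun k => (u_ k).1)); first by move=> k; exact: (Lu_ k).1.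
  move=> e e0; have eP : 0 < e / (`|P| + 1) by rewrite divr_gt0// ltr_pwDr.
  have [N HN] := cauchy _ eP; exists N => i j Ni Nj.
  have g0 := psd_ge0 (@gform_psd R n) (H10_L2pair (HB i j)).
  apply: (le_trans (HP _ (HB i j))); have := HN i j Ni Nj.
  rewrite ler_pdivlMr ?ltr_pwDr//; apply: le_trans; rewrite mulrC ler_wpM2l//.
  by have := ler_norm P; lra.
have /choice[g gP] : forall i, exists g, g \in L2 /\
    (fun k => ip mu (gcomp (u_ k) i - g) (gcomp (u_ k) i - g)) @ \oo --> (0 : R).
  move=> i; have [|e e0|g gL cg] := @L2_complete _ _ _ mu (fun k => gcomp (u_ k) i).
  - by move=> k; exact: (Lu_ k).2.
  - have [N HN] := cauchy _ e0; exists N => k l Nk Nl; apply: le_trans (HN k l Nk Nl).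
    by rewrite -gcompB; apply: ip_comp_le_gform; exact: H10_L2pair.
  by exists g.
(* L^2 limits are determined almost everywhere only, while H10 asks for a representative vanishing
   everywhere off U. Truncation to U does not increase the distances to the u_k. *)
pose u : pair := (f \_ U, fun x => \row_i (g i \_ U) x).
have uE i : gcomp u i = g i \_ U by apply/funext => x; rewrite /gcomp mxE.
have Lu : L2pair u.
  split; first exact: L2_indic.
  by move=> i; rewrite uE; apply: L2_indic => //; exact: (gP i).1.
have zu : zero_off U u.
  move=> x nUx; split; first by rewrite /= patchE memNset.
  by apply/rowP => i; rewrite !mxE patchE memNset.
have E1 k : (u_ k).1 - u.1 = ((u_ k).1 - f) \_ U.
  apply/funext => x; rewrite [LHS](_ : _ = (u_ k).1 x - (f \_ U) x)// !patchE.
  by case: ifPn => //; rewrite notin_setE => /(zu_ k)[-> _]; rewrite subr0.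
have E2 k i : gcomp (u_ k) i - gcomp u i = (gcomp (u_ k) i - g i) \_ U.
  apply/funext => x; rewrite uE [LHS](_ : _ = gcomp (u_ k) i x - (g i \_ U) x)// !patchE.
  by case: ifPn => //; rewrite notin_setE => /(zu_ k)[_ z]; rewrite /gcomp z mxE subr0.
pose s k := ip mu ((u_ k).1 - f) ((u_ k).1 - f) +
  \sum_i ip mu (gcomp (u_ k) i - g i) (gcomp (u_ k) i - g i).
have cs : s @ \oo --> (0 : R).
  rewrite -[X in _ --> X](_ : 0 + \sum_(i < n) 0 = 0); last by rewrite big1// addr0.
  apply: cvgD => //; apply: cvg_big; [exact: add_continuous|].
  by move=> i _; exact: (gP i).2.
have sle k : sform (u_ k - u) (u_ k - u) <= s k.
  rewrite /sform /gform /s; apply: lerD.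
    rewrite [(u_ k - u).1](E1 k); apply: ip_patch_le => //.
    by apply: L2_B => //; exact: (Lu_ k).1.
  apply: ler_sum => i _; rewrite gcompB E2; apply: ip_patch_le => //.
  by apply: L2_B; [exact: (Lu_ k).2|exact: (gP i).1].
have LB k : L2pair (u_ k - u) by exact: L2pairB.
have cu : (fun k => sform (u_ k - u) (u_ k - u)) @ \oo --> (0 : R).
  apply: (squeeze_cvgr _ (cvg_cst 0) cs); apply: nearW => k.
  by rewrite sle (psd_ge0 (@sform_psd R n)).
exists u; first exact: H10_closed cu.
apply: (squeeze_cvgr _ (cvg_cst 0) cu); apply: nearW => k.
by rewrite (psd_ge0 (@gform_psd R n))//; exact: gform_le_sform.
Qed.

End H10_complete.

(** * Elliptic forms, weak convergence and the Dirichlet problem *)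

Section coefficients.
Context (R : realType) (n : nat).
Local Notation mu := (lebesgue_rV R n).
Local Notation L2 := (Lfun mu 2%:E).
Local Notation pair := (sobolev_pair R n).

Lemma dotp_apply_mx (M : 'M[R]_n) (xi eta : 'rV[R]_n) :
  dotp (apply_mx M xi) eta = \sum_i \sum_j M i j * xi ord0 j * eta ord0 i.
Proof.
apply: eq_bigr => i _; rewrite !mxE mulr_suml; apply: eq_bigr => j _.
by rewrite !mxE.
Qed.

Lemma dotp_apply_mxC (M : 'M[R]_n) (xi eta : 'rV[R]_n) : M^T = M ->
  dotp (apply_mx M xi) eta = dotp (apply_mx M eta) xi.
Proof.
move=> MT; rewrite !dotp_apply_mx exchange_big; apply: eq_bigr => i _.
by apply: eq_bigr => j _; rewrite -{1}MT mxE mulrAC.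
Qed.

Lemma dotp_ge0 (xi : 'rV[R]_n) : 0 <= dotp xi xi.
Proof. by apply: sumr_ge0 => i _; rewrite -expr2 sqr_ge0. Qed.

Lemma Rintegral_ae_ge0 (f : 'rV[R]_n -> R) : measurable_fun setT f ->
  {ae mu, forall x, 0 <= f x} -> 0 <= \int[mu]_x f x.
Proof.
move=> mf f0.
have -> : \int[mu]_x f x = \int[mu]_x Num.max (f x) 0.
  congr fine; apply: ae_eq_integral => //.
  - exact/measurable_EFinP.
  - by apply/measurable_EFinP/measurable_maxr.
  - by apply: filterS f0 => x fx _; rewrite /= (max_idPl _).
by apply: Rintegral_ge0 => x _; rewrite le_max lexx orbT.
Qed.

Lemma ae_eq_Rintegral (f g : 'rV[R]_n -> R) : measurable_fun setT f ->
  measurable_fun setT g -> {ae mu, forall x, f x = g x} ->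
  \int[mu]_x f x = \int[mu]_x g x.
Proof.
move=> mf mg fg; congr fine; apply: ae_eq_integral => //.
- exact/measurable_EFinP.
- exact/measurable_EFinP.
- by apply: filterS fg => x fx _; rewrite /= fx.
Qed.

Variables (Om : set 'rV[R]_n) (alpha beta : R) (A : 'rV[R]_n -> 'M[R]_n).
Hypotheses (alpha0 : 0 < alpha) (cA : coefficient_class Om alpha beta A).

(* [bilin A U] for fields vanishing outside U, with A extended by 0 outside Om,
   so that it no longer depends on U. *)
Definition aform (u v : pair) : R :=
  \int[mu]_x (\sum_i \sum_j ((fun y => A y i j) \_ Om) x * gcomp u j x * gcomp v i x).

Let term i j (u v : pair) : L2pair u -> L2pair v -> mu.-integrable setT
  (EFin \o (fun x => ((fun y => A y i j) \_ Om) x * gcomp u j x * gcomp v i x)).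
Proof.
move=> Lu Lv; case: cA => AL _ _.
exact: (L2_mul_integrable (L2_Loo_mul (AL i j) (Lu.2 j)) (Lv.2 i)).
Qed.

Let inner i (u v : pair) : L2pair u -> L2pair v -> mu.-integrable setT
  (EFin \o (fun x => \sum_j ((fun y => A y i j) \_ Om) x * gcomp u j x * gcomp v i x)).
Proof.
move=> Lu Lv; apply: (@integrable_sumr _ _ _ _
  (fun j x => ((fun y => A y i j) \_ Om) x * gcomp u j x * gcomp v i x)) => j.
exact: term.
Qed.

Let total (u v : pair) : L2pair u -> L2pair v -> mu.-integrable setT
  (EFin \o (fun x => \sum_i \sum_j ((fun y => A y i j) \_ Om) x * gcomp u j x * gcomp v i x)).
Proof.
move=> Lu Lv; apply: (@integrable_sumr _ _ _ _
  (fun i x => \sum_j ((fun y => A y i j) \_ Om) x * gcomp u j x * gcomp v i x)) => i.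
exact: inner.
Qed.

Let integrable_measurable (f : 'rV[R]_n -> R) :
  mu.-integrable setT (EFin \o f) -> measurable_fun setT f.
Proof. by move=> /integrableP[/measurable_EFinP]. Qed.

Let integrandE (u v : pair) x : Om x ->
  \sum_i \sum_j ((fun y => A y i j) \_ Om) x * gcomp u j x * gcomp v i x =
  dotp (apply_mx (A x) (u.2 x)) (v.2 x).
Proof.
move=> Omx; rewrite dotp_apply_mx; apply: eq_bigr => i _; apply: eq_bigr => j _.
by rewrite patchE mem_set.
Qed.

Let integrand0 (u v : pair) x : ~ Om x ->
  \sum_i \sum_j ((fun y => A y i j) \_ Om) x * gcomp u j x * gcomp v i x = 0.
Proof.
move=> Omx; rewrite big1// => i _; rewrite big1// => j _.
by rewrite patchE memNset// !mul0r.
Qed.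

Lemma aform_psd : psd_form (@L2pair R n) aform.
Proof.
have gP := @gform_psd R n; split.
- exact: L2pair0.
- by move=> *; exact: L2pair_lin.
- move=> c u v w Lu Lv Lw; rewrite /aform -RintegralZl; [|by []|exact: total].
  rewrite -RintegralD; [|by []|exact: (integrableZl measurableT c (total Lu Lw))|exact: total].
  apply: eq_Rintegral => x _; rewrite mulr_sumr -big_split; apply: eq_bigr => i _.
  rewrite mulr_sumr -big_split; apply: eq_bigr => j _.
  rewrite gcomp_lin [(_ + _) x](_ : _ = c * gcomp u j x + gcomp v j x)//=.
  by ring.
- move=> u v Lu Lv; apply: ae_eq_Rintegral.
  + by apply: integrable_measurable; exact: total.
  + by apply: integrable_measurable; exact: total.
  + case: cA => _ sA _; apply: filterS sA => x sA.
    have [Omx|nOmx] := pselect (Om x); last by rewrite !integrand0.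
    by rewrite !integrandE//; apply: dotp_apply_mxC; exact: sA.
- move=> u Lu; apply: Rintegral_ae_ge0.
  + by apply: integrable_measurable; exact: total.
  + case: cA => _ _ pA; apply: filterS pA => x pA.
    have [Omx|nOmx] := pselect (Om x); last by rewrite integrand0.
    rewrite integrandE//; have /andP[+ _] := pA Omx (u.2 x); apply: le_trans.
    by rewrite mulr_ge0 ?dotp_ge0// ltW.
Qed.

Lemma bilinE (U : set 'rV[R]_n) (u v : pair) : U `<=` Om -> zero_off U v ->
  bilin A U u v = aform u v.
Proof.
move=> UOm zv; rewrite /bilin (@Rintegral_zero_off _ _ U); last first.
  by move=> x /zv[_ ->]; rewrite dotp_apply_mx big1// => i _; rewrite big1// => j _; rewrite mxE mulr0.
apply: eq_Rintegral => x _.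
have [Omx|nOmx] := pselect (Om x); first by rewrite integrandE.
rewrite integrand0//; have [] := zv x; first by move=> /UOm.
by move=> _ ->; rewrite dotp_apply_mx big1// => i _; rewrite big1// => j _; rewrite mxE mulr0.
Qed.

Lemma aform_bounds (u : pair) : L2pair u -> zero_off Om u ->
  alpha * gform u u <= aform u u <= beta * gform u u.
Proof.
move=> Lu zu; rewrite -!(Rintegral_dotp Lu Lu).
have Du : mu.-integrable setT (EFin \o (fun x => dotp (u.2 x) (u.2 x))).
  rewrite /dotp; apply: (@integrable_sumr _ _ _ _ (fun i x => u.2 x ord0 i * u.2 x ord0 i)) => i.
  exact: (L2_mul_integrable (Lu.2 i) (Lu.2 i)).
have cDu c : mu.-integrable setT (EFin \o (fun x => c * dotp (u.2 x) (u.2 x))).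
  exact: (integrableZl measurableT c Du).
have tu := total Lu Lu.
case: cA => _ _ pA.
have offE x : ~ Om x -> dotp (u.2 x) (u.2 x) = 0.
  by move=> /zu[_ ->]; rewrite /dotp big1// => i _; rewrite mxE mul0r.
apply/andP; split; rewrite -subr_ge0 -RintegralZl// -RintegralB//;
  (apply: Rintegral_ae_ge0; first by apply: measurable_funB; exact: integrable_measurable).
- apply: filterS pA => x pA.
  have [Omx|nOmx] := pselect (Om x); last by rewrite integrand0// offE// mulr0 subr0.
  by rewrite integrandE// subr_ge0; have /andP[] := pA Omx (u.2 x).
- apply: filterS pA => x pA.
  have [Omx|nOmx] := pselect (Om x); last by rewrite integrand0// offE// mulr0 subr0.
  by rewrite integrandE// subr_ge0; have /andP[] := pA Omx (u.2 x).
Qed.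

End coefficients.

(** * Weak convergence compared with convergence in L^2 *)

Section weak_convergence.
Context (R : realType) (n : nat).
Local Notation mu := (lebesgue_rV R n).
Local Notation L2 := (Lfun mu 2%:E).
Local Notation pair := (sobolev_pair R n).

Lemma H10_sqr_norm U (u : pair) : H10 U u -> H10_norm U u ^+ 2 = gform u u.
Proof.
move=> Hu; have Lu := H10_L2pair Hu.
by rewrite (H10_normE Lu (H10_zero_off Hu)) sqr_sqrtr// (psd_ge0 (@gform_psd R n)).
Qed.

(** Boundedness in squared form, as used by [psd_riesz] and given by Cauchy-Schwarz. *)
Lemma Hm1P U (h : pair -> R) :
  Hm1 U h <->
  (forall (c : R) u v, H10 U u -> H10 U v -> h (c *: u + v) = c * h u + h v) /\
  exists2 C : R, 0 <= C & forall u, H10 U u -> h u ^+ 2 <= C * gform u u.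
Proof.
split=> [[hlin [C hC]]|[hlin [C C0 hC]]]; split => //.
  exists (C ^+ 2); first exact: sqr_ge0.
  move=> u Hu; rewrite -(H10_sqr_norm Hu) -exprMn -(@real_normK _ (h u)) ?num_real//.
  rewrite lerXn2r ?nnegrE ?hC//.
  exact: (le_trans (normr_ge0 _) (hC _ Hu)).
exists (Num.sqrt C) => u Hu.
have N0 : 0 <= H10_norm U u by exact: sqrtr_ge0.
rewrite -ler_sqr ?nnegrE ?mulr_ge0 ?sqrtr_ge0// exprMn sqr_sqrtr//.
by rewrite (H10_sqr_norm Hu) real_normK ?num_real ?hC.
Qed.

Section Hm1_theory.
Variables (U : set 'rV[R]_n) (h : pair -> R).
Hypothesis hH : Hm1 U h.

Lemma Hm1D u v : H10 U u -> H10 U v -> h (u + v) = h u + h v.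
Proof. by move=> Hu Hv; rewrite -[u in LHS]scale1r hH.1 ?mul1r. Qed.

Lemma Hm1_0 : h 0 = 0.
Proof.
have := Hm1D (@H10_0 R n U) (@H10_0 R n U); rewrite addr0 => /eqP.
by rewrite -subr_eq0 opprD addrA subrr add0r oppr_eq0 => /eqP.
Qed.

Lemma Hm1B u v : H10 U u -> H10 U v -> h (u - v) = h u - h v.
Proof.
by move=> Hu Hv; rewrite addrC -scaleN1r hH.1// mulN1r addrC.
Qed.

End Hm1_theory.

Lemma H10B U (u v : pair) : H10 U u -> H10 U v -> H10 U (u - v).
Proof. by move=> Hu Hv; apply: (psdXB (H10_psd U (@gform_psd R n))). Qed.

Lemma H10D U (u v : pair) : H10 U u -> H10 U v -> H10 U (u + v).
Proof. by move=> Hu Hv; apply: (psdXD (H10_psd U (@gform_psd R n))). Qed.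

Lemma Hm1_subset (U V : set 'rV[R]_n) (h : pair -> R) : U `<=` V -> Hm1 V h -> Hm1 U h.
Proof.
move=> UV /Hm1P[hlin [C C0 hC]]; apply/Hm1P; split.
  by move=> c u v Hu Hv; apply: hlin; exact: H10_subset UV _.
by exists C => // u Hu; apply: hC; exact: H10_subset UV Hu.
Qed.

Lemma Hm1_ip U (P : R) (w : 'rV[R]_n -> R) : 0 <= P ->
  (forall u : pair, H10 U u -> ip mu u.1 u.1 <= P * gform u u) -> w \in L2 ->
  Hm1 U (fun u => ip mu u.1 w).
Proof.
move=> P0 HP wL; have ipP := ip_form mu; apply/Hm1P; split.
  move=> c u v /H10_L2pair Lu /H10_L2pair Lv.
  rewrite (psdDl ipP) ?(psdZl ipP)//; [exact: Lu.1|exact: L2_Z Lu.1|exact: Lv.1].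
exists (ip mu w w * P); first by rewrite mulr_ge0 ?ip_ge0.
move=> u Hu; apply: (le_trans (psd_CauchySchwarz ipP (H10_L2pair Hu).1 wL)).
by rewrite mulrC -mulrA ler_wpM2l ?ip_ge0 ?HP.
Qed.

Lemma weak_cvgB (U : set 'rV[R]_n) (u_ : nat -> pair) u : (forall k, H10 U (u_ k)) -> H10 U u ->
  weak_cvg U u_ u <-> weak_cvg U (fun k => u_ k - u) 0.
Proof.
move=> Hu_ Hu; split=> H h hH; have := H h hH => c.
  have -> : (fun k => h (u_ k - u)) = (fun k => h (u_ k) - h u).
    by apply/funext => k; exact: (Hm1B hH (Hu_ k) Hu).
  by rewrite (Hm1_0 hH) -(subrr (h u)); apply: cvgB => //; exact: cvg_cst.
have -> : (fun k => h (u_ k)) = (fun k => h (u_ k - u) + h u).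
  by apply/funext => k; rewrite (Hm1B hH (Hu_ k) Hu) subrK.
rewrite -[X in _ --> X]add0r -(Hm1_0 hH); apply: cvgD => //; exact: cvg_cst.
Qed.

(** In the inequality of Rellich the finitely many linear forms tend to 0 along the sequence; the
    energy, at most B, is given the weight e / 2 / (B + 1) and contributes at most e / 2. *)
Lemma weak_cvg_L2 Om (u_ : nat -> pair) (B : R) : (0 < n)%N -> bounded_set Om ->
  (forall k, H10 Om (u_ k)) -> (forall k, gform (u_ k) (u_ k) <= B) ->
  weak_cvg Om u_ 0 -> (fun k => ip mu (u_ k).1 (u_ k).1) @ \oo --> (0 : R).
Proof.
move=> n0 bOm Hu_ uB cu; have [P P0 HP] := poincare_inequality n0 bOm.
apply/cvgrPdist_le => e e0.
have B0 : 0 <= B.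
  by apply: le_trans (uB 0%N); apply: (psd_ge0 (@gform_psd R n)); exact: H10_L2pair (Hu_ _).
have eB : 0 < e / 2 / (B + 1) by rewrite !divr_gt0// ltr_pwDr.
have [s [C [C0 sL HR]]] := rellich_inequality bOm eB.
have cs : (fun k => C * (\sum_(w <- s) ip mu (u_ k).1 w ^+ 2)) @ \oo --> (0 : R).
  rewrite -[X in _ --> X](_ : C * \sum_(w <- s) 0 = 0); last by rewrite big1// mulr0.
  apply: cvgM; first exact: cvg_cst.
  rewrite (eq_big_seq (fun=> 0) (F1 := fun=> 0))//.
  have -> : (fun k => \sum_(w <- s) ip mu (u_ k).1 w ^+ 2) =
      (fun k => \sum_(w <- s | w \in s) ip mu (u_ k).1 w ^+ 2).
    by apply/funext => k; rewrite -big_seq.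
  rewrite [X in _ --> X]big_seq; apply: cvg_big; first exact: add_continuous.
  move=> w ws; have := cu _ (Hm1_ip P0 HP (sL w ws)).
  rewrite (_ : ip mu (0 : pair).1 w = 0); last exact: (psd0l (ip_form mu) (sL w ws)).
  by move=> c; rewrite -[X in _ --> X](mulr0 (0 : R)); exact: cvgM.
have e20 : 0 < e / 2 by rewrite divr_gt0.
have /cvgrPdist_le/(_ _ e20) := cs; apply: filterS => k; rewrite !sub0r !normrN => H.
rewrite ger0_norm ?ip_ge0// (le_trans (HR _ (Hu_ k)))//.
rewrite [leRHS](splitr e); apply: lerD; first exact: (le_trans (ler_norm _) H).
apply: (@le_trans _ _ (e / 2 / (B + 1) * B)); first by rewrite ler_wpM2l ?uB// ltW.
rewrite -mulrA ger_pMr// mulrC ler_pdivrMr ?ltr_pwDr//; lra.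
Qed.

(* By Riesz and density it is enough to test against test functions, for which
   the gradient can be moved onto the test function. *)
Lemma L2_weak_cvg U (P B : R) (u_ : nat -> pair) : measurable U ->
  (forall u : pair, H10 U u -> ip mu u.1 u.1 <= P * gform u u) ->
  (forall k, H10 U (u_ k)) -> (forall k, gform (u_ k) (u_ k) <= B) ->
  (fun k => ip mu (u_ k).1 (u_ k).1) @ \oo --> (0 : R) -> weak_cvg U u_ 0.
Proof.
move=> mU HP Hu_ uB cu h hH; rewrite (Hm1_0 hH).
have gP := @gform_psd R n; have gHP := H10_psd U gP.
have [hlin [C C0 hC]] := (Hm1P U h).1 hH.
have [w Hw hw] := psd_riesz gHP (H10_complete mU HP) hlin hC.
have Lw := H10_L2pair Hw.
have B0 : 0 <= B.
  by apply: le_trans (uB 0%N); apply: (psd_ge0 gP); exact: H10_L2pair (Hu_ _).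
apply/cvgrPdist_le => e e0.
have [phi [tphi cphi _ _ _]] := H10_approx Hw.
(* Chosen so that Cauchy-Schwarz against a [u_ k] of energy at most B leaves an error of at most e /
   2. *)
have eB : 0 < (e / 2) ^+ 2 / (B + 1) by rewrite divr_gt0 ?exprn_gt0 ?divr_gt0// ltr_pwDr.
have [N _ /(_ N (leqnn N))/=] := (cvgrPdist_le _ _).1 cphi _ eB.
rewrite sub0r normrN => /(le_trans (ler_norm _)) => wphi.
set p := phi N in wphi; have tp_ : test_function U p := tphi N.
have Lp := L2pair_tp tp_; have Hp := H10_tp tp_.
have cp : (fun k => gform (tp p) (u_ k)) @ \oo --> (0 : R).
  rewrite -[X in _ --> X](_ : \sum_(i < n) 0 = 0); last by rewrite big1.
  apply: cvg_big; first exact: add_continuous.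
  move=> i _; have tdp := test_partial i tp_; have tddp := test_partial i tdp.
  rewrite (_ : (fun k => _) = (fun k => - ip mu (u_ k).1 (partial i (partial i p)))).
    rewrite -oppr0; apply: cvgN.
    rewrite -[X in _ --> X](psd0l (ip_form mu) (test_L2 tddp)).
    apply: (cvg_psd_left (ip_form mu)).
    - by move=> k; exact: (H10_L2pair (Hu_ k)).1.
    - exact: L2_0.
    - exact: test_L2 tddp.
    - by under eq_fun do rewrite subr0.
  apply/funext => k; have [[_ _ _ wg] _] := Hu_ k.
  have := wg _ tdp i.
  rewrite !(@Rintegral_zero_off _ _ U); last 2 first.
  - by move=> x nUx; rewrite (test_zero tdp nUx) mulr0.
  - by move=> x nUx; rewrite (test_zero tddp nUx) mulr0.
  move=> wgE; rewrite gcomp_tp (psdC (ip_form mu)); [|exact: test_L2 tdp|exact: (H10_L2pair (Hu_ k)).2].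
  by rewrite [X in - X]wgE opprK.
have e20 : 0 < e / 2 by rewrite divr_gt0.
have /cvgrPdist_le/(_ _ e20) := cp; apply: filterS => k; rewrite !sub0r !normrN => H.
have Lk := H10_L2pair (Hu_ k).
have -> : h (u_ k) = gform (tp p) (u_ k) - gform (tp p - w) (u_ k).
  by rewrite -(hw _ (Hu_ k)) (psdBl gP Lp Lw Lk); ring.
apply: (le_trans (ler_normB _ _)); rewrite (splitr e) lerD//.
rewrite -ler_sqr ?nnegrE// ?(ltW e20)// real_normK ?num_real//.
have LB : L2pair (tp p - w) by exact: L2pairB.
apply: (le_trans (psd_CauchySchwarz gP LB Lk)).
have g1 : gform (tp p - w) (tp p - w) <= (e / 2) ^+ 2 / (B + 1).
  exact: le_trans (gform_le_sform LB) wphi.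
apply: (@le_trans _ _ ((e / 2) ^+ 2 / (B + 1) * B)).
  by apply: ler_pM => //; exact: (psd_ge0 gP).
rewrite -mulrA ger_pMr ?exprn_gt0// mulrC ler_pdivrMr ?ltr_pwDr//; lra.
Qed.

End weak_convergence.

(** * The Dirichlet problem in an open subset of Om *)

Section solutions.
Context (R : realType) (n : nat).
Local Notation mu := (lebesgue_rV R n).
Local Notation L2 := (Lfun mu 2%:E).
Local Notation pair := (sobolev_pair R n).
Variables (Om : set 'rV[R]_n) (alpha beta : R) (A : 'rV[R]_n -> 'M[R]_n).
Hypotheses (n0 : (0 < n)%N) (bOm : bounded_set Om) (alpha0 : 0 < alpha)
  (cA : coefficient_class Om alpha beta A).
Variable U : set 'rV[R]_n.
Hypotheses (oU : open U) (UOm : U `<=` Om).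

Lemma H10_sub_Om (u : pair) : H10 U u -> H10 Om u.
Proof. exact: H10_subset. Qed.

Lemma poincare_U : exists2 P : R, 0 <= P &
  forall u : pair, H10 U u -> ip mu u.1 u.1 <= P * gform u u.
Proof.
have [P P0 HP] := poincare_inequality n0 bOm.
by exists P => // u /H10_sub_Om; exact: HP.
Qed.

Lemma gform_complete : psd_complete (H10 U) (@gform R n).
Proof.
have [P P0 HP] := poincare_U.
by apply: H10_complete HP; exact: open_measurable_rV.
Qed.

Lemma aform_H10 : psd_form (H10 U) (aform Om A).
Proof. exact: (H10_psd U (aform_psd alpha0 cA)). Qed.

Lemma aform_H10_bounds (u : pair) : H10 Om u ->
  alpha * gform u u <= aform Om A u u <= beta * gform u u.
Proof.
by move=> Hu; apply: (aform_bounds cA); [exact: H10_L2pair Hu|exact: H10_zero_off Hu].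
Qed.

Lemma aform_complete : psd_complete (H10 U) (aform Om A).
Proof.
move=> u_ Hu_ cauchy.
have HB i j : H10 Om (u_ i - u_ j) := H10_sub_Om (H10B (Hu_ i) (Hu_ j)).
have [|u Hu cu] := gform_complete Hu_.
  move=> e e0; have [N HN] := cauchy _ (mulr_gt0 alpha0 e0); exists N => i j Ni Nj.
  rewrite -(ler_pM2l alpha0); apply: le_trans (HN i j Ni Nj).
  by have /andP[] := aform_H10_bounds (HB i j).
exists u => //.
have cu' : (fun k => beta * gform (u_ k - u) (u_ k - u) + 0 * 0) @ \oo --> (0 : R).
  by apply: (@cvg0_comb _ _ _ _ (cst 0)) => //; exact: cvg_cst.
apply: (squeeze_cvgr _ (cvg_cst 0) cu'); apply: nearW => k.
have Hk : H10 U (u_ k - u) := H10B (Hu_ k) Hu.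
rewrite mulr0 addr0 (psd_ge0 aform_H10 Hk)/=.
by have /andP[_] := aform_H10_bounds (H10_sub_Om Hk).
Qed.

Lemma solutionP f (u : pair) : solution A f U u <->
  H10 U u /\ forall v, H10 U v -> aform Om A u v = f v.
Proof.
split=> -[Hu su]; split => // v Hv.
  by rewrite -su// (bilinE _ _ UOm)//; exact: H10_zero_off Hv.
by rewrite (bilinE _ _ UOm) ?su//; exact: H10_zero_off Hv.
Qed.

(** The matrices being symmetric, this is Riesz for the form [aform], which ellipticity makes
    complete and comparable with [gform]. *)
Lemma solution_exists f : Hm1 U f -> exists u, solution A f U u.
Proof.
move=> /Hm1P[flin [C C0 fC]].
have [||u Hu su] := psd_riesz (h := f) (C := C / alpha) aform_H10 aform_complete.
- exact: flin.
- move=> u Hu; apply: (le_trans (fC _ Hu)); rewrite -mulrA ler_wpM2l//.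
  rewrite ler_pdivlMl//.
  by have /andP[] := aform_H10_bounds (H10_sub_Om Hu).
- by exists u; apply/solutionP; split.
Qed.

Lemma Hm1_aform (v : pair) : H10 Om v -> Hm1 U (aform Om A v).
Proof.
move=> Hv; have Lv := H10_L2pair Hv; have aP := aform_psd alpha0 cA.
apply/Hm1P; split.
  move=> c u w /H10_L2pair Lu /H10_L2pair Lw.
  rewrite (psdDr aP _ Lw Lv) ?(psdZr aP _ Lu Lv)//; exact: (psdXZ aP).
have av0 := psd_ge0 aP Lv.
(* The sign of beta is not assumed in this section, hence the absolute value. *)
exists (aform Om A v v * `|beta|); first by rewrite mulr_ge0.
move=> u Hu; apply: (le_trans (psd_CauchySchwarz aP Lv (H10_L2pair Hu))).
rewrite -mulrA ler_wpM2l//.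
have /andP[_ H] := aform_H10_bounds (H10_sub_Om Hu); apply: (le_trans H).
by rewrite ler_wpM2r ?ler_norm// (psd_ge0 (@gform_psd R n))//; exact: H10_L2pair Hu.
Qed.

End solutions.

(** * Locality of G-convergence *)

Section multiplication.
Context (R : realType) (n : nat).
Local Notation mu := (lebesgue_rV R n).
Local Notation L2 := (Lfun mu 2%:E).
Local Notation pair := (sobolev_pair R n).

(** The product eta u as a pair, its gradient being given by the Leibniz rule. *)
Definition mulp (eta : 'rV[R]_n -> R) (u : pair) : pair :=
  (eta * u.1, fun x => eta x *: u.2 x + u.1 x *: gradient eta x).

Lemma gcomp_mulp eta (u : pair) i :
  gcomp (mulp eta u) i = eta * gcomp u i + partial i eta * u.1.
Proof. by apply/funext => x; rewrite /gcomp !mxE mulrC [u.1 x * _]mulrC mulrC. Qed.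

Lemma mulpB eta (u v : pair) : mulp eta (u - v) = mulp eta u - mulp eta v.
Proof.
have E1 : (mulp eta (u - v)).1 = (mulp eta u - mulp eta v).1.
  exact: (mulrBr eta u.1 v.1).
have E2 : (mulp eta (u - v)).2 = (mulp eta u - mulp eta v).2.
  apply/funext => x; apply/rowP => i.
  rewrite [LHS](_ : _ = eta x * (u.2 x ord0 i - v.2 x ord0 i) +
     (u.1 x - v.1 x) * partial i eta x); last by rewrite !mxE.
  rewrite [RHS](_ : _ = (eta x * u.2 x ord0 i + u.1 x * partial i eta x) -
     (eta x * v.2 x ord0 i + v.1 x * partial i eta x)); last by rewrite !mxE.
  by ring.
by rewrite (surjective_pairing (mulp eta (u - v))) E1 E2 -surjective_pairing.
Qed.

Lemma mulp_lin eta c (u v : pair) : mulp eta (c *: u + v) = c *: mulp eta u + mulp eta v.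
Proof.
have E1 : (mulp eta (c *: u + v)).1 = (c *: mulp eta u + mulp eta v).1.
  apply/funext => x.
  rewrite [LHS](_ : _ = eta x * (c * u.1 x + v.1 x))//.
  rewrite [RHS](_ : _ = c * (eta x * u.1 x) + eta x * v.1 x)//.
  by ring.
have E2 : (mulp eta (c *: u + v)).2 = (c *: mulp eta u + mulp eta v).2.
  apply/funext => x; apply/rowP => i.
  rewrite [LHS](_ : _ = eta x * (c * u.2 x ord0 i + v.2 x ord0 i) +
     (c * u.1 x + v.1 x) * partial i eta x); last by rewrite !mxE.
  rewrite [RHS](_ : _ = c * (eta x * u.2 x ord0 i + u.1 x * partial i eta x) +
     (eta x * v.2 x ord0 i + v.1 x * partial i eta x)); last by rewrite !mxE.
  by ring.
by rewrite (surjective_pairing (mulp eta (c *: u + v))) E1 E2 -surjective_pairing.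
Qed.

Lemma mulp_tp eta phi : smooth eta -> smooth phi ->
  mulp eta (tp phi) = tp (eta * phi).
Proof.
move=> seta sphi.
have E2 : (mulp eta (tp phi)).2 = gradient (eta * phi).
  apply/funext => x; apply/rowP => i.
  rewrite !mxE partialM; [|exact: smooth_derivable|exact: smooth_derivable].
  by rewrite [RHS](_ : _ = eta x * partial i phi x + phi x * partial i eta x).
by rewrite (surjective_pairing (mulp eta (tp phi))) E2.
Qed.

Lemma ip_mul_le (g f : 'rV[R]_n -> R) (C : R) : measurable_fun setT g ->
  (forall x, `|g x| <= C) -> f \in L2 ->
  (g * f) \in L2 /\ ip mu (g * f) (g * f) <= C ^+ 2 * ip mu f f.
Proof.
move=> mg gC fL; have gfL : (g * f) \in L2 by exact: L2_bounded_mul mg gC fL.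
split => //; rewrite /ip -RintegralZl//; last exact: (L2_mul_integrable fL fL).
apply: le_Rintegral => //.
- exact: (L2_mul_integrable gfL gfL).
- exact: (integrableZl measurableT (C ^+ 2) (L2_mul_integrable fL fL)).
- move=> x _; rewrite [leLHS](_ : _ = g x ^+ 2 * (f x * f x)); last first.
    by rewrite (_ : (g * f) x = g x * f x)//; ring.
  rewrite ler_wpM2r//; first by rewrite -expr2 sqr_ge0.
  by rewrite -(@real_normK _ (g x)) ?num_real// lerXn2r ?nnegrE// (le_trans _ (gC x)).
Qed.

Lemma test_bounded U (eta : 'rV[R]_n -> R) : test_function U eta ->
  exists2 C : R, 0 <= C & forall x, `|eta x| <= C.
Proof.
move=> teta; have [M HM] := test_supp_in teta.
exact: supp_in_bounded (smooth_continuous (test_smooth teta)) HM.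
Qed.

Lemma test_measurable U (eta : 'rV[R]_n -> R) : test_function U eta ->
  measurable_fun setT eta.
Proof.
move=> teta; apply: continuous_measurable_rV.
exact: smooth_continuous (test_smooth teta).
Qed.

Lemma mulp_bound U (eta : 'rV[R]_n -> R) : test_function U eta ->
  exists2 K : R, 0 <= K & forall u : pair, L2pair u ->
    L2pair (mulp eta u) /\ sform (mulp eta u) (mulp eta u) <= K * sform u u.
Proof.
move=> teta; have [C C0 etaC] := test_bounded teta.
have /choice[D DP] : forall i, exists D : R, 0 <= D /\ forall x, `|partial i eta x| <= D.
  by move=> i; have [D D0 HD] := test_bounded (test_partial i teta); exists D.
have meta := test_measurable teta.
have mdeta i := test_measurable (test_partial i teta).
exists (C ^+ 2 + \sum_i (2 * C ^+ 2 + 2 * D i ^+ 2)).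
  rewrite addr_ge0 ?sqr_ge0// sumr_ge0// => i _.
  by rewrite addr_ge0// mulr_ge0 ?sqr_ge0.
move=> u Lu; have gP := @gform_psd R n.
have [m1 l1] := ip_mul_le meta etaC Lu.1.
have m2 i := ip_mul_le meta etaC (Lu.2 i).
have m3 i := ip_mul_le (mdeta i) (DP i).2 Lu.1.
split; first by split=> [|i]; [exact: m1|rewrite gcomp_mulp; exact: L2_D (m2 i).1 (m3 i).1].
have s0 := psd_ge0 (@sform_psd R n) Lu.
rewrite mulrDl; apply: lerD.
  by apply: (le_trans l1); rewrite ler_wpM2l ?sqr_ge0//; exact: ip_le_sform.
rewrite mulr_suml; apply: ler_sum => i _; rewrite gcomp_mulp.
apply: (le_trans (psd_sqrD_le (ip_form mu) (m2 i).1 (m3 i).1)).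
rewrite [leRHS]mulrDl; apply: lerD.
  rewrite -mulrA ler_wpM2l//; apply: (le_trans (m2 i).2); rewrite ler_wpM2l ?sqr_ge0//.
  exact: le_trans (ip_comp_le_gform i Lu) (gform_le_sform Lu).
rewrite -mulrA ler_wpM2l//; apply: (le_trans (m3 i).2); rewrite ler_wpM2l ?sqr_ge0//.
exact: ip_le_sform.
Qed.

(** Multiplying by eta turns test functions of Om into test functions of U. This is what makes eta
    y_k, built from a solution in Om, a competitor in H10 U. *)
Lemma H10_mulp Om U (eta : 'rV[R]_n -> R) (u : pair) : test_function U eta ->
  H10 Om u -> H10 U (mulp eta u).
Proof.
move=> teta /H10P[Lu zu [phi [tphi cphi]]].
have [K K0 HK] := mulp_bound teta.
have LB k : L2pair (u - tp (phi k)) by apply: L2pairB => //; exact: L2pair_tp (tphi k).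
apply/H10P; split.
- exact: (HK u Lu).1.
- move=> x nUx; split.
    by rewrite [LHS](_ : _ = eta x * u.1 x)// (test_zero teta nUx) mul0r.
  apply/rowP => i; rewrite !mxE (test_zero teta nUx) mul0r add0r.
  by rewrite (test_zero (test_partial i teta) nUx) mulr0.
- exists (fun k => eta * phi k); split.
    by move=> k; rewrite mulrC; apply: test_mul => //; exact: test_smooth (tphi k).
  have cK : (fun k => K * sform (u - tp (phi k)) (u - tp (phi k)) + 0 * 0) @ \oo --> (0 : R).
    by apply: (@cvg0_comb _ _ _ _ (cst 0)) => //; exact: cvg_cst.
  apply: (squeeze_cvgr _ (cvg_cst 0) cK); apply: nearW => k.
  rewrite -(mulp_tp (test_smooth teta) (test_smooth (tphi k))) -mulpB mulr0 addr0.
  by rewrite (HK _ (LB k)).2 (psd_ge0 (@sform_psd R n))//; exact: (HK _ (LB k)).1.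
Qed.

End multiplication.

(** * The logarithmic cutoff *)

Section cutoff.
Context (R : realType) (n : nat).
Implicit Types r phi : 'rV[R]_n -> R.

(** Powers built with the ring operations on functions, so that the closure properties of [smooth]
    apply. *)
Fixpoint fpow r k : 'rV[R]_n -> R := if k is k'.+1 then fpow r k' * r else cst 1.

(** The truncated power series of - log (1 - r). *)
Fixpoint log_poly r m : 'rV[R]_n -> R :=
  if m is m'.+1 then log_poly r m' + m'.+1%:R^-1 *: fpow r m'.+1 else cst 0.

Lemma fpowE r k x : fpow r k x = r x ^+ k.
Proof. by elim: k => //= k IH; rewrite exprSr -IH. Qed.

Lemma log_polyE r m x : log_poly r m x = \sum_(j < m) j.+1%:R^-1 * r x ^+ j.+1.
Proof.
elim: m => [|m IH]; first by rewrite big_ord0.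
by rewrite big_ord_recr/= -IH -(fpowE r m.+1).
Qed.

Lemma smooth_fpow r k : smooth r -> smooth (fpow r k).
Proof. by move=> sr; elim: k => [|k IH]; [exact: smooth_cst|exact: smoothM]. Qed.

Lemma smooth_log_poly r m : smooth r -> smooth (log_poly r m).
Proof.
move=> sr; elim: m => [|m IH]; first exact: smooth_cst.
by apply: smoothD => //; apply: smoothZ; exact: smooth_fpow.
Qed.

Lemma partial_fpow r k i x : smooth r ->
  partial i (fpow r k.+1) x = k.+1%:R * r x ^+ k * partial i r x.
Proof.
move=> sr; elim: k => [|k IH].
  rewrite /= partialM; [|exact: (smooth_derivable (@smooth_cst R n _))|exact: smooth_derivable].
  rewrite partial_cst [LHS](_ : _ = 1 * partial i r x + r x * 0)//.
  by rewrite expr0; ring.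
rewrite [fpow r k.+2]/(fpow r k.+1 * r) partialM; [|exact: (smooth_derivable (smooth_fpow _ sr))|exact: smooth_derivable].
rewrite [LHS](_ : _ = fpow r k.+1 x * partial i r x + r x * partial i (fpow r k.+1) x)//.
by rewrite IH fpowE -[k.+2%:R]natr1 exprS; ring.
Qed.

Lemma partial_log_poly r m i x : smooth r ->
  partial i (log_poly r m) x = (\sum_(j < m) r x ^+ j) * partial i r x.
Proof.
move=> sr; elim: m => [|m IH]; first by rewrite big_ord0 mul0r /= partial_cst.
rewrite [log_poly r m.+1]/(log_poly r m + m.+1%:R^-1 *: fpow r m.+1).
have sf := smooth_fpow m.+1 sr.
rewrite partialD; [|exact: (smooth_derivable (smooth_log_poly _ sr))|exact: (smooth_derivable (@smoothZ R n _ _ sf))].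
rewrite partialZ; last exact: smooth_derivable.
rewrite [LHS](_ : _ = partial i (log_poly r m) x +
  m.+1%:R^-1 * partial i (fpow r m.+1) x)//.
rewrite IH partial_fpow// big_ord_recr/= mulrDl !mulrA mulVf ?mul1r//.
Qed.

(* With s = phi^2 / C^2 and r = 1 - s, take 1 - eta proportional to the partial
   sum of the series of - log s, namely r + r^2/2 + ... + r^m/m, normalised by
   its value at r = 1: then phi * grad eta is O(1 / log m) * grad phi because
   s (1 + r + ... + r^(m-1)) = 1 - r^m, while eta is 1 in the limit wherever phi
   does not vanish. *)
Lemma vanishing_cutoff U phi : test_function U phi ->
  exists2 C : R, 0 <= C & forall e : R, 0 < e -> exists eta : 'rV[R]_n -> R,
    [/\ test_function U eta, forall x, 0 <= eta x <= 1,
     forall i x, `|phi x * partial i eta x| <= e * `|partial i phi x| &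
     forall x, phi x ^+ 2 * (1 - eta x) <= C * e].
Proof.
move=> tphi; have [C' C'0 phiC'] := test_bounded tphi.
pose C := C' + 1; have C0 : 0 < C by rewrite /C ltr_pwDr.
have phiC x : `|phi x| <= C by rewrite (le_trans (phiC' x))// lerDl.
exists (C ^+ 2); first exact: sqr_ge0.
move=> e e0.
(* The normalising sum H grows like log m, the harmonic series being divergent. The factor 2
   anticipates the derivative of phi^2. *)
have [m Hm] : exists m, 2 / e <= \sum_(j < m) (j.+1%:R^-1 : R).
  have := @dvg_harmonic R.
  have nd : nondecreasing_seq (series (@harmonic R)).
    apply: nondecreasing_series => k _ _; exact: harmonic_ge0.
  move=> dvg; apply: contrapT => /forallNP H; apply: dvg.
  apply: nondecreasing_is_cvgn => //; exists (2 / e) => _ [k _ <-].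
  have := H k; move/negP; rewrite -ltNge => /ltW; rewrite /series/=.
  by rewrite big_mkord.
set H := \sum_(j < m) _ in Hm.
have H0 : 0 < H by apply: lt_le_trans Hm; rewrite divr_gt0.
have eH : 2 * H^-1 <= e.
  by rewrite ler_pdivrMr// mulrC -ler_pdivrMr.
pose s : 'rV[R]_n -> R := (C ^- 2) *: (phi * phi).
pose r := cst 1 + (-1) *: s : 'rV[R]_n -> R.
have sphi := test_smooth tphi.
have ss : smooth s by apply: smoothZ; exact: smoothM.
have sr : smooth r by apply: smoothD; [exact: smooth_cst|exact: smoothZ].
pose eta := cst 1 + (- H^-1) *: log_poly r m : 'rV[R]_n -> R.
have seta : smooth eta.
  by apply: smoothD; [exact: smooth_cst|apply: smoothZ; exact: smooth_log_poly].
have sE x : s x = C ^- 2 * (phi x * phi x) by [].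
have rE x : r x = 1 - s x by rewrite [LHS](_ : _ = 1 + (-1) * s x)// mulN1r.
have etaE x : eta x = 1 - H^-1 * \sum_(j < m) j.+1%:R^-1 * r x ^+ j.+1.
  by rewrite [LHS](_ : _ = 1 + (- H^-1) * log_poly r m x)// log_polyE mulNr.
have s01 x : 0 <= s x <= 1.
  rewrite sE mulr_ge0 ?invr_ge0 ?sqr_ge0 -?expr2 ?sqr_ge0//=.
  rewrite mulrC ler_pdivrMr ?exprn_gt0// mul1r -(@real_normK _ (phi x)) ?num_real//.
  by rewrite lerXn2r// nnegrE ltW.
have r01 x : 0 <= r x <= 1 by rewrite rE; have /andP[? ?] := s01 x; apply/andP; split; lra.
have geom x : s x * \sum_(j < m) r x ^+ j = 1 - r x ^+ m.
  have := subrX1 (r x) m; rewrite rE => H1.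
  by rewrite -[RHS]opprB H1; ring.
have geom01 x : 0 <= s x * \sum_(j < m) r x ^+ j <= 1.
  have /andP[? ?] := r01 x.
  by rewrite geom subr_ge0 exprn_ile1//= lerBlDr lerDl exprn_ge0.
have Q_ge0 x : 0 <= \sum_(j < m) j.+1%:R^-1 * r x ^+ j.+1.
  by have /andP[? ?] := r01 x; apply: sumr_ge0 => j _; rewrite mulr_ge0 ?exprn_ge0.
have Q_leH x : \sum_(j < m) j.+1%:R^-1 * r x ^+ j.+1 <= H.
  have /andP[? ?] := r01 x; apply: ler_sum => j _.
  by rewrite ler_piMr ?exprn_ile1.
have drE i x : partial i r x = - (C ^- 2 * (2 * (phi x * partial i phi x))).
  rewrite partialD; [|exact: (smooth_derivable (@smooth_cst R n _))|exact: (smooth_derivable (@smoothZ R n _ _ ss))].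
  rewrite partial_cst partialZ; last exact: smooth_derivable.
  rewrite [partial i s](_ : _ = C ^- 2 *: (phi * partial i phi + phi * partial i phi)).
    rewrite [LHS](_ : _ = 0 + (-1) * (C ^- 2 * (phi x * partial i phi x + phi x * partial i phi x)))//.
    by ring.
  rewrite partialZ; last exact: (smooth_derivable (smoothM sphi sphi)).
  by rewrite partialM//; exact: smooth_derivable.
exists eta; split.
- apply: (test_supp_sub tphi seta) => x /=; apply: contraNP => nx.
  have px : phi x = 0.
    by apply/eqP; apply: contra_notT nx => px; apply: subset_closure.
  have -> : eta x = 0; last by rewrite eqxx.
  (* At a zero of phi one has r = 1, where the logarithmic sum equals H, so that eta = 0. *)
  rewrite etaE rE sE px mul0r mulr0 subr0.
  rewrite (eq_bigr (fun j : 'I_m => j.+1%:R^-1)); last by move=> j _; rewrite expr1n mulr1.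
  by rewrite -/H mulVf ?subrr// gt_eqF.
- move=> x; rewrite etaE subr_ge0 gerBl mulr_ge0 ?invr_ge0 ?(ltW H0)// andbT.
  by rewrite mulrC ler_pdivrMr// mul1r.
- move=> i x.
  have -> : partial i eta x = - H^-1 * ((\sum_(j < m) r x ^+ j) * partial i r x).
    rewrite partialD; [|exact: (smooth_derivable (@smooth_cst R n _))|
      exact: (smooth_derivable (@smoothZ R n _ _ (smooth_log_poly _ sr)))].
    rewrite partial_cst partialZ; last exact: (smooth_derivable (smooth_log_poly _ sr)).
    rewrite [LHS](_ : _ = 0 + (- H^-1) * partial i (log_poly r m) x)//.
    by rewrite add0r partial_log_poly.
  rewrite drE.
  rewrite [X in `|X| <= _](_ : _ = (2 * H^-1) * ((s x * \sum_(j < m) r x ^+ j) * partial i phi x)).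
    have hH : 0 <= 2 * H^-1 by apply: mulr_ge0; rewrite ?invr_ge0 ?(ltW H0).
    rewrite normrM (ger0_norm hH); apply: ler_pM => //.
    have /andP[g0 g1] := geom01 x.
    by rewrite normrM (ger0_norm g0) ler_piMl.
  by rewrite sE; ring.
- move=> x.
  have -> : phi x ^+ 2 * (1 - eta x) =
      C ^+ 2 * (H^-1 * (s x * \sum_(j < m) j.+1%:R^-1 * r x ^+ j.+1)).
    by rewrite etaE sE; field; rewrite !gt_eqF.
  rewrite ler_wpM2l ?sqr_ge0//.
  apply: (@le_trans _ _ (H^-1 * 1)); last first.
    by rewrite mulr1; apply: le_trans eH; rewrite ler_peMl ?invr_ge0 ?(ltW H0)// ler1n.
  rewrite ler_wpM2l ?invr_ge0 ?(ltW H0)//.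
  (* Term by term r^(j+1) / (j+1) <= r^j, so s times the logarithmic sum is at most s times the
     geometric one, itself at most 1. *)
  have /andP[s0 s1] := s01 x; have /andP[r0 r1] := r01 x; have /andP[g0 g1] := geom01 x.
  apply: le_trans g1; rewrite ler_wpM2l//; apply: ler_sum => j _.
  rewrite -[leRHS]mul1r; apply: ler_pM => //; [exact: exprn_ge0|by rewrite invf_le1// ler1n|].
  by rewrite exprS ler_piMl ?exprn_ge0.
Qed.

End cutoff.

(** * The Caccioppoli identity *)

Section aform_multiplication.
Context (R : realType) (n : nat).
Local Notation mu := (lebesgue_rV R n).
Local Notation L2 := (Lfun mu 2%:E).
Local Notation pair := (sobolev_pair R n).
Variables (Om : set 'rV[R]_n) (alpha beta : R) (A : 'rV[R]_n -> 'M[R]_n).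
Hypotheses (alpha0 : 0 < alpha) (cA : coefficient_class Om alpha beta A).

(** A field encoded as a pair with first component 0, which [aform] does not see; the same holds for
    [gradmul]. *)
Definition smul (rho : 'rV[R]_n -> R) (u : pair) : pair :=
  (0, fun x => rho x *: u.2 x).

Definition gradmul (eta : 'rV[R]_n -> R) (u : pair) : pair :=
  (0, fun x => u.1 x *: gradient eta x).

Lemma aform_gcomp (u u' v v' : pair) : (forall i, gcomp u i = gcomp u' i) ->
  (forall i, gcomp v i = gcomp v' i) -> aform Om A u v = aform Om A u' v'.
Proof.
move=> uu' vv'; apply: eq_Rintegral => x _; apply: eq_bigr => i _.
by apply: eq_bigr => j _; rewrite uu' vv'.
Qed.

Lemma gcomp_smul rho (u : pair) i x : gcomp (smul rho u) i x = rho x * gcomp u i x.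
Proof. by rewrite /gcomp mxE. Qed.

Lemma gcomp_gradmul eta (u : pair) i : gcomp (gradmul eta u) i = partial i eta * u.1.
Proof. by apply/funext => x; rewrite /gcomp !mxE mulrC. Qed.

Lemma aform_smul rho (u v : pair) :
  aform Om A (smul rho u) v = aform Om A u (smul rho v).
Proof.
apply: eq_Rintegral => x _; apply: eq_bigr => i _; apply: eq_bigr => j _.
by rewrite !gcomp_smul; ring.
Qed.

Lemma L2pair_smul (C : R) (rho : 'rV[R]_n -> R) (u : pair) : measurable_fun setT rho ->
  (forall x, `|rho x| <= C) -> L2pair u -> L2pair (smul rho u).
Proof.
move=> mrho rhoC Lu; split; first exact: L2_0.
move=> i; rewrite (_ : gcomp _ _ = fun x => rho x * gcomp u i x).
  exact: L2_bounded_mul mrho rhoC (Lu.2 i).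
by apply/funext => x; exact: gcomp_smul.
Qed.

Lemma L2pair_gradmul U eta (u : pair) : test_function U eta -> L2pair u ->
  L2pair (gradmul eta u).
Proof.
move=> teta Lu; split; first exact: L2_0.
move=> i; rewrite gcomp_gradmul; have [D _ HD] := test_bounded (test_partial i teta).
exact: (ip_mul_le (test_measurable (test_partial i teta)) HD Lu.1).1.
Qed.

(** This is 1 - (1 - eta)^2, so that subtracting the product of y by it leaves (1 - eta)^2 y.
    Without constant term it is again a test function. *)
Definition cocutoff (eta : 'rV[R]_n -> R) : 'rV[R]_n -> R := 2 *: eta + (-1) *: (eta * eta).

Lemma test_cocutoff U eta : test_function U eta -> test_function U (cocutoff eta).
Proof.
move=> teta; apply: test_lin => //.
rewrite -[_ *: _]addr0; apply: test_lin; last exact: test_0.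
by apply: test_mul => //; exact: test_smooth teta.
Qed.

Lemma partial_cocutoff eta i x : smooth eta ->
  partial i (cocutoff eta) x = 2 * (1 - eta x) * partial i eta x.
Proof.
move=> seta; have see := smoothM seta seta; have de := smooth_derivable seta.
rewrite partialD; [|exact: (smooth_derivable (smoothZ _ seta))|exact: (smooth_derivable (smoothZ _ see))].
rewrite !partialZ//; last exact: smooth_derivable.
rewrite partialM//.
rewrite [LHS](_ : _ = 2 * partial i eta x + (-1) * (eta x * partial i eta x + eta x * partial i eta x))//.
by ring.
Qed.

(* Caccioppoli: for a symmetric matrix,
   A (rho p + q) . (rho p + q) = A p . (rho^2 p + 2 rho q) + A q . q. *)
Lemma aform_cutoff U eta (y : pair) : test_function U eta -> L2pair y ->
  aform Om A (y - mulp eta y) (y - mulp eta y) =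
  aform Om A y (y - mulp (cocutoff eta) y) + aform Om A (gradmul eta y) (gradmul eta y).
Proof.
move=> teta Ly; have aP := aform_psd alpha0 cA.
have seta := test_smooth teta.
pose rho x := 1 - eta x.
have [C C0 etaC] := test_bounded teta.
have mrho : measurable_fun setT rho.
  by apply: measurable_funB => //; exact: test_measurable teta.
have rhoC x : `|rho x| <= 1 + C.
  by apply: (le_trans (ler_normB _ _)); rewrite normr1 lerD2l.
(* The gradients of (1 - eta) y and (1 - eta)^2 y are X - q and rho (X - 2 q). The identity is the
   expansion X.X - 2 X.q + q.q = X.(X - 2 q) + q.q, with rho moved across by [aform_smul]. *)
pose X := smul rho y; pose q := gradmul eta y.
have LX : L2pair X by exact: L2pair_smul mrho rhoC Ly.
have Lq : L2pair q by exact: L2pair_gradmul teta Ly.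
have L2q : L2pair (2 *: q) by exact: (psdXZ aP).
have LXq : L2pair (X - 2 *: q) by exact: L2pairB.
have gM (th : 'rV[R]_n -> R) i x :
    gcomp (y - mulp th y) i x = gcomp y i x - (th x * gcomp y i x + partial i th x * y.1 x).
  by rewrite gcompB gcomp_mulp.
have gq i x : gcomp q i x = partial i eta x * y.1 x by rewrite gcomp_gradmul.
have gX i x : gcomp X i x = rho x * gcomp y i x by rewrite gcomp_smul.
have E1 i : gcomp (y - mulp eta y) i = gcomp (X - q) i.
  apply/funext => x; rewrite gM gcompB.
  by rewrite [RHS](_ : _ = gcomp X i x - gcomp q i x)// gX gq /rho; ring.
have E2 i : gcomp (y - mulp (cocutoff eta) y) i = gcomp (smul rho (X - 2 *: q)) i.
  apply/funext => x; rewrite gM gcomp_smul gcompB partial_cocutoff//.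
  rewrite [gcomp (2 *: q) i](_ : _ = 2 *: gcomp q i); last first.
    by apply/funext => z; rewrite [LHS](_ : _ = (2 *: q.2 z) ord0 i)// mxE.
  rewrite [(gcomp X i - _) x](_ : _ = gcomp X i x - 2 * gcomp q i x)// gX gq /rho.
  rewrite [cocutoff eta x](_ : _ = 2 * eta x + (-1) * (eta x * eta x))//.
  by ring.
rewrite (aform_gcomp E1 E1) (aform_gcomp (u := y) (u' := y) (fun=> erefl) E2).
rewrite -aform_smul -/X (psd_sqrB aP LX Lq) (psdBr aP LX L2q LX) (psdZr aP _ Lq LX).
by ring.
Qed.

End aform_multiplication.

(** * Solutions with a prescribed limit *)

Section recovery.
Context (R : realType) (n : nat).
Local Notation mu := (lebesgue_rV R n).
Local Notation L2 := (Lfun mu 2%:E).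
Local Notation pair := (sobolev_pair R n).
Variables (Om : set 'rV[R]_n) (alpha beta : R).
Variables (A_ : nat -> 'rV[R]_n -> 'M[R]_n) (A : 'rV[R]_n -> 'M[R]_n).
Hypotheses (n0 : (0 < n)%N) (oOm : open Om) (bOm : bounded_set Om)
  (alpha0 : 0 < alpha) (beta0 : 0 < beta)
  (cA_ : forall k, coefficient_class Om alpha beta (A_ k))
  (cA : coefficient_class Om alpha beta A) (GA : G_cvg Om A_ A).

Local Notation a_ k := (aform Om (A_ k)).
Local Notation a := (aform Om A).
Local Notation gP := (@gform_psd R n).

(** Solutions in U for the operators A_k with the fixed right-hand side - div (A grad x): the z_k of
    the overview, and its y_k when U is Om. *)
Definition recovery (U : set 'rV[R]_n) (x : pair) (y_ : nat -> pair) :=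
  forall k, H10 U (y_ k) /\ forall w, H10 U w -> a_ k (y_ k) w = a x w.

Lemma recovery_exists U x : open U -> U `<=` Om -> H10 Om x ->
  exists y_, recovery U x y_.
Proof.
move=> oU UOm Hx.
have hx : Hm1 U (a x) := Hm1_aform alpha0 cA UOm Hx.
have /choice[y_ yP] : forall k, exists u, solution (A_ k) (a x) U u.
  by move=> k; exact: (solution_exists n0 bOm alpha0 (cA_ k) oU UOm hx).
by exists y_ => k; exact: (solutionP (A_ k) UOm (a x) (y_ k)).1 (yP k).
Qed.

Lemma recovery_cvg x y_ : H10 Om x -> recovery Om x y_ -> weak_cvg Om y_ x.
Proof.
move=> Hx yP.
have id : Om `<=` Om by [].
have hx : Hm1 Om (a x) := Hm1_aform alpha0 cA id Hx.
apply: (GA hx) => [k|].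
  exact: (solutionP (A_ k) id (a x) (y_ k)).2 (yP k).
exact: (solutionP A id (a x) x).2 (conj Hx (fun v _ => erefl)).
Qed.

Lemma recoveryB U x x' y_ y_' : U `<=` Om -> H10 Om x -> H10 Om x' ->
  recovery U x y_ -> recovery U x' y_' -> recovery U (x - x') (fun k => y_ k - y_' k).
Proof.
move=> UOm Hx Hx' yP yP' k; split; first exact: H10B (yP k).1 (yP' k).1.
move=> w Hw; have L u (Hu : H10 U u) := H10_L2pair Hu.
rewrite (psdBl (aform_psd alpha0 (cA_ k)) (L _ (yP k).1) (L _ (yP' k).1) (L _ Hw)).
rewrite (psdBl (aform_psd alpha0 cA) (H10_L2pair Hx) (H10_L2pair Hx') (L _ Hw)).
by rewrite (yP k).2// (yP' k).2.
Qed.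

(** Put t = a_k(y_k, y_k), which is a(x, y_k). By Cauchy-Schwarz and ellipticity, t^2 <= beta
    gform(x, x) * beta gform(y_k, y_k) <= beta^2 / alpha * gform(x, x) * t, and t is divided out
    when it is not 0. *)
Lemma recovery_bound U x y_ k : U `<=` Om -> H10 Om x -> recovery U x y_ ->
  a_ k (y_ k) (y_ k) <= beta ^+ 2 / alpha * gform x x.
Proof.
move=> UOm Hx yP; have [HyU yE] := yP k.
have Hy : H10 Om (y_ k) := H10_sub_Om UOm HyU.
have aP := aform_psd alpha0 cA.
have CS := psd_CauchySchwarz aP (H10_L2pair Hx) (H10_L2pair Hy).
rewrite -(yE _ HyU) in CS.
have /andP[b1 _] := aform_H10_bounds (cA_ k) Hy.
have /andP[_ b2] := aform_H10_bounds cA Hy.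
have /andP[_ b3] := aform_H10_bounds cA Hx.
have g0 := psd_ge0 gP (H10_L2pair Hy).
have gx0 := psd_ge0 gP (H10_L2pair Hx).
have t0 := psd_ge0 (aform_psd alpha0 (cA_ k)) (H10_L2pair Hy).
have ax0 := psd_ge0 aP (H10_L2pair Hx).
have ay0 := psd_ge0 aP (H10_L2pair Hy).
rewrite mulrAC ler_pdivlMr//.
move: (a_ k (y_ k) (y_ k)) CS b1 t0 => t CS b1 t0.
have [t_eq0|tn0] := eqVneq t 0; first by rewrite t_eq0 mul0r mulr_ge0 ?sqr_ge0.
have {tn0}t_gt0 : 0 < t by rewrite lt_neqAle eq_sym tn0.
rewrite -(ler_pM2l t_gt0).
move: (a x x) (a (y_ k) (y_ k)) (gform x x) (gform (y_ k) (y_ k)) ax0 ay0 CS b1 b2 b3 g0 gx0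
  => X Y G g X0 Y0 CS b1 b2 b3 g0 G0.
have h1 : t * (t * alpha) <= X * Y * alpha by rewrite mulrA -expr2 ler_wpM2r ?(ltW alpha0).
apply: (le_trans h1).
have h2 : X * Y <= beta * G * (beta * g).
  exact: ler_pM.
have h3 : beta * G * (beta * g) * alpha <= beta * G * beta * t.
  rewrite (_ : _ * alpha = beta * G * beta * (alpha * g)); last by ring.
  by rewrite ler_wpM2l// mulr_ge0 ?mulr_ge0 ?(ltW beta0).
apply: (@le_trans _ _ (beta * G * (beta * g) * alpha)).
  by rewrite ler_wpM2r ?(ltW alpha0).
by apply: (le_trans h3); rewrite le_eqVlt; apply/orP; left; apply/eqP; ring.
Qed.

Lemma recovery_gform_bound U x y_ k : U `<=` Om -> H10 Om x -> recovery U x y_ ->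
  gform (y_ k) (y_ k) <= beta ^+ 2 / alpha / alpha * gform x x.
Proof.
move=> UOm Hx yP; have := recovery_bound k UOm Hx yP.
have /andP[b1 _] := aform_H10_bounds (cA_ k) (H10_sub_Om UOm (yP k).1).
move=> /(le_trans b1); rewrite -ler_pdivlMl// => H; apply: (le_trans H).
by rewrite le_eqVlt; apply/orP; left; apply/eqP; ring.
Qed.

End recovery.

(** * Cutting off the solutions in Om *)

Section localisation.
Context (R : realType) (n : nat).
Local Notation mu := (lebesgue_rV R n).
Local Notation L2 := (Lfun mu 2%:E).
Local Notation pair := (sobolev_pair R n).
Variables (Om : set 'rV[R]_n) (alpha beta : R).
Variables (A_ : nat -> 'rV[R]_n -> 'M[R]_n) (A : 'rV[R]_n -> 'M[R]_n).
Hypotheses (n0 : (0 < n)%N) (oOm : open Om) (bOm : bounded_set Om)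
  (alpha0 : 0 < alpha) (beta0 : 0 < beta)
  (cA_ : forall k, coefficient_class Om alpha beta (A_ k))
  (cA : coefficient_class Om alpha beta A) (GA : G_cvg Om A_ A).
Variable U : set 'rV[R]_n.
Hypotheses (oU : open U) (UOm : U `<=` Om).

Local Notation a_ k := (aform Om (A_ k)).
Local Notation a := (aform Om A).
Local Notation gP := (@gform_psd R n).
Local Notation recovery := (recovery Om A_ A).

Lemma ip_dominated (f g : 'rV[R]_n -> R) (c : R) : f \in L2 -> g \in L2 ->
  (forall x, `|f x| <= c * `|g x|) -> ip mu f f <= c ^+ 2 * ip mu g g.
Proof.
move=> fL gL fg; rewrite /ip -RintegralZl//; last exact: (L2_mul_integrable gL gL).
apply: le_Rintegral => //.
- exact: (L2_mul_integrable fL fL).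
- exact: (integrableZl measurableT (c ^+ 2) (L2_mul_integrable gL gL)).
- move=> x _; rewrite -!expr2 -(@real_normK _ (f x)) ?num_real//.
  rewrite -(@real_normK _ (g x)) ?num_real// -exprMn lerXn2r ?nnegrE//.
  exact: le_trans (fg x).
Qed.

Lemma cvg_harmonic_scale (c : R) : (fun m : nat => c * m.+1%:R^-1) @ \oo --> (0 : R).
Proof.
rewrite -[X in _ --> X](mulr0 c); apply: cvgM; first exact: cvg_cst.
exact: cvg_harmonic.
Qed.

(** This bounds the right-hand side of [aform_cutoff] at the limit. The functions psi_m = (1 -
    eta_m)^2 phi have bounded energy and tend to 0 in L^2, hence weakly, which suffices because they
    are paired with the fixed phi; the second term is at most (m + 1)^-2 times the energy of phi, up
    to beta. *)
Lemma cutoff_energy phi : test_function U phi ->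
  exists eta_ : nat -> 'rV[R]_n -> R, (forall m, test_function U (eta_ m)) /\
  (fun m => a (tp phi) (tp phi - mulp (cocutoff (eta_ m)) (tp phi)) +
    beta * gform (gradmul (eta_ m) (tp phi)) (gradmul (eta_ m) (tp phi)))
   @ \oo --> (0 : R).
Proof.
move=> tphi; have [C C0 HC] := vanishing_cutoff tphi.
have sphi := test_smooth tphi.
have Htp := H10_tp tphi; have Ltp := H10_L2pair Htp.
have /choice[eta_ eta_P] : forall m : nat, exists eta : 'rV[R]_n -> R,
    [/\ test_function U eta, forall x, 0 <= eta x <= 1,
     forall i x, `|phi x * partial i eta x| <= m.+1%:R^-1 * `|partial i phi x| &
     forall x, phi x ^+ 2 * (1 - eta x) <= C * m.+1%:R^-1].
  by move=> m; apply: HC; rewrite invr_gt0.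
have teta m : test_function U (eta_ m) by case: (eta_P m).
have tco m : test_function U (cocutoff (eta_ m)) := test_cocutoff (teta m).
pose psi m := tp phi - mulp (cocutoff (eta_ m)) (tp phi).
have Hpsi m : H10 U (psi m).
  exact: (H10B Htp (H10_mulp (tco m) Htp)).
have e01 m : 0 <= (m.+1%:R^-1 : R) <= 1.
  by rewrite invr_ge0 ler0n/= invf_le1 ?ler1n ?ltr0n.
have psi1E m x : (psi m).1 x = (1 - eta_ m x) ^+ 2 * phi x.
  rewrite [LHS](_ : _ = phi x - (2 * eta_ m x + (-1) * (eta_ m x * eta_ m x)) * phi x)//.
  by ring.
have psi2E m i x : gcomp (psi m) i x = (1 - eta_ m x) ^+ 2 * partial i phi x -
    2 * (1 - eta_ m x) * (phi x * partial i (eta_ m) x).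
  rewrite gcompB gcomp_mulp gcomp_tp.
  rewrite [LHS](_ : _ = partial i phi x - (cocutoff (eta_ m) x * partial i phi x +
    partial i (cocutoff (eta_ m)) x * phi x))//.
  rewrite partial_cocutoff; last exact: test_smooth (teta m).
  rewrite [cocutoff _ x](_ : _ = 2 * eta_ m x + (-1) * (eta_ m x * eta_ m x))//.
  by ring.
(* Here 3 = 1 + 2, one summand for each term of [psi2E]; the second uses that the parameter 1 / (m +
   1) of the cutoff is at most 1. *)
have psi2_le m i x : `|gcomp (psi m) i x| <= 3 * `|gcomp (tp phi) i x|.
  have [_ /(_ x)/andP[h0 h1] /(_ i x) h2 _] := eta_P m.
  rewrite psi2E gcomp_tp; apply: (le_trans (ler_normB _ _)).
  have /andP[e0 e1] := e01 m.
  have q0 : 0 <= 1 - eta_ m x by lra.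
  have q1 : 1 - eta_ m x <= 1 by lra.
  rewrite (_ : 3 * _ = `|partial i phi x| + 2 * `|partial i phi x|); last by ring.
  apply: lerD.
    by rewrite normrM ger0_norm ?sqr_ge0// ler_piMl// exprn_ile1.
  have q2 : 0 <= 2 * (1 - eta_ m x) by lra.
  rewrite normrM (ger0_norm q2) ler_pM//; first lra.
  by apply: (le_trans h2); rewrite ler_piMl.
have psi_gform m : gform (psi m) (psi m) <= 3 ^+ 2 * gform (tp phi) (tp phi).
  rewrite /gform mulr_sumr; apply: ler_sum => i _; apply: ip_dominated.
  - exact: (H10_L2pair (Hpsi m)).2.
  - exact: Ltp.2.
  - exact: psi2_le.
have [M phiM] := test_supp_in tphi.
have mS : measurable (@big_cube R n M) by exact: measurable_cube.
have SL : (\1_(@big_cube R n M) : 'rV[R]_n -> R) \in L2.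
  by apply: L2_indicator => //; rewrite [X in (X < _)%E]big_cube_volume ltry.
(* The square of psi_m is phi^2 (1 - eta_m)^4 <= phi^2 (1 - eta_m) <= C / (m + 1), and it vanishes
   off a cube of finite volume. *)
have psi_L2 : (fun m => ip mu (psi m).1 (psi m).1) @ \oo --> (0 : R).
  have c := cvg_harmonic_scale (C * ip mu \1_(@big_cube R n M) \1_(@big_cube R n M)).
  apply: (squeeze_cvgr _ (cvg_cst 0) c); apply: nearW => m.
  have /andP[e0 e1] := e01 m.
  rewrite ip_ge0/= mulrAC -[C * _]sqr_sqrtr ?mulr_ge0//.
  apply: ip_dominated => //; first exact: (H10_L2pair (Hpsi m)).1.
  move=> x; rewrite [X in `|X| <= _](psi1E m x); case: (boolP (x \in @big_cube R n M)) => [xS|]; last first.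
    by rewrite notin_setE => /(supp_in_big_cube phiM) ->; rewrite mulr0 normr0 mulr_ge0 ?sqrtr_ge0.
  rewrite indicE xS normr1 mulr1.
  rewrite -ler_sqr ?nnegrE ?sqrtr_ge0// real_normK ?num_real// sqr_sqrtr ?mulr_ge0//.
  have [_ /(_ x)/andP[h0 h1] _ /(_ x) h2] := eta_P m.
  apply: le_trans h2; rewrite exprMn mulrC ler_wpM2l ?sqr_ge0//.
  have q0 : 0 <= 1 - eta_ m x by lra.
  have q1 : 1 - eta_ m x <= 1 by lra.
  rewrite -exprM -[leRHS]expr1; exact: ler_wiXn2l.
have [P P0 HP] := poincare_U n0 bOm UOm.
have weak0 := L2_weak_cvg (open_measurable_rV oU) HP Hpsi psi_gform psi_L2.
have ha : Hm1 U (a (tp phi)) := Hm1_aform alpha0 cA UOm (H10_sub_Om UOm Htp).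
have c1 := weak0 _ ha; rewrite (Hm1_0 ha) in c1.
exists eta_; split => //.
rewrite -[X in _ --> X](addr0 (0 : R)); apply: cvgD; first exact: c1.
have c2 := cvg_harmonic_scale (beta * gform (tp phi) (tp phi)).
apply: (squeeze_cvgr _ (cvg_cst 0) c2); apply: nearW => m.
have Lg : L2pair (gradmul (eta_ m) (tp phi)) := L2pair_gradmul (teta m) Ltp.
have /andP[e0 e1] := e01 m.
rewrite mulr_ge0 ?(ltW beta0) ?(psd_ge0 gP)//= -mulrA ler_wpM2l ?(ltW beta0)//.
apply: (@le_trans _ _ (m.+1%:R^-1 ^+ 2 * gform (tp phi) (tp phi))); last first.
  rewrite mulrC ler_wpM2l ?(psd_ge0 gP)// -[leRHS]expr1; exact: ler_wiXn2l.
rewrite /gform mulr_sumr; apply: ler_sum => i _; apply: ip_dominated.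
- exact: Lg.2.
- exact: Ltp.2.
- move=> x; rewrite gcomp_gradmul gcomp_tp.
  rewrite [(partial i (eta_ m) * _) x](_ : _ = phi x * partial i (eta_ m) x).
    by have [_ _ /(_ i x)] := eta_P m.
  by rewrite [LHS](_ : _ = partial i (eta_ m) x * phi x)// mulrC.
Qed.

(** By [aform_cutoff] and a_k(y_k, .) = a(phi, .), the energy of y_k - eta y_k is at most a quantity
    that converges to its value at phi: the first term by weak convergence, the term in y_k grad eta
    by convergence in L^2. That value is at most d / 2 for a suitable cutoff, chosen before k. *)
Lemma recovery_cutoff phi y_ (d : R) : test_function U phi ->
  recovery Om (tp phi) y_ -> 0 < d ->
  exists2 eta, test_function U eta &
    \forall k \near \oo, a_ k (y_ k - mulp eta (y_ k)) (y_ k - mulp eta (y_ k)) <= d.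
Proof.
move=> tphi yP d0; have [eta_ [teta_ E0]] := cutoff_energy tphi.
have d20 : 0 < d / 2 by rewrite divr_gt0.
have Hphi := H10_sub_Om UOm (H10_tp tphi); have Lphi := H10_L2pair Hphi.
have [m _ /(_ m (leqnn m))/=] := (cvgrPdist_le _ _).1 E0 _ d20.
rewrite sub0r normrN => /(le_trans (ler_norm _)).
set E := _ + _ => Ed; have teta := teta_ m; set eta := eta_ m in E Ed teta.
exists eta => //.
have Hy k : H10 Om (y_ k) := (yP k).1.
have cy : weak_cvg Om y_ (tp phi).
  exact: (recovery_cvg alpha0 cA GA Hphi yP).
have Hyp k : H10 Om (y_ k - tp phi) := H10B (Hy k) Hphi.
have yL2 : (fun k => ip mu (y_ k - tp phi).1 (y_ k - tp phi).1) @ \oo --> (0 : R).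
  apply: (weak_cvg_L2 (B := 2 * (beta ^+ 2 / alpha / alpha * gform (tp phi) (tp phi)) +
     2 * gform (tp phi) (tp phi)) n0 bOm Hyp).
    move=> k; have Lk := H10_L2pair (Hy k).
    rewrite (psd_sqrB gP Lk Lphi).
    have := psd_ge0 gP (psdXD gP Lk Lphi); rewrite (psd_sqrD gP Lk Lphi).
    have := recovery_gform_bound alpha0 beta0 cA_ cA k (@subset_refl _ Om) Hphi yP.
    by set B := beta ^+ 2 / alpha / alpha * _; lra.
  exact: (weak_cvgB Hy Hphi).1 cy.
have mdeta i := test_measurable (test_partial i teta).
have /choice[D DP] : forall i, exists D : R, 0 <= D /\ forall x, `|partial i eta x| <= D.
  by move=> i; have [D D0 HD] := test_bounded (test_partial i teta); exists D.
have Lg (u : pair) (Hu : H10 Om u) : L2pair (gradmul eta u).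
  exact: L2pair_gradmul teta (H10_L2pair Hu).
have cg : (fun k => gform (gradmul eta (y_ k)) (gradmul eta (y_ k))) @ \oo -->
    gform (gradmul eta (tp phi)) (gradmul eta (tp phi)).
  apply: (cvg_psd_sqr (u_ := fun k => gradmul eta (y_ k)) gP (fun k => Lg _ (Hy k)) (Lg _ Hphi)).
  have cD : (fun k => (\sum_i D i ^+ 2) * ip mu (y_ k - tp phi).1 (y_ k - tp phi).1 + 0 * 0)
      @ \oo --> (0 : R).
    by apply: (@cvg0_comb _ _ _ _ (cst 0)) => //; exact: cvg_cst.
  apply: (squeeze_cvgr _ (cvg_cst 0) cD); apply: nearW => k.
  rewrite (psd_ge0 gP)/=; last exact: L2pairB (Lg _ (Hy k)) (Lg _ Hphi).
  rewrite mulr0 addr0 mulr_suml; apply: ler_sum => i _.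
  rewrite gcompB !gcomp_gradmul -mulrBr.
  exact: (ip_mul_le (mdeta i) (DP i).2 (H10_L2pair (Hyp k)).1).2.
have tco := test_cocutoff teta.
have Hco (u : pair) (Hu : H10 Om u) : H10 Om (u - mulp (cocutoff eta) u).
  apply: (H10B Hu); apply: (H10_mulp (Om := Om)) Hu; exact: test_subset UOm tco.
(* With eta fixed, u |-> a(phi, (1 - eta)^2 u) is a continuous linear form, against which the weak
   convergence of y_k can be tested. *)
have hb : Hm1 Om (fun u => a (tp phi) (u - mulp (cocutoff eta) u)).
  have id : Om `<=` Om by [].
  have /Hm1P[alin [C C0 aC]] := Hm1_aform alpha0 cA id Hphi.
  have [K K0 HK] := mulp_bound tco.
  have [P P0 HP] := poincare_inequality n0 bOm.
  apply/Hm1P; split.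
    move=> c u v Hu Hv; rewrite mulp_lin.
    rewrite (_ : _ - _ = c *: (u - mulp (cocutoff eta) u) + (v - mulp (cocutoff eta) v)).
      exact: alin (Hco _ Hu) (Hco _ Hv).
    by rewrite scalerBr addrACA -opprD.
  exists (C * (2 + 2 * (K * (P + 1)))).
    by apply: mulr_ge0 => //; apply: addr_ge0 => //; apply: mulr_ge0 => //;
      apply: mulr_ge0 => //; apply: addr_ge0.
  move=> u Hu; have Lu := H10_L2pair Hu.
  apply: (le_trans (aC _ (Hco _ Hu))); rewrite -mulrA ler_wpM2l//.
  have [Lm Km] := HK _ Lu.
  have Lm' : L2pair (mulp (cocutoff eta) u) by [].
  apply: (@le_trans _ _ (2 * gform u u + 2 * gform (mulp (cocutoff eta) u) (mulp (cocutoff eta) u))).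
    rewrite (psd_sqrB gP Lu Lm').
    by have := psd_ge0 gP (psdXD gP Lu Lm'); rewrite (psd_sqrD gP Lu Lm'); lra.
  rewrite [leRHS]mulrDl lerD2l -mulrA ler_wpM2l//.
  apply: (le_trans (gform_le_sform Lm')); apply: (le_trans Km).
  rewrite -mulrA ler_wpM2l// /sform [leRHS]mulrDl mul1r lerD2r.
  exact: HP.
have cE : (fun k => a (tp phi) (y_ k - mulp (cocutoff eta) (y_ k)) +
    beta * gform (gradmul eta (y_ k)) (gradmul eta (y_ k))) @ \oo --> E.
  apply: cvgD; first exact: (cy _ hb).
  exact: (@cvgM _ _ \oo _ (cst beta) _ beta _ (cvg_cst beta) cg).
have /cvgrPdist_le/(_ _ d20)[N _ HN] := cE; exists N => // k /HN; rewrite /= distrC => Hk.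
rewrite (aform_cutoff alpha0 (cA_ k) teta (H10_L2pair (Hy k))).
rewrite ((yP k).2 _ (Hco _ (Hy k))).
have zg : zero_off Om (gradmul eta (y_ k)).
  move=> x nx; split => //; have [z1 _] := H10_zero_off (Hy k) nx.
  by rewrite [LHS](_ : _ = (y_ k).1 x *: gradient eta x)// z1 scale0r.
have /andP[_ b2] := aform_bounds (cA_ k) (Lg _ (Hy k)) zg.
have := le_trans (ler_norm _) Hk; move: b2 Ed.
clearbody E; move: (a (tp phi) _) (gform _ _) (aform _ _ _ _) => X Y Z.
by lra.
Qed.

End localisation.

(** * From solutions in Om to solutions in U *)

Section G_convergence_localises.
Context (R : realType) (n : nat).
Local Notation pair := (sobolev_pair R n).
Variables (Om : set 'rV[R]_n) (alpha beta : R).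
Variables (A_ : nat -> 'rV[R]_n -> 'M[R]_n) (A : 'rV[R]_n -> 'M[R]_n).
Hypotheses (n0 : (0 < n)%N) (oOm : open Om) (bOm : bounded_set Om)
  (alpha0 : 0 < alpha) (beta0 : 0 < beta)
  (cA_ : forall k, coefficient_class Om alpha beta (A_ k))
  (cA : coefficient_class Om alpha beta A) (GA : G_cvg Om A_ A).
Variable U : set 'rV[R]_n.
Hypotheses (oU : open U) (UOm : U `<=` Om).

Local Notation a_ k := (aform Om (A_ k)).
Local Notation a := (aform Om A).
Local Notation gP := (@gform_psd R n).
Local Notation recovery := (recovery Om A_ A).

Lemma Hm1_gform V (w : pair) : L2pair w -> Hm1 V (gform w).
Proof.
move=> Lw; apply/Hm1P; split.
  move=> c u v /H10_L2pair Lu /H10_L2pair Lv.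
  by rewrite (psdDr gP (psdXZ gP c Lu) Lv Lw) (psdZr gP c Lu Lw).
exists (gform w w); first exact: (psd_ge0 gP Lw).
by move=> u /H10_L2pair Lu; exact: (psd_CauchySchwarz gP Lw Lu).
Qed.

(* Cea: the solution in U is the best approximation in H10 U of the solution in
   Om, for the energy. *)
Lemma recovery_cea (v : pair) y_ z_ w k : H10 U v -> recovery Om v y_ ->
  recovery U v z_ -> H10 U w ->
  a_ k (y_ k - z_ k) (y_ k - z_ k) <= a_ k (y_ k - w) (y_ k - w).
Proof.
move=> Hv yP zP Hw.
have aP := aform_psd alpha0 (cA_ k).
have Hz : H10 U (z_ k) := (zP k).1.
have Hs : H10 U (z_ k - w) := H10B Hz Hw.
have HsOm := H10_sub_Om UOm Hs.
have Ls := H10_L2pair Hs.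
have Ly := H10_L2pair (yP k).1; have Lz := H10_L2pair Hz.
have Ld : L2pair (y_ k - z_ k) := L2pairB Ly Lz.
have -> : y_ k - w = (y_ k - z_ k) + (z_ k - w) by rewrite addrA subrK.
rewrite (psd_sqrD aP Ld Ls) (psdBl aP Ly Lz Ls).
rewrite ((yP k).2 _ HsOm) ((zP k).2 _ Hs) subrr mulr0 addr0 lerDl.
exact: (psd_ge0 aP Ls).
Qed.

(** The cutoffs are available for test functions, so v is approximated by a test function phi with
    solutions x_k in Om. The competitor in [recovery_cea] is eta x_k; by linearity y_k - x_k is the
    solution for v - phi, whose energy is small uniformly in k. *)
Lemma recovery_strong (v : pair) y_ z_ : H10 U v -> recovery Om v y_ ->
  recovery U v z_ -> (fun k => gform (y_ k - z_ k) (y_ k - z_ k)) @ \oo --> (0 : R).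
Proof.
move=> Hv yP zP; have HvOm := H10_sub_Om UOm Hv.
have Hd k : H10 Om (y_ k - z_ k) := H10B (yP k).1 (H10_sub_Om UOm (zP k).1).
apply/cvgrPdist_le => e e0.
(* Two energies of at most alpha e / 4, each doubled by [psd_sqrD_le], add up to alpha e; alpha is
   spent in passing from a_k to [gform]. *)
have ae0 : 0 < alpha * e / 4 by rewrite divr_gt0// mulr_gt0.
have c0 : 0 < beta ^+ 2 / alpha by rewrite divr_gt0// exprn_gt0.
have [phi_ [tphi_ cphi _ _ _]] := H10_approx Hv.
have /cvgrPdist_le/(_ _ (divr_gt0 ae0 c0))[N _ /(_ N (leqnn N))/=] := cphi.
rewrite sub0r normrN => /(le_trans (ler_norm _)).
set phi := phi_ N => phi_v; have tphi : test_function U phi := tphi_ N.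
have HphiU := H10_tp tphi; have Hphi := H10_sub_Om UOm HphiU.
have id : Om `<=` Om by [].
have [x_ xP] := recovery_exists n0 bOm alpha0 cA_ cA oOm id Hphi.
have [eta teta [K _ HK]] := recovery_cutoff n0 bOm alpha0 beta0 cA_ cA GA oU UOm tphi xP ae0.
exists K => // k /HK /= xk.
have Hw : H10 U (mulp eta (x_ k)) := H10_mulp teta (xP k).1.
have aP := aform_psd alpha0 (cA_ k).
have Ly := H10_L2pair (yP k).1; have Lx := H10_L2pair (xP k).1.
have Lw := H10_L2pair Hw.
have cea := recovery_cea k Hv yP zP Hw.
have B := recoveryB alpha0 cA_ cA id HvOm Hphi yP xP.
have b1 := recovery_bound alpha0 beta0 cA_ cA k (@subset_refl _ Om) (H10B HvOm Hphi) B.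
have b2 : gform (v - tp phi) (v - tp phi) <= alpha * e / 4 / (beta ^+ 2 / alpha).
  apply: le_trans phi_v; rewrite -opprB -scaleN1r (psd_sqrZ gP) ?sqrrN ?expr1n ?mul1r.
    exact: gform_le_sform (L2pairB (H10_L2pair HphiU) (H10_L2pair Hv)).
  exact: L2pairB (H10_L2pair HphiU) (H10_L2pair Hv).
have b3 : a_ k (y_ k - x_ k) (y_ k - x_ k) <= alpha * e / 4.
  by apply: (le_trans b1); rewrite mulrC -ler_pdivlMr.
have b4 : a_ k (y_ k - mulp eta (x_ k)) (y_ k - mulp eta (x_ k)) <= alpha * e.
  have -> : y_ k - mulp eta (x_ k) = (y_ k - x_ k) + (x_ k - mulp eta (x_ k)).
    by rewrite addrA subrK.
  apply: (le_trans (psd_sqrD_le aP (L2pairB Ly Lx) (L2pairB Lx Lw))).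
  move: b3 xk; move: (a_ k (y_ k - x_ k) _) (a_ k (x_ k - _) _) => s t *; lra.
have /andP[b5 _] := aform_H10_bounds (cA_ k) (Hd k).
rewrite sub0r normrN ger0_norm; last exact: (psd_ge0 gP (H10_L2pair (Hd k))).
rewrite -(ler_pM2l alpha0); exact: (le_trans b5 (le_trans cea b4)).
Qed.

(** A functional on H10 U is represented by some [gform w], which also acts on H10 Om. There y_k
    tends weakly to v, and y_k - z_k tends strongly to 0. *)
Lemma recovery_weak_cvg (v : pair) z_ : H10 U v -> recovery U v z_ -> weak_cvg U z_ v.
Proof.
move=> Hv zP h hH; have HvOm := H10_sub_Om UOm Hv.
have id : Om `<=` Om by [].
have [y_ yP] := recovery_exists n0 bOm alpha0 cA_ cA oOm id HvOm.
have [hlin [C C0 hC]] := (Hm1P U h).1 hH.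
have [w Hw hw] := psd_riesz (H10_psd U gP) (gform_complete n0 bOm oU UOm) hlin hC.
have Lw := H10_L2pair Hw.
have c1 := recovery_cvg alpha0 cA GA HvOm yP (Hm1_gform Om Lw).
have Hd k : H10 Om (y_ k - z_ k) := H10B (yP k).1 (H10_sub_Om UOm (zP k).1).
have c2 : (fun k => gform (y_ k - z_ k) w) @ \oo --> gform 0 w.
  apply: (cvg_psd_left (u_ := fun k => y_ k - z_ k) gP (fun k => H10_L2pair (Hd k)) (@L2pair0 R n) Lw).
  have := recovery_strong Hv yP zP; apply: cvg_trans; apply: near_eq_cvg; apply: nearW => k.
  by rewrite subr0.
rewrite (psd0l gP Lw) in c2.
have -> : (fun k => h (z_ k)) = (fun k => gform w (y_ k) - gform (y_ k - z_ k) w).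
  apply/funext => k; rewrite -(hw _ (zP k).1).
  have Ly := H10_L2pair (yP k).1; have Lz := H10_L2pair (zP k).1.
  rewrite (psdBl gP Ly Lz Lw) (psdC gP Ly Lw) (psdC gP Lz Lw).
  by rewrite opprB addrC subrK.
rewrite -(hw _ Hv) -[X in _ --> X]subr0.
by apply: cvgB.
Qed.

End G_convergence_localises.

(** * Gamma-limits *)

Section limits_inferior.
Context (R : realType).
Implicit Types (u : (\bar R)^nat) (c : \bar R).
Local Open Scope ereal_scope.

Lemma limn_esup_lt_near u c : limn_esup u < c -> \forall k \near \oo, u k < c.
Proof.
move=> /ereal_inf_lt[_ [V VF <-] Vc]; apply: filterS VF => k Vk.
by apply: le_lt_trans Vc; apply: ereal_sup_ubound; exists k.
Qed.

Lemma limn_esup_le_near u c : (\forall k \near \oo, u k <= c) -> limn_esup u <= c.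
Proof.
move=> H; apply: (@le_trans _ _ (ereal_sup (u @` [set k | u k <= c]))).
  by apply: ereal_inf_lbound; exists [set k | u k <= c].
by apply: ge_ereal_sup => _ [k kc <-].
Qed.

Lemma limn_einf_lt_often u c : limn_einf u < c ->
  forall K, exists2 k, (K <= k)%N & u k < c.
Proof.
move=> uc K; apply: contrapT => H; move: uc; apply/negP; rewrite -leNgt leeNr.
apply: limn_esup_le_near; exists K => // k /= Kk; rewrite leeNl oppeK.
by rewrite leNgt; apply/negP => ukc; apply: H; exists k.
Qed.

Lemma limn_einf_le_often u c :
  (forall K, exists2 k, (K <= k)%N & u k <= c) -> limn_einf u <= c.
Proof.
move=> H; rewrite leNgt; apply/negP; rewrite lteNr => /limn_esup_lt_near[K _ HK].
have [k Kk] := H K; apply/negP; rewrite -ltNge.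
by have := HK k Kk; rewrite lteNl oppeK.
Qed.

(** Comparison through real upper bounds with an error e, the form in which the estimates on the
    Gamma-limits come; infinite values are covered. *)
Lemma eq_shift_ereal (G I : \bar R) (x : R) :
  (forall c e : R, (0 < e)%R -> I < c%:E -> G <= (x + c + e)%:E) ->
  (forall c e : R, (0 < e)%R -> G < c%:E -> I <= (c - x + e)%:E) ->
  G = x%:E + I.
Proof.
(* One inequality, applied with r = x and with r = - x. When X = -oo, arbitrary choices of c force Y
   = -oo. *)
have key (X Y : \bar R) (r : R) :
    (forall c e : R, (0 < e)%R -> X < c%:E -> Y <= (r + c + e)%:E) -> Y <= r%:E + X.
  case: X => [X||] H; last first.
  - rewrite addeNy leeNy_eq; apply/eqP.
    case: Y H => [Y||] H //; last first.
      have := H 0%R 1%R ltr01 (ltNyr _); by rewrite leye_eq.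
    have : (Y <= r + (Y - r - 2) + 1)%R by rewrite -lee_fin; apply: H => //; exact: ltNyr.
    by clear H => ?; exfalso; lra.
  - by rewrite addey// leey.
  - case: Y H => [Y||] H; [|by have := H (X + 1)%R 1%R ltr01; rewrite lte_fin ltrDl ltr01 => /(_ isT)|by rewrite leNye].
    rewrite -EFinD lee_fin; apply/ler_addgt0Pr => e e0.
    have e20 : (0 < e / 2)%R by rewrite divr_gt0.
    have := H (X + e / 2)%R _ e20; rewrite lte_fin ltrDl e20 => /(_ isT).
    by rewrite lee_fin; clear H => ?; lra.
move=> H1 H2; apply/eqP; rewrite eq_le; apply/andP; split; first exact: key.
have : I <= (- x)%R%:E + G by apply: key => c e e0 /(H2 c e e0); rewrite [(c - x)%R]addrC.
rewrite -(@leeD2lE _ x%:E)// addeA -EFinD subrr add0e.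
by [].
Qed.

End limits_inferior.

(** Diagonal extraction for the limsup: the level [m_ k] is the largest i <= k whose threshold
    [K_ i] has been reached. *)
Lemma near_diagonal (P : nat -> nat -> Prop) :
  (forall m, \forall k \near \oo, P m k) ->
  exists m_ : nat -> nat, (forall m, \forall k \near \oo, (m <= m_ k)%N) /\
    \forall k \near \oo, P (m_ k) k.
Proof.
move=> H; have /choice[K_ KP] : forall m, exists K, forall k, (K <= k)%N -> P m k.
  by move=> m; have [K _ HK] := H m; exists K => k; exact: HK.
exists (fun k => \max_(i < k.+1 | (K_ i <= k)%N) i); split.
  move=> m; exists (maxn m (K_ m)) => // k /=; rewrite geq_max => /andP[mk Kk].
  exact: (@leq_bigmax_cond _ (fun i : 'I_k.+1 => (K_ i <= k)%N) _ (Ordinal (mk : (m < k.+1)%N))).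
(* For k >= K_0 the index 0 is admissible, so the maximum is attained at an admissible index. *)
exists (K_ 0) => // k /= K0; apply: KP.
have [|i Ki ->//] := @eq_bigmax_cond 'I_k.+1 [pred i : 'I_k.+1 | (K_ i <= k)%N] (fun i => i).
by apply/card_gt0P; exists ord0.
Qed.

(** Diagonal extraction for the liminf, where each level holds only for infinitely many k. The level
    rises by one each time P holds at the current level; were this to stop, the level would be
    constant from some rank on, against the hypothesis at that level. *)
Lemma often_diagonal (P : nat -> nat -> Prop) :
  (forall m K, exists2 k, (K <= k)%N & P m k) ->
  exists m_ : nat -> nat, (forall m, \forall k \near \oo, (m <= m_ k)%N) /\
    forall K, exists2 k, (K <= k)%N & P (m_ k) k.
Proof.
move=> H; pose m_ := fix m_ k := if k is k'.+1 then
  if `[< P (m_ k') k' >] then (m_ k').+1 else m_ k' else 0%N.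
have mono : {homo m_ : i j / (i <= j)%N}.
  apply: homo_leq => [i|j i k|k /=]; [exact: leqnn|exact: leq_trans|].
  by case: ifP.
have often K : exists2 k, (K <= k)%N & P (m_ k) k.
  apply: contrapT => N.
  have const i : m_ (K + i)%N = m_ K.
    elim: i => [|i IH]; first by rewrite addn0.
    rewrite addnS /=; case: asboolP => //= P'; exfalso; apply: N.
    by exists (K + i)%N => //; exact: leq_addr.
  have [k Kk Pk] := H (m_ K) K; apply: N; exists k => //.
  by rewrite -(subnKC Kk) const subnKC.
exists m_; split => //; elim=> [|m [K _ HK]]; first by exists 0%N.
have [k Kk Pk] := often K; exists k.+1 => // j /= kj.
apply: leq_trans (mono _ _ kj) => /=; case: asboolP => // _.
exact: HK.
Qed.

(** * Equi-coercivity and weak neighbourhoods *)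

Section coercivity.
Context (R : realType) (n : nat).
Local Notation mu := (lebesgue_rV R n).
Local Notation L2 := (Lfun mu 2%:E).
Local Notation pair := (sobolev_pair R n).
Local Notation gP := (@gform_psd R n).

(** Homogeneity reduces to the unit ball, over which [Hm1_norm] is the supremum. A u of zero energy
    cannot be normalised, but f vanishes at it by boundedness. *)
Lemma Hm1_norm_sqr_le (U : set 'rV[R]_n) (f : pair -> R) (u : pair) (C : R) :
  Hm1 U f -> Hm1_norm U f <= C -> H10 U u -> f u ^+ 2 <= C ^+ 2 * gform u u.
Proof.
move=> hf fC Hu; have [flin [D D0 fD]] := (Hm1P U f).1 hf.
have g0 := psd_ge0 gP (H10_L2pair Hu).
have [gu0|gn0] := eqVneq (gform u u) 0.
  by have := fD _ Hu; rewrite gu0 !mulr0.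
have {gn0}gu : 0 < gform u u by rewrite lt_neqAle eq_sym gn0.
set N := H10_norm U u.
have N2 : N ^+ 2 = gform u u by exact: H10_sqr_norm.
have N0 : 0 < N.
  by rewrite lt_neqAle sqrtr_ge0 andbT eq_sym -sqrf_eq0 N2 gt_eqF.
have HZ : H10 U (N^-1 *: u) by exact: (psdXZ (H10_psd U gP)).
have fZ : f (N^-1 *: u) = N^-1 * f u.
  by have := flin N^-1 u 0 Hu (@H10_0 R n U); rewrite addr0 (Hm1_0 hf) addr0.
have NZ : H10_norm U (N^-1 *: u) <= 1.
  rewrite -[leRHS](expr1n _ 1) -ler_sqr ?nnegrE ?sqrtr_ge0// expr1n.
  rewrite (H10_sqr_norm HZ) (psd_sqrZ gP _ (H10_L2pair Hu)) -N2 -exprMn.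
  by rewrite mulVf ?expr1n// gt_eqF.
have : `|f (N^-1 *: u)| <= C.
  apply: le_trans fC; apply: sup_ubound; last by exists (N^-1 *: u).
  (* An upper bound of the set, without which its [sup] would carry no information. *)
  exists (Num.sqrt D) => _ [w [Hw w1] <-].
  rewrite -ler_sqr ?nnegrE ?sqrtr_ge0// real_normK ?num_real// sqr_sqrtr//.
  apply: (le_trans (fD _ Hw)); rewrite -(H10_sqr_norm Hw) ler_piMr//.
  by rewrite expr_le1// sqrtr_ge0.
rewrite fZ normrM gtr0_norm ?invr_gt0// ler_pdivrMl// => fN.
rewrite -N2 -exprMn -(@real_normK _ (f u)) ?num_real// ler_sqr ?nnegrE//.
  by rewrite mulrC.
by apply: (le_trans (normr_ge0 (f u))); rewrite mulrC.
Qed.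

Variables (Om : set 'rV[R]_n) (alpha beta : R).
Variables (A_ : nat -> 'rV[R]_n -> 'M[R]_n).
Hypotheses (n0 : (0 < n)%N) (bOm : bounded_set Om) (alpha0 : 0 < alpha)
  (cA_ : forall k, coefficient_class Om alpha beta (A_ k)).
Variables (f_ : nat -> pair -> R) (C : R).
Hypotheses (Hf_ : forall k, Hm1 Om (f_ k)) (fC : forall k, Hm1_norm Om (f_ k) <= C).
Variable U : set 'rV[R]_n.
Hypotheses (oU : open U) (UOm : U `<=` Om).
Local Notation F_ k := (energy (A_ k) (f_ k) U).

Lemma energyE (B : 'rV[R]_n -> 'M[R]_n) (f : pair -> R) (u : pair) : H10 U u ->
  energy B f U u = 2^-1 * aform Om B u u - f u.
Proof. by move=> Hu; rewrite /energy (bilinE _ _ UOm)//; exact: H10_zero_off Hu. Qed.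

(** Young's inequality bounds f_k u by alpha G / 4 + C^2 / alpha, where G is the energy of u, and so
    absorbs it into half of the quadratic part alpha G / 2. *)
Lemma energy_coercive k (u : pair) (c : R) : H10 U u -> F_ k u <= c ->
  gform u u <= 4 / alpha * (c + C ^+ 2 / alpha).
Proof.
move=> Hu; rewrite energyE// => Fc; have HuOm := H10_sub_Om UOm Hu.
have fu := Hm1_norm_sqr_le (Hf_ k) (fC k) HuOm.
have /andP[au _] := aform_H10_bounds (cA_ k) HuOm.
have g0 := psd_ge0 gP (H10_L2pair Hu).
set G := gform u u in fu au g0 *; set t := f_ k u in fu Fc.
set D := C ^+ 2 in fu *; have D0 : 0 <= D by exact: sqr_ge0.
(* Otherwise t ^ 2 > 4 (alpha G / 4) (D / alpha) = D G. *)
have tle : t <= alpha / 4 * G + D / alpha.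
  rewrite leNgt; apply/negP => lt_t.
  have s0 : 0 <= alpha / 4 * G by rewrite mulr_ge0// divr_ge0// ltW.
  have r0 : 0 <= D / alpha by rewrite divr_ge0// ltW.
  have DG : D * G = 4 * (alpha / 4 * G) * (D / alpha) by field; rewrite gt_eqF.
  move: fu lt_t; rewrite DG; move: (alpha / 4 * G) (D / alpha) s0 r0 => s r s0 r0 fu lt_t.
  have : (s + r) ^+ 2 < t ^+ 2.
    by rewrite ltr_sqr// ?nnegrE ?addr_ge0// (le_trans _ (ltW lt_t))// addr_ge0.
  have := sqr_ge0 (s - r); move: fu; rewrite !expr2; lra.
rewrite -ler_pdivrMl; last by rewrite divr_gt0.
rewrite invf_div (_ : alpha / 4 * G = alpha * G / 4); last by ring.
move: tle Fc au; rewrite (_ : alpha / 4 * G = alpha * G / 4); last by ring.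
move: (D / alpha) (alpha * G) (aform _ _ _ _) => r s a; lra.
Qed.

(** On sets of bounded energy, the finitely many linear forms of the inequality of Rellich define a
    weak neighbourhood that is small in L^2. This lets sequences of neighbourhoods be used in the
    weak topology. *)
Lemma weak_nbhs_L2 (v : pair) (B d : R) : H10 U v -> 0 < d ->
  exists2 N, weak_nbhs U v N &
    forall w, N w -> gform w w <= B -> ip mu (w - v).1 (w - v).1 <= d.
Proof.
move=> Hv d0; have [P P0 HP] := poincare_U n0 bOm UOm.
have ipP := ip_form mu.
pose B' := 2 * `|B| + 2 * gform v v.
have B'0 : 0 <= B' by rewrite addr_ge0 ?mulr_ge0// (psd_ge0 gP (H10_L2pair Hv)).
have e0 : 0 < d / 2 / (B' + 1) by rewrite !divr_gt0// ltr_wpDl.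
have [s [D [D0 sL HR]]] := rellich_inequality bOm e0.
pose q := D * (size s)%:R; have q0 : 0 <= q by rewrite mulr_ge0.
(* With r <= 1, a number smaller than r in absolute value has a square of at most r; the other bound
   gives q r <= d / 2. *)
pose r : R := Num.min 1 (d / 2 / (q + 1)).
have r0 : 0 < r by rewrite lt_min ltr01/= !divr_gt0// ltr_wpDl.
have sL' (i : 'I_(size s)) : s`_i \in L2 by apply: sL; exact: mem_nth.
pose h (i : 'I_(size s)) (u : pair) := ip mu u.1 s`_i.
have hH i : Hm1 U (h i) by exact: Hm1_ip P0 HP (sL' i).
exists [set w | H10 U w /\ forall i, `|h i w - h i v| < r].
  by split=> [w []//|]; exists (size s), h, r; split.
move=> w [Hw hw] wB; have HB := H10B Hw Hv.
apply: (le_trans (HR _ (H10_sub_Om UOm HB))).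
have gB : gform (w - v) (w - v) <= B'.
  have := psd_sqrB_le gP (H10_L2pair Hw) (H10_L2pair Hv).
  have := ler_norm B; rewrite /B'; lra.
have sumle : \sum_(z <- s) ip mu (w - v).1 z ^+ 2 <= (size s)%:R * r.
  rewrite (big_nth 0) big_mkord.
  apply: (@le_trans _ _ (\sum_(i < size s) r)); last first.
    by rewrite sumr_const card_ord mulr_natl.
  apply: ler_sum => i _.
  have -> : ip mu (w - v).1 s`_i = h i w - h i v by exact: (Hm1B (hH i) Hw Hv).
  have hr := hw i; have r1 : r <= 1 by rewrite ge_min lexx.
  rewrite -real_normK ?num_real// expr2.
  have n0' := normr_ge0 (h i w - h i v).
  move: (`|h i w - h i v|) hr n0' => y hr n0'; nra.
have b1 : D * \sum_(z <- s) ip mu (w - v).1 z ^+ 2 <= d / 2.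
  apply: (le_trans (ler_wpM2l D0 sumle)); rewrite mulrA -/q.
  apply: (@le_trans _ _ (q * (d / 2 / (q + 1)))).
    by rewrite ler_wpM2l// ge_min lexx orbT.
  rewrite mulrCA ger_pMr ?divr_gt0// ler_pdivrMr ?ltr_wpDl// mul1r.
  by rewrite lerDl.
have b2 : d / 2 / (B' + 1) * gform (w - v) (w - v) <= d / 2.
  apply: (le_trans (ler_wpM2l (ltW e0) gB)).
  rewrite mulrAC -mulrA ger_pMr ?divr_gt0// ler_pdivrMr ?ltr_wpDl// mul1r.
  by rewrite lerDl.
by rewrite [leRHS](splitr d); exact: lerD.
Qed.

End coercivity.

(** * The Gamma-liminf and the Gamma-limsup *)

Section gamma_limit.
Context (R : realType) (n : nat).
Local Notation mu := (lebesgue_rV R n).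
Local Notation pair := (sobolev_pair R n).
Local Notation gP := (@gform_psd R n).
Variables (Om : set 'rV[R]_n) (alpha beta : R).
Variables (A_ : nat -> 'rV[R]_n -> 'M[R]_n) (A : 'rV[R]_n -> 'M[R]_n).
Hypotheses (n0 : (0 < n)%N) (oOm : open Om) (bOm : bounded_set Om)
  (alpha0 : 0 < alpha) (beta0 : 0 < beta)
  (cA_ : forall k, coefficient_class Om alpha beta (A_ k))
  (cA : coefficient_class Om alpha beta A) (GA : G_cvg Om A_ A).
Variables (f_ : nat -> pair -> R) (g : pair -> R) (C : R).
Hypotheses (Hf_ : forall k, Hm1 Om (f_ k)) (fC : forall k, Hm1_norm Om (f_ k) <= C)
  (gL : limit_rhs Om A_ A f_ g).
Variable U : set 'rV[R]_n.
Hypotheses (oU : open U) (UOm : U `<=` Om).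
Local Notation F_ := (fun k => energy (A_ k) (f_ k) U).
Local Notation F0 := (energy A g U).
Local Notation a_ k := (aform Om (A_ k)).
Local Notation a := (aform Om A).
Local Notation recovery := (recovery Om A_ A).

Lemma energy_shift_cvg (v : pair) (z_ y_ : nat -> pair) : H10 U v -> recovery U v z_ ->
  weakly_null U y_ ->
  (fun k => energy (A_ k) (f_ k) U (z_ k + y_ k) - energy (A_ k) (f_ k) U (y_ k))
    @ \oo --> F0 v.
Proof.
move=> Hv zP [Hy cy]; have Hz k : H10 U (z_ k) := (zP k).1.
have HvOm := H10_sub_Om UOm Hv.
have aP := aform_psd alpha0 cA.
have /choice[w_ wP] : forall k, exists u, solution (A_ k) (f_ k) U u.
  by move=> k; exact: (solution_exists n0 bOm alpha0 (cA_ k) oU UOm (Hm1_subset UOm (Hf_ k))).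
have [w wS] := solution_exists n0 bOm alpha0 cA oU UOm (Hm1_subset UOm gL.1).
have cw := gL.2 U oU UOm w_ w wP wS.
have cz := recovery_weak_cvg n0 oOm bOm alpha0 beta0 cA_ cA GA oU UOm Hv zP.
have hv : Hm1 U (a v) := Hm1_aform alpha0 cA UOm HvOm.
(* The term [a v 0], equal to 0, is the limit of [a v (y_ k)]; it is kept so that the limit is taken
   term by term. *)
have -> : F0 v = 2^-1 * a v v + a v 0 - a v w.
  rewrite (energyE UOm A g Hv) (Hm1_0 hv) addr0; congr (_ - _).
  have [Hw ww] := (solutionP A UOm g w).1 wS.
  by rewrite -(ww v Hv); exact: (psdC aP (H10_L2pair Hw) (H10_L2pair Hv)).
have -> : (fun k => energy (A_ k) (f_ k) U (z_ k + y_ k) - energy (A_ k) (f_ k) U (y_ k)) =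
    (fun k => 2^-1 * a v (z_ k) + a v (y_ k) - a v (w_ k)).
  apply/funext => k; have Lz := H10_L2pair (Hz k); have Ly := H10_L2pair (Hy k).
  have akP := aform_psd alpha0 (cA_ k).
  rewrite (energyE UOm (A_ k) (f_ k) (H10D (Hz k) (Hy k))) (energyE UOm (A_ k) (f_ k) (Hy k)).
  rewrite (Hm1D (Hm1_subset UOm (Hf_ k)) (Hz k) (Hy k)) (psd_sqrD akP Lz Ly).
  rewrite ((zP k).2 _ (Hz k)) ((zP k).2 _ (Hy k)).
  have [Hw ww] := (solutionP (A_ k) UOm (f_ k) (w_ k)).1 (wP k).
  have -> : f_ k (z_ k) = a v (w_ k).
    by rewrite -(ww _ (Hz k)) (psdC akP (H10_L2pair Hw) Lz) ((zP k).2 _ Hw).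
  by field.
apply: cvgB; last exact: (cw _ hv).
apply: cvgD; last exact: (cy _ hv).
by apply: cvgM; [exact: cvg_cst|exact: (cz _ hv)].
Qed.

Lemma weak_nbhs_near (v : pair) (x_ : nat -> pair) N : (forall k, H10 U (x_ k)) ->
  weak_cvg U x_ v -> weak_nbhs U v N -> \forall k \near \oo, N (x_ k).
Proof.
move=> Hx cx [_ [m [h [e [hH e0 hN]]]]].
have : \forall k \near \oo, forall i, `|h i (x_ k) - h i v| < e.
  apply: filter_forall => i; have /cvgrPdist_lt/(_ _ e0) := cx _ (hH i).
  by apply: filterS => k; rewrite distrC.
by apply: filterS => k; exact: hN.
Qed.

Lemma weak_cvgD (v : pair) (z_ y_ : nat -> pair) : (forall k, H10 U (z_ k)) ->
  weak_cvg U z_ v -> weakly_null U y_ -> weak_cvg U (fun k => z_ k + y_ k) v.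
Proof.
move=> Hz cz [Hy cy] h hH.
rewrite (_ : (fun k => _) = fun k => h (z_ k) + h (y_ k)); last first.
  by apply/funext => k; exact: (Hm1D hH (Hz k) (Hy k)).
rewrite -[h v]addr0 -(Hm1_0 hH); apply: cvgD; [exact: cz|exact: cy].
Qed.

(** The translate z_k + y_k lies eventually in the weak neighbourhood N of v, and its energy exceeds
    that of y_k by F0 v up to e. *)
Lemma energy_inf_shift (v : pair) (y_ : nat -> pair) N (e : R) : H10 U v ->
  weakly_null U y_ -> weak_nbhs U v N -> 0 < e ->
  \forall k \near \oo, (ereal_inf [set (F_ k w)%:E | w in N] <=
    (F_ k (y_ k) + F0 v + e)%:E)%E.
Proof.
move=> Hv yN NN e0; have HvOm := H10_sub_Om UOm Hv.
have [z_ zP] := recovery_exists n0 bOm alpha0 cA_ cA oU UOm HvOm.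
have Hz k : H10 U (z_ k) := (zP k).1.
have cz := recovery_weak_cvg n0 oOm bOm alpha0 beta0 cA_ cA GA oU UOm Hv zP.
have /cvgrPdist_le/(_ _ e0) := energy_shift_cvg Hv zP yN.
have := weak_nbhs_near (fun k => H10D (Hz k) (yN.1 k)) (weak_cvgD Hz cz yN) NN.
apply: filterS2 => k /= Nk ck.
apply: (@le_trans _ _ (F_ k (z_ k + y_ k))%:E).
  by apply: ereal_inf_lbound; exists (z_ k + y_ k).
rewrite lee_fin; move: ck; rewrite ler_norml => /andP[c1 _].
move: c1; move: (energy _ _ _ _) (energy _ _ _ _) (energy _ _ _ _) => p q r; lra.
Qed.

Lemma Gamma_liminf_le (v : pair) (c e : R) : H10 U v -> 0 < e ->
  (- nu' U F_ < c%:E)%E -> (Gamma_liminf U F_ v <= (F0 v + c + e)%:E)%E.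
Proof.
move=> Hv e0; rewrite oppeK => /ereal_inf_lt[_ [y_ yN <-] yc].
apply: ge_ereal_sup => _ [N NN <-]; apply: limn_einf_le_often => K.
have [K' _ HK] := energy_inf_shift Hv yN NN e0.
have [k Kk yk] := limn_einf_lt_often yc (maxn K K').
move: Kk; rewrite geq_max => /andP[Kk Kk']; exists k => //.
apply: (le_trans (HK k Kk')); move: yk; rewrite lte_fin lee_fin; lra.
Qed.

Lemma Gamma_limsup_le (v : pair) (c e : R) : H10 U v -> 0 < e ->
  (- nu'' U F_ < c%:E)%E -> (Gamma_limsup U F_ v <= (F0 v + c + e)%:E)%E.
Proof.
move=> Hv e0; rewrite oppeK => /ereal_inf_lt[_ [y_ yN <-] yc].
apply: ge_ereal_sup => _ [N NN <-]; apply: limn_esup_le_near.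
apply: filterS2 (energy_inf_shift Hv yN NN e0) (limn_esup_lt_near yc) => k h.
rewrite lte_fin => yk; apply: (le_trans h); rewrite lee_fin; lra.
Qed.

(** A point witnessing that an infimum over a weak neighbourhood of v is below c, the neighbourhood
    being remembered through an L^2 distance only. *)
Let competitor (v : pair) (c : R) m k (w : pair) := [/\ H10 U w, F_ k w < c &
  ip mu (w - v).1 (w - v).1 <= m.+1%:R^-1].

Lemma competitor_nbhs (v : pair) (c : R) m : H10 U v ->
  exists2 N, weak_nbhs U v N & forall k,
    (ereal_inf [set (F_ k w)%:E | w in N] < c%:E)%E -> exists w, competitor v c m k w.
Proof.
move=> Hv; have m0 : (0 : R) < m.+1%:R^-1 by rewrite invr_gt0.
have [N NN HN] := weak_nbhs_L2 n0 bOm UOm (4 / alpha * (c + C ^+ 2 / alpha)) Hv m0.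
exists N => // k /ereal_inf_lt[_ [w Nw <-]]; rewrite lte_fin => wc.
have Hw := NN.1 _ Nw; exists w; split => //; apply: HN => //.
exact: (energy_coercive alpha0 cA_ Hf_ fC UOm Hw (ltW wc)).
Qed.

(* The sequence is w_k - z_k at the indices having a competitor w_k, and 0 at the
   other ones. *)
Lemma competitor_weakly_null (v : pair) (c e : R) (m_ : nat -> nat) : H10 U v -> 0 < e ->
  (forall m, \forall k \near \oo, (m <= m_ k)%N) ->
  exists2 y_, weakly_null U y_ & \forall k \near \oo,
    (exists w, competitor v c (m_ k) k w) -> F_ k (y_ k) <= c - F0 v + e.
Proof.
move=> Hv e0 mP; have HvOm := H10_sub_Om UOm Hv.
have [z_ zP] := recovery_exists n0 bOm alpha0 cA_ cA oU UOm HvOm.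
have Hz k : H10 U (z_ k) := (zP k).1.
have cz := recovery_weak_cvg n0 oOm bOm alpha0 beta0 cA_ cA GA oU UOm Hv zP.
have /choice[y_ yP] : forall k, exists y : pair,
    if `[< exists w, competitor v c (m_ k) k w >]
    then competitor v c (m_ k) k (z_ k + y) /\ H10 U y else y = 0.
  move=> k; case: asboolP => [[w cw]|_]; last by exists 0.
  have [Hw _ _] := cw; exists (w - z_ k); split; last exact: H10B Hw (Hz k).
  by rewrite addrC subrK.
have Hy k : H10 U (y_ k).
  by move: (yP k); case: asboolP => [_ []//|_ ->]; exact: H10_0.
have gz k := recovery_gform_bound alpha0 beta0 cA_ cA k UOm HvOm zP.
set B1 := beta ^+ 2 / alpha / alpha * gform v v in gz.
have B10 : 0 <= B1 by apply: le_trans (gz 0); exact: (psd_ge0 gP (H10_L2pair (Hz 0))).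
pose B2 := 4 / alpha * (c + C ^+ 2 / alpha).
have ipP := ip_form mu; have L u (Hu : H10 U u) := H10_L2pair Hu.
have gy k : gform (y_ k) (y_ k) <= 2 * `|B2| + 2 * B1.
  move: (yP k); case: asboolP => [_ [[Hw wc _] _]|_ ->]; last first.
    rewrite (psd0l gP (L2pair0 R n)); apply: addr_ge0.
      by rewrite pmulr_rge0.
    by rewrite pmulr_rge0.
  have gw := energy_coercive alpha0 cA_ Hf_ fC UOm Hw (ltW wc).
  rewrite (_ : y_ k = (z_ k + y_ k) - z_ k); last by rewrite addrC addKr.
  have := psd_sqrB_le gP (L _ Hw) (L _ (Hz k)).
  have := gz k; have := ler_norm B2; move: gw; rewrite -/B2; lra.
have czv : (fun k => ip mu (z_ k - v).1 (z_ k - v).1) @ \oo --> (0 : R).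
  have czv0 := (weak_cvgB Hz Hv).1 cz.
  apply: (@weak_cvg_L2 _ _ Om (fun k => z_ k - v) (2 * B1 + 2 * gform v v) n0 bOm).
  - by move=> k; have := H10_sub_Om UOm (H10B (Hz k) Hv).
  - move=> k; have := psd_sqrB_le gP (L _ (Hz k)) (L _ Hv).
    have := gz k; lra.
  - by move=> h hH; exact: czv0 (Hm1_subset UOm hH).
have cy : (fun k => ip mu (y_ k).1 (y_ k).1) @ \oo --> (0 : R).
  (* The sequence is the difference of w_k - v and z_k - v, each of squared norm at most d / 4 for
     large k, and [psd_sqrB_le] doubles both. *)
  apply/cvgrPdist_le => d d0; have d40 : 0 < d / 4 by rewrite divr_gt0.
  have /cvgrPdist_le/(_ _ d40) := czv.
  have [m md] : exists m : nat, m.+1%:R^-1 <= d / 4.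
    have /cvgrPdist_le/(_ _ d40)[m _ Hm] := @cvg_harmonic R.
    exists m; have := Hm m (leqnn m); rewrite /= sub0r normrN ger0_norm//.
  apply: filterS2 (mP m) => k mk; rewrite !sub0r !normrN !ger0_norm ?ip_ge0// => zk.
  move: (yP k); case: asboolP => [_ [[Hw _ wv] _]|_ ->]; last first.
    by rewrite (psd0l ipP (L2pair0 R n).1) ltW.
  rewrite (_ : (y_ k).1 = ((z_ k + y_ k) - v).1 - (z_ k - v).1); last first.
    by rewrite -[LHS]/(y_ k).1 {1}(_ : y_ k = z_ k + y_ k - v - (z_ k - v))// opprB addrA subrK addrC addKr.
  have [Lw _] := L _ (H10B Hw Hv); have [Lz _] := L _ (H10B (Hz k) Hv).
  have mk' : (m_ k).+1%:R^-1 <= d / 4.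
    by apply: le_trans md; rewrite lef_pV2 ?posrE// ler_nat ltnS.
  move: zk (le_trans wv mk') Lw Lz.
  move: (z_ k + y_ k - v).1 (z_ k - v).1 => p q q4 p4 Lp Lq.
  apply: (le_trans (psd_sqrB_le ipP Lp Lq)).
  move: (ip mu p p) (ip mu q q) p4 q4 => x y; lra.
have [P P0 HP] := poincare_U n0 bOm UOm.
have yN : weakly_null U y_.
  split=> //; apply: L2_weak_cvg HP Hy gy cy; exact: open_measurable_rV.
exists y_ => //; have /cvgrPdist_le/(_ _ e0) := energy_shift_cvg Hv zP yN.
apply: filterS => k /= ck ex; move: (yP k); case: asboolP => // _ [[_ wc _] _].
move: ck wc; rewrite ler_norml => /andP[_].
move: (energy _ _ _ _) (energy _ _ _ _) (energy _ _ _ _) => p q r; lra.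
Qed.

(** A Gamma-liminf below c gives, for each level m, competitors at infinitely many k. The diagonal
    keeps infinitely many of them while the level tends to infinity, and this is enough for a
    liminf; the limsup needs them at all large k, hence [near_diagonal] there. *)
Lemma Gamma_liminf_ge (v : pair) (c e : R) : H10 U v -> 0 < e ->
  (Gamma_liminf U F_ v < c%:E)%E -> (- nu' U F_ <= (c - F0 v + e)%:E)%E.
Proof.
move=> Hv e0 Gc.
have often m K : exists2 k, (K <= k)%N & exists w, competitor v c m k w.
  have [N NN HN] := competitor_nbhs c m Hv.
  have Nc : (limn_einf (fun k => ereal_inf [set (F_ k w)%:E | w in N]) < c%:E)%E.
    by apply: le_lt_trans Gc; apply: ereal_sup_ubound; exists N.
  by have [k Kk /HN ?] := limn_einf_lt_often Nc K; exists k.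
have [m_ [mP mO]] := often_diagonal often.
have [y_ yN [K' _ yc]] := competitor_weakly_null c Hv e0 mP.
rewrite oppeK; apply: (@le_trans _ _ (limn_einf (fun k => (F_ k (y_ k))%:E))).
  by apply: ereal_inf_lbound; exists y_.
apply: limn_einf_le_often => K; have [k Kk Pk] := mO (maxn K K').
move: Kk; rewrite geq_max => /andP[Kk Kk']; exists k => //.
by rewrite lee_fin; exact: yc.
Qed.

Lemma Gamma_limsup_ge (v : pair) (c e : R) : H10 U v -> 0 < e ->
  (Gamma_limsup U F_ v < c%:E)%E -> (- nu'' U F_ <= (c - F0 v + e)%:E)%E.
Proof.
move=> Hv e0 Gc.
have near m : \forall k \near \oo, exists w, competitor v c m k w.
  have [N NN HN] := competitor_nbhs c m Hv.
  have Nc : (limn_esup (fun k => ereal_inf [set (F_ k w)%:E | w in N]) < c%:E)%E.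
    by apply: le_lt_trans Gc; apply: ereal_sup_ubound; exists N.
  by apply: filterS (limn_esup_lt_near Nc) => k /HN.
have [m_ [mP mO]] := near_diagonal near.
have [y_ yN yc] := competitor_weakly_null c Hv e0 mP.
rewrite oppeK; apply: (@le_trans _ _ (limn_esup (fun k => (F_ k (y_ k))%:E))).
  by apply: ereal_inf_lbound; exists y_.
apply: limn_esup_le_near; apply: filterS2 mO yc => k Pk yc.
by rewrite lee_fin; exact: yc.
Qed.

Lemma Gamma_liminfE (v : pair) : H10 U v ->
  Gamma_liminf U F_ v = ((F0 v)%:E - nu' U F_)%E.
Proof.
by move=> Hv; apply: eq_shift_ereal => c e e0; [exact: Gamma_liminf_le|exact: Gamma_liminf_ge].
Qed.

Lemma Gamma_limsupE (v : pair) : H10 U v ->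
  Gamma_limsup U F_ v = ((F0 v)%:E - nu'' U F_)%E.
Proof.
by move=> Hv; apply: eq_shift_ereal => c e e0; [exact: Gamma_limsup_le|exact: Gamma_limsup_ge].
Qed.

End gamma_limit.

Theorem corollary3p4 (R : realType) (n : nat) (n_gt0 : (0 < n)%N)
    (Om : set 'rV[R]_n) (Om_open : open Om) (Om_bounded : bounded_set Om)
    (alpha beta : R) (alpha_gt0 : 0 < alpha) (alpha_beta : alpha <= beta)
    (A_ : nat -> 'rV[R]_n -> 'M[R]_n) (A : 'rV[R]_n -> 'M[R]_n)
    (coef_A_ : forall k, coefficient_class Om alpha beta (A_ k))
    (coef_A : coefficient_class Om alpha beta A)
    (GA : G_cvg Om A_ A)
    (f_ : nat -> sobolev_pair R n -> R) (Hm1_f_ : forall k, Hm1 Om (f_ k))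
    (f_bounded : exists C : R, forall k, Hm1_norm Om (f_ k) <= C)
    (g : sobolev_pair R n -> R) (gP : limit_rhs Om A_ A f_ g)
    (U : set 'rV[R]_n) (U_open : open U) (U_Om : U `<=` Om) :
  let F_ := fun k => energy (A_ k) (f_ k) U in
  let F0 := energy A g U in
  (Gamma_cvg U F_ <-> nu' U F_ = nu'' U F_) /\
  (Gamma_cvg U F_ ->
    Gamma_limit U F_ (fun v => ((F0 v)%:E - nu' U F_)%E) /\
    Gamma_limit U F_ (fun v => ((F0 v)%:E - nu'' U F_)%E)).
Proof.
move=> F_ F0; have [C fC] := f_bounded.
have beta_gt0 := lt_le_trans alpha_gt0 alpha_beta.
have infE v (Hv : H10 U v) := Gamma_liminfE n_gt0 Om_open Om_bounded alpha_gt0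
  beta_gt0 coef_A_ coef_A GA Hm1_f_ fC gP U_open U_Om Hv.
have supE v (Hv : H10 U v) := Gamma_limsupE n_gt0 Om_open Om_bounded alpha_gt0
  beta_gt0 coef_A_ coef_A GA Hm1_f_ fC gP U_open U_Om Hv.
have iff : Gamma_cvg U F_ <-> nu' U F_ = nu'' U F_.
  split=> [H|E v Hv]; last by rewrite infE// supE// -/F_ E.
  (* At v = 0 the real number F0 0 can be cancelled in the extended reals, whatever nu' and nu''
     are. *)
  have := H _ (@H10_0 R n U); rewrite infE; last exact: H10_0.
  rewrite supE; last exact: H10_0.
  move=> /(congr1 (fun x => (- (F0 0))%R%:E + x)%E); rewrite !addeA -EFinD addNr !add0e.
  by move=> /(congr1 (fun x => - x)%E); rewrite !oppeK.
split=> // /iff E; split=> v Hv; first by rewrite infE// supE// -/F_ E.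
by rewrite infE// supE// -/F_ E.
Qed.
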